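(* Let $\alpha\in\mathbb{R}$ be Diophantine of type $\kappa$, let $\varphi_N(z)=\frac{(z-\alpha)^2}{2N}$, and fix $$\eta\in\left(\max\left(\tfrac{17}{18},\,1-\tfrac{2}{9\kappa}\right),\,1\right].$$ There exists $s=s(\kappa,\eta)>0$ such that for any bounded intervals $A,B_1,B_2\subset\mathbb{R}$, $$\frac{1}{M^{\eta}}\sum_{M\le N\le M+M^{\eta}}R_{2,N}(A,B_1,B_2;\varphi_N)=|A|\,|B_1|\,|B_2|+O\left(M^{-s}\right)$$ as $M\to\infty$, where the sum runs over integers $N$ and the implied constant in the remainder depends on $\alpha,\eta,A,B_1$ and $B_2$.
   Context: An irrational $\alpha\in\mathbb{R}$ is Diophantine of type $\kappa>0$ if there exists $C>0$ such that $\left|\alpha-\frac{p}{q}\right|>\frac{C}{q^{\kappa}}$ for all $p\in\mathbb{Z}$, $q\in\mathbb{N}$ (necessarily $\kappa\ge2$). For bounded intervals $A,B_1,B_2\subset\mathbb{R}$ and a function $\varphi$, set $$R_{2,N}(A,B_1,B_2;\varphi)=\frac{\#\{(i,j)\in\mathbb{Z}^2 : i\ne j,\ \varphi(i)-\varphi(j)\in N^{-1}A+\mathbb{Z},\ (\tfrac{i}{N},\tfrac{j}{N})\in B_1\times B_2\}}{N}.$$ Here $|\cdot|$ denotes the length of an interval. *)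

(* Defs.v *)
From HB Require Import structures.
From mathcomp Require Export all_boot all_order all_algebra finmap.
From mathcomp Require Export all_classical all_reals all_analysis.
Export Order.TTheory GRing.Theory Num.Theory.
Export numFieldNormedType.Exports.

Set Implicit Arguments.
Unset Strict Implicit.
Unset Printing Implicit Defensive.

Local Open Scope classical_set_scope.
Local Open Scope ring_scope.

Definition diophantine (R : realType) (kappa alpha : R) : Prop :=
  irrational alpha /\
  exists2 C : R, 0 < C &
    forall (p : int) (q : nat), (0 < q)%N ->
      C / q%:R `^ kappa < `|alpha - p%:~R / q%:R|.

Definition bounded_interval (R : realType) (I : set R) : Prop :=
  is_interval I /\ bounded_set I.

Definition ilength (R : realType) (I : set R) : R := fine (lebesgue_measure I).

Definition pairs (R : realType) (N : nat) (A B1 B2 : set R) (phi : R -> R) :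
    set (int * int) :=
  [set ij | [/\ ij.1 <> ij.2,
                exists2 a, A a & exists m : int,
                  phi ij.1%:~R - phi ij.2%:~R = N%:R^-1 * a + m%:~R,
                B1 (ij.1%:~R / N%:R)
              & B2 (ij.2%:~R / N%:R)]].

(* [fset_set] is the empty finite set on infinite sets, but [pairs] is finite
   whenever 0 < N and B1, B2 are bounded. *)
Definition R2 (R : realType) (N : nat) (A B1 B2 : set R) (phi : R -> R) : R :=
  #|` fset_set (pairs N A B1 B2 phi)|%:R / N%:R.

Definition phiN (R : realType) (alpha : R) (N : nat) (z : R) : R :=
  (z - alpha) ^+ 2 / (2 * N%:R).

(* M is real. Only large M matter, so it is enough to sum over N : nat; the
   index set is finite, hence \sum_(N \in _) is the ordinary sum. *)
Definition average_R2 (R : realType) (eta alpha : R) (A B1 B2 : set R) (M : R) :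
    R :=
  (M `^ eta)^-1 *
  \sum_(N \in [set N : nat | M <= N%:R <= M + M `^ eta])
    R2 N A B1 B2 (phiN alpha N).

(* Main.v *)
Require Import Defs.
From mathcomp Require Import cyclic separable cyclotomic complex.
From mathcomp Require Import zify ring lra.

Set Implicit Arguments.
Unset Strict Implicit.
Unset Printing Implicit Defensive.

(** Write [i = j + u] with [u > 0]; exchanging [i] and [j] handles the other half ([pairs_swap]).
    Since [phiN i - phiN j = (u j + u^2/2 - alpha u) / N], the pair is counted exactly when, for
    some integer [m], the number [h = u j - N m] satisfies [h + u^2/2 - alpha u] in [A]
    ([pairs_inH]). For each [u] there are O(1) such [h] ([Hseq]), and [(N, m)] comes from some [j]
    exactly when [N m + h = 0] modulo [u]. So the sum over [N] counts, for [u] up to a constant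
    times [M] and [h] in [Hseq u], the points [(N, m)] of a modular hyperbola in a region of size
    about [M^eta] by O([M]).

    Equidistribution on the hyperbola. A box should contain the proportion [cong_count u h / u^2] of
    its points. The Fourier coefficients [hhat] of the hyperbola are Kloosterman sums, and
    Kloosterman's fourth moment argument is enough: the fourth moment is an additive energy
    ([sum_hhat4], [energy_leq]), and invariance under units turns the mean into a pointwise bound
    ([hhat4_leq]) that saves a fourth root of the modulus up to gcds. The sharp region is averaged
    over short shifts ([smoothing]); what is then needed is a count in tent-weighted boxes, whose
    Fourier transform is absolutely summable with good bounds ([box_count_estimate],
    [good_pair_estimate]). This works while [gcd(h, u)] is at most a threshold [G].

    The Diophantine condition enters twice. If [e] divides both [u = e w] and [h], then [2 alpha w]
    is within O(1/e) of an integer, so such [w] are spaced by a constant times [e^nu] with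
    [nu = 1 / (kappa - 1)]; hence few pairs have [gcd(h, u) > G] ([bad_pairs_leq]) and a trivial
    bound is enough for them. Secondly, the local densities [aS u], the sums of [cong_count u h / u]
    over [h], have mean [b - a] ([aS_average]): sorted by divisors and expanded with the Moebius
    function, they count integers in intervals that move linearly, and the sawtooth sums involved
    are controlled by a rational approximation whose denominator the Diophantine condition keeps
    large ([nH_discrepancy]). Summation by parts against the length of the admissible [j] range
    ([model_sum]) and a lattice point count ([overlap_riemann]) then produce the product of the
    three lengths.

    Parameters ([half_power]). With a small [d], the shifts have lengths about [M^(eta - d)] and
    [M^(1 - d)], Fourier frequencies of order at most [D = M^(eta - 3d)] are treated trivially, and
    [G = M^((kappa - 1)(1 - eta + 2d))], so that bad pairs cost about [M^(eta - 2d)]. The relative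
    Kloosterman error is then [M] to the power [kappa (1 - eta) - eta/4] plus a small multiple of
    [kappa d]; the hypotheses give [kappa (1 - eta) < 16/72] and [eta/4 > 17/72] ([eps_bound]). *)

Local Open Scope nat_scope.

(** * Divisor function, totients and gcd sums *)

Definition tau n := size (divisors n).

(** A divisor [d] is determined by the exponent of [p] in its gcd with [p ^ a] together with the
    cofactor of that gcd, which divides [m]. *)
Lemma tau_pfactorM p a m : prime p -> 0 < m ->
  tau (p ^ a * m) <= a.+1 * tau m.
Proof.
move=> p_pr m_gt0.
rewrite -[a.+1](size_iota 0) /tau -(size_allpairs (fun i d => p ^ i * d)).
apply: uniq_leq_size; first exact: divisors_uniq.
move=> d; rewrite -dvdn_divisors; last by rewrite muln_gt0 expn_gt0 prime_gt0.
move=> d_dvd; have d_gt0 : 0 < d.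
  by apply: dvdn_gt0 d_dvd; rewrite muln_gt0 expn_gt0 prime_gt0.
have g_gt0 : 0 < gcdn d (p ^ a) by rewrite gcdn_gt0 d_gt0.
have /(dvdn_pfactor _ _ p_pr)[i ia gE] := dvdn_gcdr d (p ^ a).
apply/allpairsP; exists (i, d %/ gcdn d (p ^ a)) => /=; split.
- by rewrite -[_ :: _]/(iota 0 a.+1) mem_iota ltnS.
- rewrite -dvdn_divisors //.
  have [d' dE] := dvdnP (dvdn_gcdl d (p ^ a)).
  have [b bE] := dvdnP (dvdn_gcdr d (p ^ a)).
  rewrite {1}dE mulnK //.
  have co : coprime d' b.
    by rewrite /coprime -(eqn_pmul2r g_gt0) muln_gcdl -dE -bE mul1n.
  rewrite -(Gauss_dvdr _ co) -(dvdn_pmul2r g_gt0) -dE.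
  by rewrite mulnAC -bE.
- by rewrite -gE muln_divA ?dvdn_gcdl // mulKn.
Qed.

(** With [b = a %/ k] one has [a + 1 <= k (b + 1) <= k 2^b], and [b k <= a]. *)
Lemma succn_exp_leq k a : 0 < k -> a.+1 ^ k <= k ^ k * 2 ^ a.
Proof.
move=> k_gt0; have le1 : a.+1 <= k * 2 ^ (a %/ k).
  apply: (@leq_trans (k * (a %/ k).+1)); first by rewrite mulnC ltn_ceil.
  by rewrite leq_mul2l ltn_expl ?orbT.
apply: leq_trans (_ : (k * 2 ^ (a %/ k)) ^ k <= _); first by rewrite leq_exp2r.
by rewrite expnMn leq_mul2l -expnM leq_pexp2l ?leq_trunc_div ?orbT.
Qed.

(** Strip off one prime power [p ^ a] at a time. If [p >= 2^k], then [(a + 1)^k <= 2^(a k) <= p^a]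
    costs nothing; each prime below [2^k] costs a factor [k^k], and there are at most [2^k] of them.
    The set [S n] keeps track of these small primes. *)
Lemma tau_exp_bound k : 0 < k ->
  exists C, forall n, 0 < n -> tau n ^ k <= C * n.
Proof.
move=> k_gt0; pose S n := [set r : 'I_(2 ^ k) | prime r & r %| n].
exists ((k ^ k) ^ (2 ^ k)) => n n_gt0.
apply: (@leq_trans ((k ^ k) ^ #|S n| * n)); last first.
  rewrite leq_mul2r leq_pexp2l ?orbT ?expn_gt0 ?k_gt0 //.
  by rewrite (leq_trans (max_card _)) ?card_ord.
elim/ltn_ind: n n_gt0 => n IH n_gt0.
have [n1|n_gt1] := leqP n 1.
  have -> : n = 1 by lia.
  by rewrite exp1n muln1 expn_gt0 expn_gt0 k_gt0.
have p_pr := pdiv_prime n_gt1; set p := pdiv n in p_pr.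
have [m co_pm nE] := pfactor_coprime p_pr n_gt0.
set a := logn p n in nE; rewrite mulnC in nE.
have p_dvd : p %| n by exact: pdiv_dvd.
have a_gt0 : 0 < a by rewrite logn_gt0 mem_primes p_pr n_gt0.
have m_gt0 : 0 < m by move: n_gt0; rewrite nE; case: m {co_pm nE} => //; rewrite muln0.
have pa_gt1 : 1 < p ^ a by rewrite -(exp1n a) ltn_exp2r ?prime_gt1.
have lt_mn : m < n by rewrite nE ltn_Pmull.
have IHm := IH m lt_mn m_gt0.
have SS : S m \subset S n.
  apply/fintype.subsetP => r; rewrite !inE => /andP[-> rm] /=.
  by rewrite nE dvdn_mull.
have tn : tau n ^ k <= (a.+1 ^ k) * ((k ^ k) ^ #|S m| * m).
  rewrite {1}nE; apply: leq_trans (_ : (a.+1 * tau m) ^ k <= _).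
    by rewrite leq_exp2r // tau_pfactorM.
  by rewrite expnMn leq_mul2l IHm orbT.
apply: leq_trans tn _.
apply: (@leq_trans ((k ^ k) ^ #|S n| * (p ^ a * m))); last by rewrite -nE.
have kk_gt0 : 0 < k ^ k by rewrite expn_gt0 k_gt0.
have [p_lt|p_ge] := ltnP p (2 ^ k).
- have lt_card : #|S m| < #|S n|.
    apply: proper_card; apply/properP; split=> //.
    exists (Ordinal p_lt); rewrite !inE /= p_pr //=.
    by apply/negP=> pm; move: co_pm; rewrite prime_coprime // pm.
  have ak := succn_exp_leq a k_gt0.
  have p2 : 2 ^ a <= p ^ a by rewrite leq_exp2r ?prime_gt1.
  apply: (@leq_trans ((k ^ k * p ^ a) * ((k ^ k) ^ #|S m| * m))).
    by rewrite leq_mul2r (leq_trans ak) ?orbT // leq_mul2l p2 orbT.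
  rewrite mulnACA -expnS leq_mul2r.
  by rewrite leq_pexp2l ?orbT.
- have ak : a.+1 ^ k <= p ^ a.
    apply: (@leq_trans ((2 ^ a) ^ k)); first by rewrite leq_exp2r // ltn_expl.
    by rewrite -expnM mulnC expnM leq_exp2r.
  rewrite mulnCA; apply: leq_mul; last by rewrite leq_mul2r ak orbT.
  by rewrite leq_pexp2l // subset_leq_card.
Qed.

Lemma sum_multiples e k (f : nat -> nat) : 0 < e ->
  (forall x, ~~ (e %| x) -> f x = 0) ->
  \sum_(x < e * k) f x = \sum_(y < k) f (e * y).
Proof.
move=> e_gt0 f0; elim: k => [|k IH]; first by rewrite muln0 !big_ord0.
rewrite mulnS addnC big_split_ord /= IH big_ord_recr /=; congr (_ + _).
case: e e_gt0 f0 {IH} => // e _ f0.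
rewrite big_ord_recl /= addn0 big1 ?addn0 // => i _; apply: f0.
rewrite /= dvdn_addr ?dvdn_mulr // /bump /= add1n gtnNdvd //.
by rewrite ltnS.
Qed.

Lemma divisors_gt0 n d : 0 < n -> d \in divisors n -> 0 < d.
Proof. by move=> n_gt0; rewrite -dvdn_divisors //; exact: dvdn_gt0. Qed.

Lemma sum_divisors_ord n (f : nat -> nat) : 0 < n ->
  \sum_(d < n.+1 | d %| n) f d = \sum_(d <- divisors n) f d.
Proof.
move=> n_gt0; rewrite -(big_mkord (fun d => d %| n) f) -big_filter.
apply: perm_big; apply: uniq_perm.
- by rewrite filter_uniq // /index_iota iota_uniq.
- exact: divisors_uniq.
move=> d; rewrite mem_filter -dvdn_divisors // mem_index_iota ltnS.
by case dn: (d %| n) => //=; apply: dvdn_leq.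
Qed.

Lemma count_multiples e q : 0 < e -> e %| q -> \sum_(x < q) (e %| x : nat) = q %/ e.
Proof.
move=> e_gt0 /dvdnP[k ->]; rewrite mulnC.
rewrite (@sum_multiples e k (fun x => (e %| x : nat))) //; last by move=> x /negPf ->.
by under eq_bigr do rewrite dvdn_mulr //; rewrite sum1_card card_ord mulKn.
Qed.

(** [gcdn x q] is at most the sum of the divisors [e] of [q] that divide [x], and each [e]
    contributes [e * (q / e) = q] to the double sum. *)
Lemma sum_gcdn_leq q : 0 < q -> \sum_(x < q) gcdn x q <= q * tau q.
Proof.
move=> q_gt0.
apply: (@leq_trans (\sum_(x < q) \sum_(e <- divisors q) e * (e %| x : nat))).
  apply: leq_sum => x _.
  have gd : gcdn x q \in divisors q by rewrite -dvdn_divisors ?dvdn_gcdr.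
  by rewrite (big_rem _ gd) /= dvdn_gcdl muln1 leq_addr.
rewrite exchange_big /= mulnC /tau -sum1_size big_distrl /=.
rewrite big_seq [leqRHS]big_seq; apply: leq_sum => e ed.
have e_gt0 := divisors_gt0 q_gt0 ed.
rewrite -big_distrr /= count_multiples ?dvdn_divisors // mul1n mulnC.
by rewrite divnK // dvdn_divisors.
Qed.

Lemma count_gcdn e q : 0 < q -> e %| q ->
  \sum_(x < q) (gcdn x q == e) = totient (q %/ e).
Proof.
move=> q_gt0 eq; have e_gt0 := dvdn_gt0 q_gt0 eq.
case/dvdnP: eq => k qE; rewrite {}qE mulnK // mulnC in q_gt0 *.
rewrite (@sum_multiples e k (fun x => (gcdn x (e * k) == e : nat))) //.
  rewrite totient_count_coprime big_mkord; apply: eq_bigr => y _.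
  by rewrite -muln_gcdr -{2}[e]muln1 eqn_pmul2l // gcdnC.
by move=> x ex; apply/eqP; rewrite eqb0; apply: contra ex => /eqP <-; rewrite dvdn_gcdl.
Qed.

Lemma totient_leq_mulr d m : 0 < m -> totient d <= totient (d * m).
Proof.
elim/ltn_ind: m d => m IH d m_gt0.
have [m1|m_gt1] := leqP m 1; first by (have -> : m = 1 by lia); rewrite muln1.
have p_pr := pdiv_prime m_gt1; set p := pdiv m in p_pr.
have [m' mE] := dvdnP (pdiv_dvd m); rewrite -/p in mE.
have m'_gt0 : 0 < m' by move: m_gt0; rewrite mE muln_gt0 => /andP[].
have lt_m' : m' < m by rewrite mE ltn_Pmulr ?prime_gt1.
apply: leq_trans (IH _ lt_m' d m'_gt0) _; rewrite mE mulnA.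
set n := d * m'; have [->|n_gt0] := posnP n; first by [].
have [a [co nE]] : exists a, coprime p (n %/ p ^ a) /\ n = p ^ a * (n %/ p ^ a).
  exists (logn p n); have [b cob nE] := pfactor_coprime p_pr n_gt0.
  split; last by rewrite mulnC divnK // pfactor_dvdnn.
  by rewrite {1}nE mulnK // expn_gt0 prime_gt0.
move: (n %/ p ^ a) co nE => b co ->.
rewrite mulnAC -expnSr !totient_coprime ?coprimeXl // leq_mul2r; apply/orP; right.
case: a => [|a]; first by rewrite expn0 (_ : totient 1 = 1) // totient_gt0 expn_gt0 prime_gt0.
by rewrite !totient_pfactor //= leq_mul2l leq_pexp2l ?orbT // prime_gt0.
Qed.

(** [q] is the sum of [totient d] over its [tau q] divisors, and no term exceeds [totient q]. *)
Lemma leq_tau_totient q : 0 < q -> q <= tau q * totient q.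
Proof.
move=> q_gt0; rewrite -{1}(sum_totient_dvd q) sum_divisors_ord //.
rewrite /tau -sum1_size big_distrl /= big_seq [leqRHS]big_seq.
apply: leq_sum => d; rewrite -dvdn_divisors // mul1n => /dvdnP[m qE].
rewrite qE mulnC totient_leq_mulr //.
by move: q_gt0; rewrite qE muln_gt0 => /andP[].
Qed.

Local Open Scope ring_scope.

(** * Moebius expansion of the totient and the divisor bound *)

Section Mobius.
Variable R : realType.

Definition mu (n : nat) : R :=
  if all (fun p => logn p n == 1)%N (primes n) then (-1) ^+ size (primes n)
  else 0.

Lemma norm_mu_le1 n : `|mu n| <= 1.
Proof. by rewrite /mu; case: ifP; rewrite ?normr0 // normrX normrN1 expr1n. Qed.

Lemma mu_pM p c : prime p -> (0 < c)%N -> ~~ (p %| c)%N -> mu (p * c) = - mu c.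
Proof.
move=> p_pr c_gt0 pc; have p_gt0 := prime_gt0 p_pr.
have pE : perm_eq (primes (p * c)) (p :: primes c).
  apply: uniq_perm; rewrite ?primes_uniq //=.
    by rewrite primes_uniq andbT mem_primes p_pr c_gt0.
  by move=> r; rewrite primesM // primes_prime // !inE.
rewrite /mu (perm_all _ pE) (perm_size pE) /= lognM // logn_prime // eqxx.
rewrite (_ : logn p c = 0%N) ?addn0 /=; last first.
  by apply/eqP; rewrite -leqn0 leqNgt logn_gt0 mem_primes p_pr c_gt0.
rewrite (_ : all _ _ = all (fun r => logn r c == 1)%N (primes c)); last first.
  apply: eq_in_all => r; rewrite mem_primes => /and3P[r_pr _ rc].
  rewrite lognM // [logn r p]logn_prime //.
  by have [rp|] := eqVneq r p; first by rewrite -rp rc in pc.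
by case: ifP; rewrite ?oppr0 // exprS mulN1r.
Qed.

Lemma mu_sqr_dvd p c : prime p -> (0 < c)%N -> (p ^ 2 %| c)%N -> mu c = 0.
Proof.
move=> p_pr c_gt0 pc; rewrite /mu; case: ifP => // /allP /(_ p) al.
have p2 : (2 <= logn p c)%N by rewrite -pfactor_dvdn.
have : p \in primes c by rewrite -logn_gt0; lia.
by move=> /al; lia.
Qed.

(** Induction on [w = p ^ a.+1 * m] with [p] not dividing [m]: divisors of [w] divisible by [p ^ 2]
    contribute 0, the others are the divisors [c] of [m] and the products [p * c], so both sides
    acquire the factor [1 - 1/p]. *)
Lemma totient_mu w : (0 < w)%N ->
  (totient w)%:R / w%:R = \sum_(c <- divisors w) mu c / c%:R :> R.
Proof.
elim/ltn_ind: w => w IH w_gt0.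
have [w1|w_gt1] := leqP w 1.
  have -> : w = 1%N by lia.
  by rewrite (_ : divisors 1 = [:: 1%N]) // big_seq1 /mu /= expr0.
have p_pr := pdiv_prime w_gt1; set p := pdiv w in p_pr.
have p_gt0 := prime_gt0 p_pr.
have [m co_pm wE] := pfactor_coprime p_pr w_gt0.
have : (0 < logn p w)%N by rewrite logn_gt0 mem_primes p_pr w_gt0 pdiv_dvd.
move: (logn p w) wE => [|a] // wE _; rewrite mulnC in wE.
have m_gt0 : (0 < m)%N by move: w_gt0; rewrite wE muln_gt0 => /andP[].
have lt_mw : (m < w)%N.
  by rewrite wE ltn_Pmull // -(exp1n a.+1) ltn_exp2r ?prime_gt1.
have pm : ~~ (p %| m)%N by rewrite -prime_coprime.
rewrite (bigID (fun c => p ^ 2 %| c)%N) /= big_seq_cond big1 ?add0r; last first.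
  move=> c /andP[cw pc].
  by rewrite (mu_sqr_dvd p_pr _ pc) ?mul0r // (divisors_gt0 w_gt0 cw).
rewrite -big_filter.
have pE : perm_eq [seq c <- divisors w | ~~ (p ^ 2 %| c)%N]
    (divisors m ++ [seq (p * c)%N | c <- divisors m]).
  apply: uniq_perm; first by rewrite filter_uniq ?divisors_uniq.
    rewrite cat_uniq divisors_uniq map_inj_uniq ?divisors_uniq ?andbT /=.
      apply/hasPn => _ /mapP[c cm ->]; rewrite -dvdn_divisors //.
      by apply: contra pm; apply: dvdn_trans; rewrite dvdn_mulr.
    by move=> x y /eqP; rewrite eqn_pmul2l // => /eqP.
  move=> c; rewrite mem_filter mem_cat -!dvdn_divisors //.
  apply/andP/orP.
    move=> [p2c cw]; have [pc|pc] := boolP (p %| c)%N; last first.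
      left; move: cw; rewrite wE Gauss_dvdr // coprimeXr // coprime_sym.
      by rewrite prime_coprime.
    right; apply/mapP; have [c' cE] := dvdnP pc; exists c'; last by rewrite mulnC.
    have pc' : ~~ (p %| c')%N.
      by apply: contra p2c => pc'; rewrite cE mulnC expnS expn1 dvdn_pmul2l.
    rewrite -dvdn_divisors //; move: cw.
    rewrite cE wE mulnC expnS -mulnA dvdn_pmul2l // Gauss_dvdr //.
    by rewrite coprimeXr // coprime_sym prime_coprime.
  have nd c' : (c' %| m)%N -> ~~ (p %| c')%N.
    by move=> c'm; apply: contra pm => /dvdn_trans; apply.
  move=> [cm|/mapP[c' c'm ->]].
    split; last by rewrite wE dvdn_mull.
    by apply: contra (nd _ cm); apply: dvdn_trans; rewrite dvdn_exp.
  rewrite -dvdn_divisors // in c'm; split.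
    by rewrite expnS expn1 dvdn_pmul2l // nd.
  by rewrite wE expnS -mulnA dvdn_pmul2l // dvdn_mull.
rewrite (perm_big _ pE) big_cat big_map /=.
rewrite (_ : \sum_(_ <- divisors m) mu (p * _) / _ =
    - p%:R^-1 * \sum_(c <- divisors m) mu c / c%:R); last first.
  rewrite big_distrr /= big_seq [RHS]big_seq; apply: eq_bigr => c cm.
  have c_gt0 := divisors_gt0 m_gt0 cm.
  rewrite -dvdn_divisors // in cm.
  rewrite mu_pM //; last by apply: contra pm => /dvdn_trans; apply.
  by rewrite natrM invfM; ring.
rewrite -(IH m lt_mw m_gt0) wE totient_coprime ?coprimeXl //.
rewrite totient_pfactor //= !natrM !natrX.
have -> : p.-1%:R = p%:R - 1 :> R by rewrite -subn1 natrB.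
have p0 : p%:R != 0 :> R by rewrite pnatr_eq0 -lt0n.
have m0 : m%:R != 0 :> R by rewrite pnatr_eq0 -lt0n.
by rewrite exprS; field; rewrite p0 m0 expf_neq0.
Qed.

(** Take the [k]-th root in [tau_exp_bound] for an integer [k > 1/e]. *)
Lemma tau_powR_bound (e : R) : 0 < e ->
  exists2 C : R, 0 < C & forall n, (0 < n)%N -> (tau n)%:R <= C * n%:R `^ e.
Proof.
move=> e_gt0; pose k := (Num.trunc e^-1).+1.
have k_gt : e^-1 < k%:R by rewrite /k truncnS_gt.
have k_gt0 : 0 < k%:R :> R by rewrite ltr0n.
have [C HC] := @tau_exp_bound k isT.
exists (C.+1%:R `^ (k%:R^-1)); first by rewrite powR_gt0 // ltr0n.
move=> n n_gt0.
have n_ge1 : 1 <= n%:R :> R by rewrite ler1n.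
have := HC n n_gt0; rewrite -(ler_nat R) natrX natrM => HCn.
have -> : (tau n)%:R = ((tau n)%:R ^+ k) `^ (k%:R^-1) :> R.
  by rewrite -powR_mulrn // -powRrM divff ?powRr1 // gt_eqF.
apply: (@le_trans _ _ ((C%:R * n%:R) `^ k%:R^-1)).
  by apply: ge0_ler_powR; rewrite ?nnegrE ?invr_ge0 ?mulr_ge0 ?exprn_ge0 // ltW.
rewrite powRM //; apply: ler_pM; rewrite ?powR_ge0 //.
  by apply: ge0_ler_powR; rewrite ?nnegrE ?invr_ge0 ?ler_nat // ltW.
apply: ler_powR => //.
by rewrite -[leRHS]invrK lef_pV2 ?posrE ?invr_gt0 // ltW.
Qed.

End Mobius.

Lemma gcdn_mul_leq a b q : (0 < q)%N ->
  (gcdn (a * b) q <= gcdn a q * gcdn b q)%N.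
Proof.
move=> q_gt0; apply: dvdn_leq; first by rewrite muln_gt0 !gcdn_gt0 q_gt0 !orbT.
rewrite muln_gcdl !muln_gcdr !dvdn_gcd dvdn_gcdl.
by rewrite (dvdn_mull a) ?(dvdn_mulr b) ?(dvdn_mulr q) ?dvdn_gcdr.
Qed.

Lemma count_modn_leq S n d : (0 < d)%N ->
  (d * \sum_(m < S) (m == n %[mod d] : nat) <= S + d)%N.
Proof.
move=> d_gt0; rewrite -big_mkcond /= sum1_card.
have lt_div (m : 'I_S) : (m %/ d < (S %/ d).+1)%N.
  by rewrite ltnS leq_div2r // ltnW.
have : (#|[pred m : 'I_S | m == n %[mod d]]| <= #|'I_(S %/ d).+1|)%N.
  apply: (@leq_card_in _ _ (fun m => Ordinal (lt_div m))).
  move=> x y; rewrite !inE => /eqP xn /eqP yn [xy].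
  by apply: val_inj; rewrite /= (divn_eq x d) (divn_eq y d) xn yn xy.
rewrite card_ord => le; apply: (@leq_trans (d * (S %/ d).+1)).
  by rewrite leq_mul2l le orbT.
by rewrite mulnS addnC leq_add2r mulnC leq_trunc_div.
Qed.

Lemma big_prodE (V : Type) (idx : V) (op : Monoid.com_law idx)
    (I J : finType) (F : I * J -> V) :
  \big[op/idx]_w F w = \big[op/idx]_i \big[op/idx]_j F (i, j).
Proof. by rewrite pair_bigA; apply: eq_bigr; case. Qed.

(** * Points and additive energy of the modular hyperbola *)

Section ResidueRing.
Variable p : nat.
Local Notation q := p.+2.
Local Notation Zq := 'I_p.+2.
Implicit Types a b c x y h t : Zq.

Lemma gcdn_Zp_mulr a b : (gcdn (a * b)%R q <= gcdn a q * gcdn b q)%N.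
Proof. by rewrite /= gcdn_modl gcdn_mul_leq. Qed.

Lemma eq0_Zp_dvdn a : (a == 0) = (q %| a)%N.
Proof. by rewrite /dvdn modn_small. Qed.

(** The solutions form a translate of the kernel of multiplication by [c], which consists of the
    multiples of [q / gcdn c q]. *)
Lemma count_linear c b x0 : c * x0 = b ->
  #|[set x : Zq | (c * x == b)%R]| = gcdn c q.
Proof.
set A := [set x | _] => x0b.
have -> : #|A| = #|[set x : Zq | (c * x == 0)%R]|.
  rewrite -(card_imset _ (addIr (- x0))); apply: eq_card => x.
  apply/imsetP/idP.
    by move=> [y]; rewrite !inE => /eqP yb ->; rewrite mulrBr yb x0b subrr.
  rewrite inE => /eqP x_0; exists (x + x0); last by rewrite addrK.
  by rewrite inE mulrDr x_0 x0b add0r.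
have g_gt0 : (0 < gcdn c q)%N by rewrite gcdn_gt0 orbT.
have [k qE] := dvdnP (dvdn_gcdr c q); have [c' cE] := dvdnP (dvdn_gcdl c q).
have k_gt0 : (0 < k)%N by case: k qE.
have co : coprime k c'.
  rewrite coprime_sym /coprime -(eqn_pmul2r g_gt0) mul1n muln_gcdl -cE.
  by rewrite -qE.
rewrite -sum1_card big_mkcond /=.
rewrite (eq_bigr (fun x : Zq => (k %| x : nat))); last first.
  move=> x _; rewrite inE eq0_Zp_dvdn /= /dvdn modn_mod -/(dvdn _ _).
  rewrite {1}cE {1}qE mulnAC dvdn_pmul2r // Gauss_dvdr //.
have kq : (k %| q)%N by apply/dvdnP; exists (gcdn c q); rewrite mulnC.
by rewrite count_multiples // {1}qE mulKn.
Qed.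

Lemma count_linear_leq c b : (#|[set x : Zq | (c * x == b)%R]| <= gcdn c q)%N.
Proof.
set A := [set x | _]; have [->|[x0]] := set_0Vmem A; first by rewrite cards0.
by rewrite inE => /eqP /count_linear ->.
Qed.

(** A nonempty fibre has at most [gcdn x q] elements, and [gcdn x q] then divides [h]. *)
Lemma count_hyperbola_fibre x h : (#|[set y : Zq | (x * y == h)%R]| <= gcdn h q)%N.
Proof.
set A := [set y | _]; have [->|[y]] := set_0Vmem A; first by rewrite cards0.
rewrite inE => /eqP <-; apply: leq_trans (count_linear_leq _ _) _.
apply: dvdn_leq; first by rewrite gcdn_gt0 orbT.
by rewrite /= gcdn_modl dvdn_gcd dvdn_gcdr andbT dvdn_mulr ?dvdn_gcdl.
Qed.

Definition hyperbola h := [set xy : Zq * Zq | (xy.1 * xy.2 == h)%R].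

(** The additive energy of [hyperbola h] as a subset of [Zq * Zq]: quadruples of its points with
    equal sums of two. *)
Definition energy h := #|[set ij : ((Zq * Zq) * (Zq * Zq)) * ((Zq * Zq) * (Zq * Zq)) |
  [&& ij.1.1 \in hyperbola h, ij.1.2 \in hyperbola h,
      ij.2.1 \in hyperbola h, ij.2.2 \in hyperbola h,
      (ij.1.1.1 + ij.1.2.1 == ij.2.1.1 + ij.2.2.1)%R
    & (ij.1.1.2 + ij.1.2.2 == ij.2.1.2 + ij.2.2.2)%R]]|.

(* Clearing denominators in [h/x1 + h/x2 = h/x3 + h/x4] with
   [x4 = x1 + x2 - x3]. *)
Lemma energy_relation (x1 x2 x3 x4 y1 y2 y3 y4 h : Zq) :
  x1 * y1 = h -> x2 * y2 = h -> x3 * y3 = h -> x4 * y4 = h ->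
  x1 + x2 = x3 + x4 -> y1 + y2 = y3 + y4 ->
  h * (x1 + x2) * ((x3 - x1) * (x3 - x2)) = 0.
Proof.
move=> h1 h2 h3 h4 ex ey.
have x4E : x4 = x1 + x2 - x3 by rewrite ex [RHS]addrC addKr.
(* Once each [x_i y_i] is replaced by [h] and [x4] is eliminated, the two sides are the same
   polynomial; with the products left alone, the bracket is [x1 x2 x3 x4] times
   [y1 + y2 - y3 - y4]. *)
transitivity (- ((x1 * y1) * (x2 * x3 * x4) + (x2 * y2) * (x1 * x3 * x4)
  - (x3 * y3) * (x1 * x2 * x4) - (x4 * y4) * (x1 * x2 * x3)) * 1
  + 0 * h).
  by rewrite h1 h2 h3 h4 x4E; ring.
have -> : x1 * y1 * (x2 * x3 * x4) + x2 * y2 * (x1 * x3 * x4)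
  - x3 * y3 * (x1 * x2 * x4) - x4 * y4 * (x1 * x2 * x3) =
  x1 * x2 * x3 * x4 * ((y1 + y2) - (y3 + y4)) by ring.
by rewrite ey subrr mulr0 oppr0 !mul0r addr0.
Qed.

(** In the variables [s = x3 - x1] and [r = x3 - x2], the relation is linear in [x3] with leading
    coefficient [2 h s r]. Each [(s, r)] thus allows at most [2 gcdn h q * gcdn s q * gcdn r q]
    values of [x3], and [sum_gcdn_leq] sums this over [s] and over [r]. *)
Lemma count_energy_triples h :
  (\sum_(x1 : Zq) \sum_(x2 : Zq) \sum_(x3 : Zq)
     (h * (x1 + x2) * ((x3 - x1) * (x3 - x2)) == 0)%R
   <= 2 * gcdn h q * (q * tau q) ^ 2)%N.
Proof.
pose P (s r x : Zq) : nat := (h * (2 * x - s - r) * (s * r) == 0)%R.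
rewrite (eq_bigr (fun x1 => \sum_(x3 : Zq) \sum_(x2 : Zq)
    (h * (x1 + x2) * ((x3 - x1) * (x3 - x2)) == 0)%R)%N); last first.
  by move=> x1 _; rewrite exchange_big.
rewrite exchange_big /=.
rewrite (eq_bigr (fun x => \sum_(s : Zq) \sum_(r : Zq) P s r x)%N); last first.
  move=> x _; rewrite (reindex_inj (inv_inj (subKr x))) /=.
  apply: eq_bigr => s _; rewrite (reindex_inj (inv_inj (subKr x))) /=.
  apply: eq_bigr => r _; rewrite /P !subKr; congr (nat_of_bool (_ * _ * _ == _)).
  by ring.
rewrite exchange_big /=.
rewrite (eq_bigr (fun s => \sum_(r : Zq) \sum_(x : Zq) P s r x)%N); last first.
  by move=> s _; rewrite exchange_big.
have bound s r : (\sum_(x : Zq) P s r x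
    <= 2 * gcdn h q * (gcdn s q * gcdn r q))%N.
  rewrite /P -big_mkcond /= sum1_card.
  have := count_linear_leq (2 * h * (s * r)) (h * (s + r) * (s * r)).
  rewrite cardsE.
  have eqc : [pred x : Zq | (2 * h * (s * r) * x == h * (s + r) * (s * r))%R] =i
      [pred x : Zq | (h * (2 * x - s - r) * (s * r) == 0)%R].
    by move=> x; rewrite !inE -subr_eq0; congr (_ == _); ring.
  rewrite -(eq_card eqc) => le.
  apply: leq_trans le _; apply: leq_trans (gcdn_Zp_mulr _ _) _.
  apply: leq_mul; last exact: gcdn_Zp_mulr.
  apply: leq_trans (gcdn_Zp_mulr _ _) _; apply: leq_mul => //.
  have -> : (2%R : Zq) = inord (2 %% q) by apply: val_inj; rewrite /= inordK ?ltn_mod // modnDm.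
  rewrite inordK ?ltn_mod // gcdn_modl.
  by apply: dvdn_leq => //; exact: dvdn_gcdl.
apply: (@leq_trans (\sum_(s : Zq) \sum_(r : Zq)
    2 * gcdn h q * (gcdn s q * gcdn r q))).
  by apply: leq_sum => s _; apply: leq_sum => r _; exact: bound.
under eq_bigr do rewrite -big_distrr -big_distrr /=.
rewrite -big_distrr -big_distrl /= leq_mul2l -mulnn; apply/orP; right.
by apply: leq_mul; exact: sum_gcdn_leq.
Qed.

(** The fourth point is determined by the other three. Their abscissas satisfy the relation of
    [energy_relation], and each of the three ordinates lies in a fibre of size at most [g]: this is
    [g ^ 3] times the count of triples. *)
Lemma energy_leq h : (energy h <= 2 * gcdn h q ^ 4 * (q * tau q) ^ 2)%N.
Proof.
set g := gcdn h q.
pose proj (ij : ((Zq * Zq) * (Zq * Zq)) * ((Zq * Zq) * (Zq * Zq))) :=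
  (ij.1.1, ij.1.2, ij.2.1).
pose T (x1 x2 x3 : Zq) : bool := (h * (x1 + x2) * ((x3 - x1) * (x3 - x2)) == 0)%R.
pose B := [set w : (Zq * Zq) * (Zq * Zq) * (Zq * Zq) |
  [&& w.1.1 \in hyperbola h, w.1.2 \in hyperbola h, w.2 \in hyperbola h
    & T w.1.1.1 w.1.2.1 w.2.1]].
apply: (@leq_trans #|B|).
  rewrite /energy -(@card_in_imset _ _ proj).
    apply: subset_leq_card; apply/fintype.subsetP => _ /imsetP[[[[x1 y1] [x2 y2]] [[x3 y3] [x4 y4]]] + ->].
    rewrite !inE /= => /and5P[/eqP h1 /eqP h2 /eqP h3 /eqP h4 /andP[/eqP ex /eqP ey]].
    by rewrite /= h1 h2 h3 !eqxx /= /T (energy_relation h1 h2 h3 h4 ex ey).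
  move=> [[[x1 y1] [x2 y2]] [[x3 y3] [x4 y4]]] [[[u1 v1] [u2 v2]] [[u3 v3] [u4 v4]]].
  rewrite !inE /= => /and5P[_ _ _ _ /andP[/eqP ex /eqP ey]].
  move=> /and5P[_ _ _ _ /andP[/eqP fx /eqP fy]] [] ? ? ? ? ? ?; subst.
  by move: ex ey; rewrite fx fy => /addrI -> /addrI ->.
rewrite -sum1_card big_mkcond /=.
rewrite big_prodE big_prodE.
pose Y (x : Zq) := #|[set y : Zq | (x * y == h)%R]|.
have sumY (x : Zq) (F : nat) : (\sum_(y : Zq) ((x * y == h)%R * F) = Y x * F)%N.
  by rewrite -big_distrl /= /Y -sum1_card [in RHS]big_mkcond; congr (_ * _)%N;
     apply: eq_bigr => y _; rewrite inE; case: eqP.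
apply: (@leq_trans (\sum_(x1 : Zq) \sum_(x2 : Zq) \sum_(x3 : Zq)
   (Y x1 * (Y x2 * (Y x3 * T x1 x2 x3))))); last first.
  apply: (@leq_trans (\sum_(x1 : Zq) \sum_(x2 : Zq) \sum_(x3 : Zq) g ^ 3 * T x1 x2 x3)).
    do 3![apply: leq_sum => ? _].
    rewrite expnS expnS expn1 -!mulnA.
    by rewrite !leq_mul // count_hyperbola_fibre.
  under eq_bigr do under eq_bigr do rewrite -big_distrr /=.
  under eq_bigr do rewrite -big_distrr /=.
  rewrite -big_distrr /= expnS.
  apply: leq_trans (leq_mul (leqnn _) (count_energy_triples h)) _.
  by rewrite -/g; apply/eq_leq; ring.
apply/eq_leq.
rewrite big_prodE.
apply: eq_bigr => x1 _.
transitivity (\sum_(y1 : Zq) ((x1 * y1 == h)%R *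
   \sum_(x2 : Zq) \sum_(x3 : Zq) (Y x2 * (Y x3 * T x1 x2 x3))))%N; last first.
  by rewrite sumY big_distrr; apply: eq_bigr => x2 _; rewrite big_distrr.
apply: eq_bigr => y1 _.
rewrite big_prodE big_distrr.
apply: eq_bigr => x2 _.
transitivity (\sum_(y2 : Zq) ((x2 * y2 == h)%R * ((x1 * y1 == h)%R *
   \sum_(x3 : Zq) (Y x3 * T x1 x2 x3))))%N; last first.
  by rewrite sumY mulnCA big_distrr.
apply: eq_bigr => y2 _.
rewrite big_prodE !big_distrr.
apply: eq_bigr => x3 _ /=.
transitivity (\sum_(y3 : Zq) ((x3 * y3 == h)%R * ((x2 * y2 == h)%R *
  ((x1 * y1 == h)%R * T x1 x2 x3))))%N; last by rewrite sumY; ring.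
apply: eq_bigr => y3 _; rewrite !inE /=.
by do 3!case: eqP => _ //=; rewrite ?muln0 ?mul0n ?mul1n //; case: (T _ _ _).
Qed.

End ResidueRing.

Lemma Zp_nat_dvdn p n : ((n%:R : 'I_p.+2) == 0) = (p.+2 %| n)%N.
Proof. by rewrite -(inj_eq val_inj) Zp_nat. Qed.

Lemma card_unit_Zp p : #|[set t : 'I_p.+2 | t \is a GRing.unit]| = totient p.+2.
Proof.
rewrite totient_count_coprime big_mkord -sum1_card big_mkcond /=.
apply: eq_bigr => t _; rewrite inE -{1}(natr_Zp t).
by rewrite (@unitZpE p.+2) //; case: coprime.
Qed.

(** * Fourier coefficients of the hyperbola (Kloosterman sums) and of intervals *)

Section Fourier.
Variables (C : numClosedFieldType) (p : nat) (z : C).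
Local Notation q := p.+2.
Local Notation Zq := 'I_p.+2.
Hypothesis prim_z : q.-primitive_root z.
Implicit Types a b c x y h t k l : Zq.

Definition ech x : C := z ^+ x.

Lemma ech0 : ech 0 = 1. Proof. exact: expr0. Qed.

Lemma echD x y : ech (x + y) = ech x * ech y.
Proof. by rewrite /ech -exprD /= (prim_expr_mod prim_z). Qed.

Lemma norm_ech x : `|ech x| = 1.
Proof.
apply/eqP; rewrite -(@pexpr_eq1 _ _ q) // -normrX /ech -exprM mulnC exprM.
by rewrite (prim_expr_order prim_z) expr1n normr1.
Qed.

Lemma conj_ech x : (ech x)^* = ech (- x).
Proof.
have e1 : ech x * ech (- x) = 1 by rewrite -echD subrr ech0.
have ex0 : ech x != 0 by apply: contra_eq_neq e1 => ->; rewrite mul0r eq_sym oner_neq0.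
by apply: (mulfI ex0); rewrite e1 -normCK norm_ech expr1n.
Qed.

Lemma ech_exp x n : ech (n%:R * x) = ech x ^+ n.
Proof.
elim: n => [|n IH]; first by rewrite mul0r ech0 expr0.
by rewrite exprS -IH -echD mulrS mulrDl mul1r.
Qed.

Lemma sum_ech x : \sum_a ech (a * x) = if x == 0 then q%:R else 0.
Proof.
case: eqP => [->|/eqP x0].
  rewrite (eq_bigr (fun=> 1)); first by rewrite sumr_const card_ord.
  by move=> a _; rewrite mulr0 ech0.
have ex1 : ech x != 1.
  by rewrite /ech -(prim_order_dvd prim_z) -eq0_Zp_dvdn.
rewrite (eq_bigr (fun a : Zq => ech x ^+ a)); last first.
  by move=> a _; rewrite -ech_exp natr_Zp.
have : (ech x - 1) * \sum_(a < q) ech x ^+ a = 0.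
  rewrite -subrX1 /ech -exprM mulnC exprM (prim_expr_order prim_z) expr1n.
  by rewrite subrr.
by move/eqP; rewrite mulf_eq0 subr_eq0 (negPf ex1) /= => /eqP.
Qed.

(** Opening the square and summing over [a] and [b] detects [f i = f j] and [g i = g j] by
    orthogonality, with weight [q] each. *)
Lemma parseval2 (I : finType) (P : pred I) (f g : I -> Zq) :
  \sum_a \sum_b `|\sum_(i | P i) ech (a * f i + b * g i)| ^+ 2 =
  (q ^ 2 * #|[set ij : I * I | [&& P ij.1, P ij.2, f ij.1 == f ij.2
                              & g ij.1 == g ij.2]]|)%:R.
Proof.
transitivity (\sum_a \sum_b \sum_(i | P i) \sum_(j | P j)
   ech (a * (f i - f j)) * ech (b * (g i - g j))).
  apply: eq_bigr => a _; apply: eq_bigr => b _.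
  rewrite normCK raddf_sum /= big_distrl /=; apply: eq_bigr => i _.
  rewrite big_distrr /=; apply: eq_bigr => j _.
  by rewrite conj_ech -!echD; congr ech; ring.
under eq_bigr do rewrite exchange_big /=.
rewrite exchange_big /=.
transitivity (\sum_(i | P i) \sum_(j | P j)
   (q ^ 2 * ((f i == f j) && (g i == g j)))%:R : C).
  apply: eq_bigr => i _.
  under eq_bigr do rewrite exchange_big /=.
  rewrite exchange_big /=; apply: eq_bigr => j _.
  under eq_bigr do rewrite -big_distrr sum_ech subr_eq0 /=.
  rewrite -big_distrl sum_ech subr_eq0 /= natrM natrX.
  by do 2!case: eqP => _; rewrite ?mulr0 ?mul0r ?mulr1 // expr2.
rewrite -sum1_card natrM natr_sum big_distrr /= [RHS]big_mkcond /=.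
rewrite big_prodE [LHS]big_mkcond /=; apply: eq_bigr => i _.
case Pi: (P i); last by rewrite big1 // => j _; rewrite inE /= Pi.
rewrite big_mkcond /=; apply: eq_bigr => j _; rewrite inE /= Pi /=.
by case: (P j) => //=; case: andP => _; rewrite natrM ?mulr1 ?mulr0.
Qed.

Section Hyperbola.
Variable h : Zq.
Local Notation g := (gcdn h q).

Definition hhat a b : C := \sum_(xy in hyperbola h) ech (a * xy.1 + b * xy.2).

(** [hhat a b ^+ 2] is an exponential sum over pairs of hyperbola points with phase given by the sum
    of the pair, so [parseval2] counts coincidences between such sums. *)
Lemma sum_hhat4 :
  \sum_a \sum_b `|hhat a b| ^+ 4 = (q ^ 2 * energy h)%:R.
Proof.
pose P (w : (Zq * Zq) * (Zq * Zq)) := (w.1 \in hyperbola h) && (w.2 \in hyperbola h).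
have := parseval2 P (fun w => w.1.1 + w.2.1) (fun w => w.1.2 + w.2.2).
rewrite (_ : #|_| = energy h); last first.
  by apply: eq_card => w; rewrite [in LHS]inE [in RHS]inE /P -!andbA.
move=> <-; apply: eq_bigr => a _; apply: eq_bigr => b _.
rewrite (_ : 4 = 2 * 2)%N // exprM -normrX; congr (`|_| ^+ 2).
rewrite expr2 /hhat big_distrl big_mkcond [RHS]big_mkcond [RHS]big_prodE /=.
apply: eq_bigr => v _; rewrite /P /=.
case: ifP => vh; last by rewrite big1.
rewrite big_distrr [LHS]big_mkcond; apply: eq_bigr => w _ /=.
by case: ifP => // _; rewrite -echD; congr ech; ring.
Qed.

Lemma hhatC a b : hhat a b = hhat b a.
Proof.
rewrite /hhat (reindex_inj (h := fun xy : Zq * Zq => (xy.2, xy.1))) /=; last first.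
  by move=> [x y] [x1 y1] /= [-> ->].
apply: eq_big => [[x y]|[x y] _]; first by rewrite !inE /= mulrC.
by rewrite addrC.
Qed.

Lemma hhat_unit t a b : t \is a GRing.unit -> hhat (a * t) (b / t) = hhat a b.
Proof.
move=> ut; rewrite [RHS]/hhat.
rewrite (reindex_inj (h := fun xy : Zq * Zq => (t * xy.1, t^-1 * xy.2))) /=; last first.
  move=> [x y] [x1 y1] /= /eqP; rewrite xpair_eqE => /andP[/eqP /(mulrI ut) ->].
  by move=> /eqP /mulrI ->; rewrite ?unitrV.
apply: eq_big => [[x y]|[x y] _]; last by congr ech => /=; ring.
by rewrite !inE /= mulrACA divrr // mul1r.
Qed.

Lemma norm_hhat_leq a b : `|hhat a b| <= #|hyperbola h|%:R.
Proof.
apply: le_trans (ler_norm_sum _ _ _) _.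
rewrite (eq_bigr (fun=> 1)) ?sumr_const //.
by move=> xy _; rewrite norm_ech.
Qed.

(* The unit [t] acts on the hyperbola by [(x, y) |-> (x t, y / t)]; the orbit
   of the frequency [(a, b)] has at least [totient q / gcdn a q] elements, and
   each of them carries the same Fourier coefficient. *)
Lemma hhat4_leq a b : `|hhat a b| ^+ 4 * q%:R <=
  (2 * g ^ 4 * tau q ^ 3 * q ^ 4 * gcdn a q)%:R.
Proof.
have orb : `|hhat a b| ^+ 4 * (totient q)%:R <= (gcdn a q * (q ^ 2 * energy h))%:R.
  rewrite natrM -sum_hhat4 -card_unit_Zp mulr_natr -sumr_const.
  rewrite (eq_bigr (fun t => `|hhat (a * t) (b / t)| ^+ 4)); last first.
    by move=> t; rewrite inE => /(hhat_unit a b) ->.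
  apply: (@le_trans _ _ (\sum_(t : Zq) \sum_b' `|hhat (a * t) b'| ^+ 4)).
    rewrite big_mkcond; apply: ler_sum => t _; case: ifP => _.
      by rewrite (bigD1 (b / t)) //= lerDl sumr_ge0 // => *; rewrite exprn_ge0.
    by rewrite sumr_ge0 // => *; rewrite exprn_ge0.
  (* A frequency [a'] equals [a * t] for at most [gcdn a q] values of [t], so the sum over units is
     at most that multiple of the full fourth moment. *)
  rewrite (partition_big (fun t => a * t) xpredT) //= big_distrr /=.
  apply: ler_sum => a' _.
  rewrite (eq_bigr (fun=> \sum_b' `|hhat a' b'| ^+ 4)); last first.
    by move=> t /eqP ->.
  rewrite sumr_const -[leLHS]mulr_natl ler_wpM2r ?ler_nat //.
    by rewrite sumr_ge0 // => *; rewrite exprn_ge0.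
  have := count_linear_leq a a'; apply: leq_trans.
  by apply: subset_leq_card; apply/fintype.subsetP => t; rewrite inE.
(* Passing from [totient q] to [q] costs one more factor [tau q]. *)
apply: (@le_trans _ _ (`|hhat a b| ^+ 4 * (tau q * totient q)%:R)).
  by rewrite ler_wpM2l ?exprn_ge0 // ler_nat leq_tau_totient.
rewrite natrM mulrCA.
apply: le_trans (ler_wpM2l _ orb) _; first by rewrite ler0n.
rewrite -natrM ler_nat.
apply: (@leq_trans (tau q * (gcdn a q * (q ^ 2 * (2 * g ^ 4 * (q * tau q) ^ 2))))).
  by rewrite !leq_mul // energy_leq.
by apply/eq_leq; ring.
Qed.

End Hyperbola.

Definition geom S a : C := \sum_(n < S) ech (a * n%:R).

Lemma geom0 S : geom S 0 = S%:R.
Proof.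
rewrite /geom (eq_bigr (fun=> 1)) ?sumr_const ?card_ord //.
Qed.

(** The frequencies with [d k = 0] form a subgroup whose annihilator is the set of multiples of [d].
    Orthogonality on it makes the left side [d] times the number of [(m, n)] with [m = n] modulo
    [d], and each [m] has at most [S / d + 1] such [n]. *)
Lemma sum_geom_low S d : (0 < d)%N -> (d %| q)%N ->
  \sum_(k | d%:R * k == 0) `|geom S k| ^+ 2 <= (S * (S + d))%:R.
Proof.
move=> d_gt0 dq.
have detect (k m : Zq) :
  (d%:R * k == 0)%:R * ech (k * m) = q%:R^-1 * \sum_x ech (k * (m + x * d%:R)).
  rewrite (eq_bigr (fun x => ech (x * (d%:R * k)) * ech (k * m))); last first.
    by move=> x _; rewrite -echD; congr ech; ring.
  rewrite -big_distrl sum_ech /=; case: eqP => _; last by rewrite !mul0r mulr0.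
  by rewrite mulrA mulVf ?pnatr_eq0.
have inner (m : Zq) :
  \sum_k (d%:R * k == 0)%:R * ech (k * m) = #|[set x : Zq | d%:R * x == - m]|%:R.
  under eq_bigr do rewrite detect.
  rewrite -big_distrr exchange_big /= -sum1_card natr_sum [RHS]big_mkcond big_distrr /=.
  apply: eq_bigr => x _; rewrite sum_ech inE [x * _]mulrC addrC addr_eq0.
  by case: eqP => _; rewrite ?mulr0 // mulVf ?pnatr_eq0.
have -> : \sum_(k | d%:R * k == 0) `|geom S k| ^+ 2 =
   (\sum_(m < S) \sum_(n < S) #|[set x : Zq | d%:R * x == - (m%:R - n%:R)]%R|)%:R.
  rewrite natr_sum (eq_bigr (fun k => \sum_(m < S) \sum_(n < S) ech (k * (m%:R - n%:R)))).
    rewrite exchange_big; apply: eq_bigr => m _ /=.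
    rewrite natr_sum exchange_big; apply: eq_bigr => n _ /=.
    rewrite -inner big_mkcond; apply: eq_bigr => k _.
    by case: eqP => _; rewrite ?mul1r ?mul0r.
  move=> k _; rewrite normCK /geom raddf_sum /= big_distrl /=; apply: eq_bigr => m _.
  rewrite big_distrr /=; apply: eq_bigr => n _.
  by rewrite conj_ech -echD; congr ech; ring.
rewrite ler_nat.
apply: (@leq_trans (\sum_(m < S) (S + d))); last by rewrite sum_nat_const card_ord.
apply: leq_sum => m _; apply: leq_trans (count_modn_leq S m d_gt0).
rewrite big_distrr /=; apply: leq_sum => n _.
case: eqP => [_|mn].
  rewrite muln1; apply: leq_trans (count_linear_leq _ _) _.
  by rewrite Zp_nat /= gcdn_modl; apply: dvdn_leq => //; exact: dvdn_gcdl.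
rewrite muln0 leqn0 cards_eq0; apply/eqP/setP => x; rewrite !inE.
apply/negP => /eqP dx; apply: mn.
have : (n%:R : Zq) = (m + d * x)%:R.
  by rewrite natrD natrM natr_Zp dx; ring.
rewrite !Zp_nat => /(congr1 val) /= mE.
rewrite -(modn_dvdm n dq) mE modn_dvdm //.
by rewrite addnC mulnC modnMDl.
Qed.

Lemma sum_geom_all S : \sum_k `|geom S k| ^+ 2 <= (S * (S + q))%:R.
Proof.
have q0 : q%:R = 0 :> Zq by apply/eqP; rewrite Zp_nat_dvdn.
have := sum_geom_low S (ltn0Sn p.+1) (dvdnn q).
by under eq_bigl do rewrite q0 mul0r eqxx.
Qed.

(** The sum runs over [k] of additive order [q / gcdn k q] at most [D]. The frequency 0 gives
    [S ^ 2]. Every other [k] lies in the subgroup [d k = 0] for its order [d], and by [sum_geom_low]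
    that subgroup without 0 contributes at most [S d <= S D]; there are at most [tau q] orders. *)
Lemma sum_geom_order S (D : C) : 0 <= D ->
  \sum_(k : Zq | (k == 0) || (q%:R <= D * (gcdn k q)%:R)) `|geom S k| ^+ 2 <=
  S%:R * (S%:R + (tau q)%:R * D).
Proof.
move=> D_ge0.
rewrite (bigD1 0) ?eqxx //= geom0 ger0_norm ?ler0n // mulrDr expr2 lerD2l.
apply: (@le_trans _ _ (\sum_(d <- divisors q | d%:R <= D)
    \sum_(k | (k != 0) && (d%:R * k == 0)) `|geom S k| ^+ 2)).
  rewrite [leRHS]big_mkcond /=.
  rewrite (eq_bigr (fun d => \sum_(k : Zq) (if [&& d%:R <= D, k != 0 & d%:R * k == 0]
     then `|geom S k| ^+ 2 else 0))); last first.
    by move=> d _; case: ifP => dD; [rewrite big_mkcond | rewrite big1].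
  rewrite exchange_big big_mkcond /=; apply: ler_sum => k _.
  case: ifP => [/andP[k0' k0]|_]; last first.
    by rewrite sumr_ge0 // => d _; case: ifP; rewrite // exprn_ge0.
  rewrite (negPf k0) /= in k0'.
  have gq : (gcdn k q %| q)%N := dvdn_gcdr k q.
  have g_gt0 : (0 < gcdn k q)%N by rewrite gcdn_gt0 orbT.
  have dd : (q %/ gcdn k q)%N \in divisors q.
    by rewrite -dvdn_divisors //; apply/dvdnP; exists (gcdn k q); rewrite mulnC divnK.
  rewrite (big_rem _ dd) /= ifT ?lerDl ?sumr_ge0 //.
    by move=> d _; case: ifP; rewrite // exprn_ge0.
  rewrite k0 /=; apply/andP; split.
    by rewrite -(@ler_pM2r _ (gcdn k q)%:R) ?ltr0n // -natrM divnK.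
  rewrite -{2}(natr_Zp k) -natrM Zp_nat_dvdn.
  by rewrite mulnC muln_divA // mulnC -muln_divA ?dvdn_gcdl // dvdn_mulr.
apply: (@le_trans _ _ (\sum_(d <- divisors q | d%:R <= D) S%:R * D)).
  rewrite big_seq_cond [leRHS]big_seq_cond; apply: ler_sum => d /andP[dq dD].
  have d_gt0 := divisors_gt0 (ltn0Sn _) dq.
  rewrite -dvdn_divisors // in dq.
  have := sum_geom_low S d_gt0 dq; rewrite (bigD1 0) ?mulr0 ?eqxx //=.
  rewrite geom0 ger0_norm ?ler0n // natrM natrD mulrDr -expr2 lerD2l => le.
  apply: le_trans (_ : _ <= S%:R * d%:R) _; last by rewrite ler_wpM2l.
  by under eq_bigl do rewrite andbC.
rewrite big_const_seq iter_addr_0 -[leLHS]mulr_natl mulrCA ler_wpM2l ?ler0n //.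
by rewrite ler_wpM2r // ler_nat count_size.
Qed.

End Fourier.

(** * Hyperbola points in tent-weighted boxes *)

Section BoxCount.
Variable p : nat.
Local Notation q := p.+2.
Local Notation Zq := 'I_p.+2.
Implicit Types x y h t k l : Zq.

(** The convolution of two intervals of length [S], translated by [t]. Its Fourier coefficients have
    absolute value [|geom| ^ 2], so that Parseval bounds their absolute sum. *)
Definition tent S t x : nat :=
  (\sum_(a < S) \sum_(b < S) (t + a%:R + b%:R == x)%R)%N.

Definition box_count h t1 S1 t2 S2 : nat :=
  (\sum_(a < S1) \sum_(b < S1) \sum_(c < S2) \sum_(d < S2)
     ((t1 + a%:R + b%:R) * (t2 + c%:R + d%:R) == h)%R)%N.

Lemma box_countE h t1 S1 t2 S2 :
  box_count h t1 S1 t2 S2 =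
  (\sum_(xy in hyperbola h) tent S1 t1 xy.1 * tent S2 t2 xy.2)%N.
Proof.
pose f (i : 'I_S1 * 'I_S1) : Zq := t1 + i.1%:R + i.2%:R.
pose g (j : 'I_S2 * 'I_S2) : Zq := t2 + j.1%:R + j.2%:R.
transitivity (\sum_i \sum_j (f i * g j == h)%R)%N.
  by rewrite big_prodE; do 2!(apply: eq_bigr => ? _); rewrite big_prodE.
transitivity (\sum_(xy in hyperbola h) \sum_i \sum_j (f i == xy.1) * (g j == xy.2))%N.
  rewrite [RHS]exchange_big; apply: eq_bigr => i _ /=.
  rewrite [RHS]exchange_big; apply: eq_bigr => j _ /=.
  rewrite [RHS]big_mkcond (bigD1 (f i, g j)) //= !eqxx inE /= big1 ?addn0.
    by case: eqP.
  move=> [x y]; rewrite xpair_eqE negb_and /= => ne; case: ifP => // _.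
  by case/orP: ne => /negPf ne; [rewrite [f i == _]eq_sym ne mul0n
    | rewrite [g j == _]eq_sym ne muln0].
apply: eq_bigr => xy _; rewrite /tent -/(f _) big_distrl /= big_prodE.
apply: eq_bigr => a _; rewrite big_distrl /=; apply: eq_bigr => b _.
rewrite big_prodE big_distrr /=; apply: eq_bigr => c _.
by rewrite big_distrr.
Qed.

Section WithRoot.
Variables (C : numClosedFieldType) (z : C).
Hypothesis prim_z : q.-primitive_root z.

Lemma tent_fourier S t x : q%:R * (tent S t x)%:R =
  \sum_k ech z (k * t) * geom z S k ^+ 2 * ech z (- k * x).
Proof.
rewrite natr_sum big_distrr /=.
rewrite (eq_bigr (fun a : 'I_S => \sum_(b < S) \sum_k
   ech z (k * (t + a%:R + b%:R - x)))); last first.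
  move=> a _; rewrite natr_sum big_distrr; apply: eq_bigr => b _ /=.
  by rewrite (sum_ech prim_z) subr_eq0; case: eqP => _; rewrite ?mulr1 ?mulr0.
under eq_bigr do rewrite exchange_big.
rewrite exchange_big; apply: eq_bigr => k _ /=.
rewrite expr2 /geom !big_distrl /= big_distrr big_distrl /=; apply: eq_bigr => a _.
rewrite big_distrr big_distrr big_distrl /=; apply: eq_bigr => b _.
by rewrite -!(echD prim_z); congr ech; ring.
Qed.

Lemma box_count_fourier h t1 S1 t2 S2 :
  (q ^ 2 * box_count h t1 S1 t2 S2)%:R =
  \sum_k \sum_l ech z (k * t1) * geom z S1 k ^+ 2 *
    (ech z (l * t2) * geom z S2 l ^+ 2) * hhat z h (- k) (- l).
Proof.
rewrite box_countE natrM natr_sum natrX big_distrr /=.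
rewrite (eq_bigr (fun xy : Zq * Zq => \sum_k \sum_l
   ech z (k * t1) * geom z S1 k ^+ 2 * (ech z (l * t2) * geom z S2 l ^+ 2) *
   ech z (- k * xy.1 + - l * xy.2))); last first.
  move=> xy _; rewrite expr2 natrM mulrACA !tent_fourier big_distrl /=.
  apply: eq_bigr => k _; rewrite big_distrr; apply: eq_bigr => l _ /=.
  by rewrite (echD prim_z); ring.
rewrite exchange_big; apply: eq_bigr => k _ /=.
by rewrite exchange_big; apply: eq_bigr => l _ /=; rewrite /hhat big_distrr.
Qed.

Lemma gcdn_ZpN k : gcdn (- k)%R q = gcdn k q.
Proof.
rewrite /= gcdn_modl; apply/eqP; rewrite eqn_dvd !dvdn_gcd !dvdn_gcdr !andbT.
have kq : (k <= q)%N by rewrite ltnW.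
apply/andP; split.
  by rewrite -(dvdn_subr kq) ?dvdn_gcdr // dvdn_gcdl.
by rewrite dvdn_sub ?dvdn_gcdr ?dvdn_gcdl.
Qed.

(** In [box_count_fourier] the frequency [(0, 0)] is the main term. If [k] or [l] has order above
    [D], then [hhat4_leq] bounds the coefficient by [Kl] (by [hhatC] either variable will do), and
    [sum_geom_all] sums the weights. If both have order at most [D], the trivial bound by the size
    of the hyperbola is used with the smaller weight sum of [sum_geom_order]; subtracting
    [S1 ^ 2 * S2 ^ 2] there removes [(0, 0)]. *)
Lemma box_count_estimate h t1 S1 t2 S2 (D Kl : C) :
  0 <= D -> 0 <= Kl ->
  (2 * gcdn h q ^ 4 * tau q ^ 3 * q ^ 4)%:R <= D * Kl ^+ 4 ->
  `|(q ^ 2 * box_count h t1 S1 t2 S2)%:R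
    - (S1 ^ 2 * S2 ^ 2 * #|hyperbola h|)%:R| <=
  Kl * ((S1 * (S1 + q))%:R * (S2 * (S2 + q))%:R) +
  #|hyperbola h|%:R * (S1%:R * (S1%:R + (tau q)%:R * D) *
     (S2%:R * (S2%:R + (tau q)%:R * D)) - (S1 ^ 2 * S2 ^ 2)%:R).
Proof.
move=> D_ge0 Kl_ge0 HK.
pose low (k : Zq) := (k == 0) || (q%:R <= D * (gcdn k q)%:R).
pose F k l : C := `|geom z S1 k| ^+ 2 * `|geom z S2 l| ^+ 2.
have F_ge0 k l : 0 <= F k l by rewrite mulr_ge0 ?exprn_ge0.
have K1 k l : ~~ low k -> `|hhat z h (- k) (- l)| <= Kl.
  rewrite negb_or => /andP[_ kD].
  have {}kD : D * (gcdn k q)%:R < q%:R.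
    by rewrite real_ltNge ?ger0_real ?mulr_ge0.
  rewrite -(@ler_pXn2r _ 4) ?nnegrE //.
  rewrite -(@ler_pM2r _ q%:R) ?ltr0n //.
  apply: le_trans (hhat4_leq prim_z h _ _) _.
  rewrite natrM gcdn_ZpN; apply: le_trans (ler_wpM2r _ HK) _; first exact: ler0n.
  by rewrite mulrAC mulrC ler_wpM2l ?exprn_ge0 // ltW.
have hC k l : hhat z h k l = hhat z h l k by exact: hhatC.
have h00 : hhat z h (- 0) (- 0) = #|hyperbola h|%:R.
  rewrite /hhat (eq_bigr (fun=> 1)) ?sumr_const // => xy _.
  by rewrite oppr0 !mul0r addr0 ech0.
have term k l : `|ech z (k * t1) * geom z S1 k ^+ 2 *
    (ech z (l * t2) * geom z S2 l ^+ 2) * hhat z h (- k) (- l)| =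
    F k l * `|hhat z h (- k) (- l)|.
  by rewrite !normrM !(norm_ech prim_z) !mul1r.
have FS : \sum_k \sum_l F k l <= (S1 * (S1 + q))%:R * (S2 * (S2 + q))%:R.
  under eq_bigr do rewrite -big_distrr /=.
  rewrite -big_distrl /=; apply: ler_pM; try exact: (sum_geom_all prim_z).
    by apply: sumr_ge0 => i _; exact: exprn_ge0.
  by apply: sumr_ge0 => i _; exact: exprn_ge0.
have FL : \sum_(k | low k) \sum_(l | low l) F k l <=
    S1%:R * (S1%:R + (tau q)%:R * D) * (S2%:R * (S2%:R + (tau q)%:R * D)).
  under eq_bigr do rewrite -big_distrr /=.
  rewrite -big_distrl /=; apply: ler_pM; try exact: (sum_geom_order prim_z).
    by apply: sumr_ge0 => i _; exact: exprn_ge0.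
  by apply: sumr_ge0 => i _; exact: exprn_ge0.
have F00 : F 0 0 = (S1 ^ 2 * S2 ^ 2)%:R.
  by rewrite /F !geom0 !normr_nat natrM !natrX.
pose G k l := ech z (k * t1) * geom z S1 k ^+ 2 *
    (ech z (l * t2) * geom z S2 l ^+ 2) * hhat z h (- k) (- l).
have G00 : G 0 0 = (S1 ^ 2 * S2 ^ 2 * #|hyperbola h|)%:R.
  by rewrite /G !mul0r ech0 !mul1r h00 !geom0 natrM natrM !natrX.
clearbody F; have low0 : low 0 by rewrite /low eqxx.
pose delta (k l : Zq) : C := ((k == 0) && (l == 0))%:R.
pose lowF k l : C := if low k && low l then F k l else 0.
have sum_delta (x : C) : \sum_k \sum_l delta k l * x = x.
  rewrite (bigD1 0) //= (bigD1 0) //= /delta !eqxx mul1r !big1 ?addr0 //.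
    by move=> k /negPf k0; rewrite big1 // => l _; rewrite k0 mul0r.
  by move=> l /negPf ->; rewrite andbF mul0r.
have N_ge0 : 0 <= #|hyperbola h|%:R :> C by exact: ler0n.
have pointwise k l : `|G k l - delta k l * G 0 0| <=
    Kl * F k l + #|hyperbola h|%:R * (lowF k l - delta k l * F 0 0).
  have [/andP[/eqP -> /eqP ->]|kl0] := boolP ((k == 0) && (l == 0)).
    by rewrite /delta /lowF low0 !eqxx !mul1r !subrr normr0 mulr0 addr0 mulr_ge0.
  rewrite /delta (negPf kl0) !mul0r !subr0 /G term /lowF.
  case: ifP => [_|/negbT]; last first.
    rewrite mulr0 addr0 negb_and mulrC => /orP[lk|ll].
      by rewrite ler_wpM2r // K1.
    by rewrite ler_wpM2r // hC K1.
  rewrite addrC [leRHS]addrC -[leLHS]add0r lerD ?mulr_ge0 // mulrC.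
  by rewrite ler_wpM2r // norm_hhat_leq.
have -> : (S1 ^ 2 * S2 ^ 2 * #|hyperbola h|)%:R =
    \sum_k \sum_l delta k l * G 0 0 by rewrite sum_delta G00.
rewrite box_count_fourier -sumrB; apply: le_trans (ler_norm_sum _ _ _) _.
apply: (@le_trans _ _ (\sum_k \sum_l (Kl * F k l +
    #|hyperbola h|%:R * (lowF k l - delta k l * F 0 0)))).
  apply: ler_sum => k _; rewrite -sumrB; apply: le_trans (ler_norm_sum _ _ _) _.
  by apply: ler_sum => l _; exact: pointwise.
under eq_bigr do rewrite big_split -!big_distrr sumrB /=.
rewrite big_split -!big_distrr sumrB /= sum_delta F00.
apply: lerD; first by apply: ler_wpM2l.
apply: ler_wpM2l => //; rewrite lerD2r.
apply: le_trans FL; rewrite le_eqVlt; apply/orP; left; apply/eqP.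
rewrite [RHS]big_mkcond; apply: eq_bigr => k _; rewrite [in RHS]big_mkcond /lowF /=.
by case: (low k) => //=; rewrite big1.
Qed.

End WithRoot.

End BoxCount.

(** * From residue rings to congruences between integers *)

Lemma exists_prim_root (C : numClosedFieldType) n : (0 < n)%N ->
  exists z : C, n.-primitive_root z.
Proof.
move=> n_gt0; have [r] := closed_field_poly_normal ('X^n - 1 : {poly C}).
rewrite lead_coefXnsubC // scale1r => Dr.
have ur : uniq r by rewrite -separable_prod_XsubC -Dr separable_Xn_sub_1 // pnatr_eq0 -lt0n.
have sr : size r = n by apply/succn_inj; rewrite -(size_prod_XsubC _ id) -Dr size_XnsubC.
suff /hasP[z] : has n.-primitive_root r by exists z.
apply: has_prim_root => //; last by rewrite sr.
by apply/allP => z zr; rewrite /root_of_unity Dr root_prod_XsubC.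
Qed.

Lemma Zp_int_dvdz p (m : int) : ((m%:~R : 'I_p.+2) == 0) = (p.+2%:Z %| m)%Z.
Proof.
case: m => n; first by rewrite -pmulrn Zp_nat_dvdn.
by rewrite NegzE rmorphN /= oppr_eq0 -pmulrn Zp_nat_dvdn dvdzE abszN.
Qed.

Lemma gcdn_Zp_int p (m : int) : gcdn (m%:~R : 'I_p.+2) p.+2 = gcdn `|m| p.+2.
Proof.
case: m => n; first by rewrite -pmulrn Zp_nat /= gcdn_modl.
by rewrite NegzE rmorphN /= -pmulrn gcdn_ZpN Zp_nat /= gcdn_modl.
Qed.

Definition cong_count (u : nat) (h : int) : nat :=
  (\sum_(x < u) \sum_(y < u) (u%:Z %| (x%:Z * y%:Z - h)%R)%Z)%N.

Definition shift_count (u : nat) (h t1 : int) (S1 : nat) (t2 : int) (S2 : nat) : nat :=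
  (\sum_(a < S1) \sum_(b < S1) \sum_(c < S2) \sum_(d < S2)
    (u%:Z %| ((t1 + a%:Z + b%:Z) * (t2 + c%:Z + d%:Z) - h)%R)%Z)%N.

Lemma cong_countE p (h : int) : cong_count p.+2 h = #|hyperbola (h%:~R : 'I_p.+2)|.
Proof.
rewrite -sum1_card big_mkcond big_prodE; apply: eq_bigr => x _.
apply: eq_bigr => y _; rewrite inE /= -subr_eq0.
rewrite -{2}(natr_Zp x) -{2}(natr_Zp y) !pmulrn -intrM -intrB Zp_int_dvdz.
by case: (_ %| _)%Z.
Qed.

Lemma shift_countE p h t1 S1 t2 S2 : shift_count p.+2 h t1 S1 t2 S2 =
  box_count (h%:~R : 'I_p.+2) t1%:~R S1 t2%:~R S2.
Proof.
do 4!(apply: eq_bigr => ? _).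
by rewrite -[in RHS]subr_eq0 !pmulrn -!intrD -intrM -intrB Zp_int_dvdz.
Qed.

(** [box_count_estimate] over the complex numbers of [R], read back on the real axis. The modulus 1
    is not of the form [p.+2] and is checked by hand. *)
Lemma shift_count_estimate (R : realType) u h t1 S1 t2 S2 (D Kl : R) :
  (0 < u)%N -> 0 <= D -> 0 <= Kl ->
  (2 * gcdn `|h| u ^ 4 * tau u ^ 3 * u ^ 4)%:R <= D * Kl ^+ 4 ->
  `|(u ^ 2 * shift_count u h t1 S1 t2 S2)%:R
    - (S1 ^ 2 * S2 ^ 2 * cong_count u h)%:R| <=
  Kl * ((S1 * (S1 + u))%:R * (S2 * (S2 + u))%:R) +
  (cong_count u h)%:R * (S1%:R * (S1%:R + (tau u)%:R * D) *
     (S2%:R * (S2%:R + (tau u)%:R * D)) - (S1 ^ 2 * S2 ^ 2)%:R).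
Proof.
case: u => [|[|p]] // _ D_ge0 Kl_ge0 HK.
  have -> : shift_count 1 h t1 S1 t2 S2 = (S1 ^ 2 * S2 ^ 2)%N.
    rewrite /shift_count (eq_bigr (fun=> S1 * S2 ^ 2)%N).
      by rewrite sum_nat_const card_ord; ring.
    move=> a _; rewrite (eq_bigr (fun=> S2 ^ 2)%N).
      by rewrite sum_nat_const card_ord.
    move=> b _; rewrite (eq_bigr (fun=> S2)%N).
      by rewrite sum_nat_const card_ord mulnn.
    move=> c _; rewrite (eq_bigr (fun=> 1%N)).
      by rewrite sum_nat_const card_ord muln1.
    by move=> d _; rewrite dvd1z.
  have -> : cong_count 1 h = 1%N.
    by rewrite /cong_count !big_ord1 dvd1z.
  rewrite mul1n muln1 subrr normr0 mul1r addr_ge0 ?mulr_ge0 //.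
  rewrite subr_ge0 natrM !natrX !expr2 ler_pM ?mulr_ge0 // ler_wpM2l //.
    by rewrite lerDl mulr_ge0.
  by rewrite lerDl mulr_ge0.
have [z prim_z] := exists_prim_root (complex R) (ltn0Sn p.+1).
have natC n : (n%:R : R)%:C%C = n%:R by rewrite rmorph_nat.
have := @box_count_estimate p (complex R) z prim_z h%:~R t1%:~R S1 t2%:~R S2 D%:C%C Kl%:C%C.
have normC (x : R) : `|x%:C%C| = `|x|%:C%C.
  by rewrite normc_def /= expr0n addr0 sqrtr_sqr.
rewrite gcdn_Zp_int -cong_countE -shift_countE => est.
have CD := rmorphD (real_complex R); have CM := rmorphM (real_complex R).
have CB := rmorphB (real_complex R).
rewrite -lecR -normC; do 4!rewrite ?CB ?CD ?CM /=.
rewrite !natC; apply: est; rewrite ?lecR //.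
by rewrite -natC -rmorphXn -rmorphM lecR.
Qed.

(** Bezout provides one solution when the gcd divides [h], and [count_linear] counts the rest; a
    solution conversely forces the gcd to divide [h]. *)
Lemma count_cong u (x : 'I_u) (h : int) : (0 < u)%N ->
  (\sum_(y < u) (u%:Z %| (x%:Z * y%:Z - h)%R)%Z)%N =
  if ((gcdn x u)%:Z %| h)%Z then gcdn x u else 0%N.
Proof.
case: u x => [|[|p]] // x _.
  by rewrite big_ord1 ord1 /= gcd0n !dvd1z.
transitivity #|[set y : 'I_p.+2 | (x * y == h%:~R)%R]|.
  rewrite -sum1_card [RHS]big_mkcond /=; apply: eq_bigr => y _; rewrite inE.
  rewrite -subr_eq0 -{2}(natr_Zp x) -{2}(natr_Zp y) !pmulrn -intrM -intrB.
  by rewrite Zp_int_dvdz; case: (_ %| _)%Z.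
case: ifP => [gh|gh].
  have [[a [b ab]] [k hE]] := (Bezoutz x p.+2, dvdzP gh).
  apply: (@count_linear p x h%:~R (a * k)%:~R).
  rewrite -{1}(natr_Zp x) pmulrn -intrM; apply/eqP.
  rewrite -subr_eq0 -intrB Zp_int_dvdz hE.
  have -> : (gcdn x p.+2)%:Z = a * x%:Z + b * p.+2%:Z by rewrite ab.
  apply/dvdzP; exists (- (k * b)); ring.
apply/eqP; rewrite cards_eq0; apply/eqP/setP => y; rewrite !inE.
apply/negP; rewrite -subr_eq0 -{1}(natr_Zp x) -{1}(natr_Zp y) !pmulrn -intrM -intrB.
rewrite Zp_int_dvdz => uxh; move/negP: gh; apply.
have -> : h = x%:Z * y%:Z - (x%:Z * y%:Z - h) by ring.
rewrite rpredB //; first by rewrite dvdz_mulr // dvdzE /= dvdn_gcdl.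
by apply: dvdz_trans uxh; rewrite dvdzE /= dvdn_gcdr.
Qed.

(** Group the [x] by [e = gcdn x u]: there are [totient (u / e)] of them, each with [e] solutions
    [y] if [e] divides [h] and none otherwise. *)
Lemma cong_count_divisors u (h : int) : (0 < u)%N ->
  cong_count u h = (\sum_(e <- divisors u | (e%:Z %| h)%Z) e * totient (u %/ e))%N.
Proof.
move=> u_gt0.
rewrite /cong_count (eq_bigr (fun x : 'I_u => \sum_(e <- divisors u | (e%:Z %| h)%Z)
   e * (gcdn x u == e))%N); last first.
  move=> x _; rewrite count_cong //.
  have gd : gcdn x u \in divisors u by rewrite -dvdn_divisors ?dvdn_gcdr.
  rewrite big_mkcond (bigD1_seq _ gd) ?divisors_uniq //= eqxx muln1 big1 ?addn0 //.
  by move=> e /negPf ne; rewrite eq_sym ne muln0; case: ifP.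
rewrite exchange_big /= big_seq_cond [RHS]big_seq_cond.
apply: eq_bigr => e /andP[ed _]; rewrite -big_distrr /= count_gcdn //.
by rewrite dvdn_divisors.
Qed.

Lemma cong_count_leq u (h : int) : (0 < u)%N -> (cong_count u h <= u * tau u)%N.
Proof.
move=> u_gt0; rewrite /cong_count; apply: leq_trans (sum_gcdn_leq u_gt0).
apply: leq_sum => x _.
by rewrite count_cong //; case: ifP.
Qed.

Lemma cong_countN u (h : int) : (0 < u)%N -> cong_count u (- h) = cong_count u h.
Proof.
move=> u_gt0; rewrite !cong_count_divisors //; apply: eq_bigl => e.
by rewrite dvdzE abszN.
Qed.

(** * Integers in linearly moving intervals, by sawtooth sums *)

Section Discrepancy.
Variable R : realType.
Implicit Types a b x y Y beta : R.

(** The integers of [[a, b]] as a list. The length [n] is a signed integer: the test keeps the list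
    empty when [n] is negative, where the absolute value would not. *)
Definition zitv a b : seq int :=
  let n := Num.floor b - Num.ceil a + 1 in
  [seq Num.ceil a + k%:Z | k <- iota 0 (if 0 <= n then `|n|%N else 0%N)].

Lemma mem_zitv a b (h : int) : (h \in zitv a b) = (a <= h%:~R <= b).
Proof.
rewrite -floor_ge_int -ceil_le_int /zitv.
move: (Num.ceil a) (Num.floor b) => c d.
apply/mapP/andP => [[k]|[ah hb]].
  rewrite mem_iota add0n /= => kn ->; split; first by rewrite lerDl.
  by move: kn; case: ifP => //; lia.
exists `|h - c|%N; last by lia.
by rewrite mem_iota add0n /=; case: ifP; lia.
Qed.

Lemma zitv_uniq a b : uniq (zitv a b).
Proof. by rewrite map_inj_uniq ?iota_uniq // => x y; lia. Qed.

Lemma zitv_nondeg a b : a <= b -> 0 <= Num.floor b - Num.ceil a + 1.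
Proof.
move=> ab; have := ceilB1_lt a; have := floorD1_gt b => h1 h2.
have : (Num.ceil a - 1)%:~R < (Num.floor b + 1)%:~R :> R by lra.
by rewrite ltr_int; lia.
Qed.

Lemma size_zitv a b : a <= b ->
  (size (zitv a b))%:Z = Num.floor b - Num.ceil a + 1.
Proof.
by move=> /zitv_nondeg n_ge0; rewrite size_map size_iota n_ge0; lia.
Qed.

Lemma size_zitv_leq a b : a <= b -> (size (zitv a b))%:R <= b - a + 1.
Proof.
move=> ab; have /(congr1 (fun z : int => z%:~R : R)) := size_zitv ab.
rewrite pmulrn => ->; rewrite intrD intrB.
by have := floor_le b; have := ceil_ge a; lra.
Qed.

Lemma size_zitv_geq a b : a <= b -> b - a - 1 <= (size (zitv a b))%:R.
Proof.
move=> ab; have /(congr1 (fun z : int => z%:~R : R)) := size_zitv ab.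
rewrite pmulrn => ->; rewrite intrD intrB.
have := floorD1_gt b; have := ceilB1_lt a; rewrite intrB intrD; lra.
Qed.

Lemma count_zitv_leq (s : seq int) (P : pred int) a b :
  a <= b -> uniq s -> (forall h, P h -> a <= h%:~R <= b) ->
  (count P s)%:Z <= Num.floor b - Num.ceil a + 1.
Proof.
move=> ab us Pab; rewrite -size_zitv // lez_nat -size_filter.
apply: uniq_leq_size; rewrite ?filter_uniq // => h.
by rewrite mem_filter => /andP[/Pab]; rewrite mem_zitv.
Qed.

Lemma count_zitv_geq (s : seq int) (P : pred int) a b :
  uniq s -> (forall h : int, a < h%:~R < b -> P h /\ h \in s) ->
  Num.ceil b - Num.floor a - 1 <= (count P s)%:Z.
Proof.
move=> us Pab.
have [lt0|ge0] := ltP (Num.ceil b - Num.floor a - 1) 0; first by lia.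
rewrite -(gez0_abs ge0) lez_nat -size_filter.
rewrite -{1}(size_iota 0 `|(Num.ceil b - Num.floor a - 1)%R|%N).
rewrite -(size_map (fun k => Num.floor a + 1 + k%:Z)).
apply: uniq_leq_size.
  by rewrite map_inj_uniq ?iota_uniq // => x y; lia.
move=> _ /mapP[k + ->]; rewrite mem_iota add0n => /andP[_ kn].
rewrite mem_filter; apply/andP; apply: Pab; apply/andP; split.
  by rewrite -floor_lt_int; move: (Num.ceil b) (Num.floor a) ge0 kn; lia.
by rewrite -ceil_gt_int; move: (Num.ceil b) (Num.floor a) ge0 kn; lia.
Qed.

(** This is [1/2 - {x}], with [{x}] the fractional part. *)
Definition saw x : R := (Num.floor x)%:~R - x + 2^-1.

Lemma saw_bound x : `|saw x| <= 1.
Proof.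
rewrite /saw; have := floor_le x; have := floorD1_gt x; rewrite intrD ler_norml.
lra.
Qed.

Lemma sum_modz_coprime (r : nat) (p m : int) : (0 < r)%N -> coprimez p r ->
  (\sum_(k < r) ((k%:Z * p + m) %% r)%Z)%R = (\sum_(k < r) k%:Z)%R.
Proof.
move=> r_gt0 co; have r0 : r%:Z != 0 by lia.
have lt (k : 'I_r) : (`|((k%:Z * p + m) %% r)%Z| < r)%N.
  by have := ltz_pmod (k%:Z * p + m) (_ : 0 < r%:Z); have := modz_ge0 (k%:Z * p + m) r0; lia.
pose f k := Ordinal (lt k).
have inj_f : injective f.
  move=> k l /(congr1 (fun i => (val i)%:Z)) /=.
  rewrite !gez0_abs ?modz_ge0 // => /eqP; rewrite eqz_mod_dvd.
  have -> : k%:Z * p + m - (l%:Z * p + m) = (k%:Z - l%:Z) * p by ring.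
  rewrite Gauss_dvdzl; last by rewrite coprimez_sym.
  move=> /dvdzP[j jE]; apply: val_inj => /=.
  have kr := ltn_ord k; have lr := ltn_ord l.
  have : `|k%:Z - l%:Z| < r%:Z by lia.
  rewrite jE; have [j0|j0] := eqVneq j 0; first by move: jE; rewrite j0 mul0r; lia.
  nia.
rewrite [RHS](reindex_inj inj_f); apply: eq_bigr => k _ /=.
by rewrite gez0_abs // modz_ge0.
Qed.

Lemma sum_ord_half (r : nat) : \sum_(k < r) k%:R = r%:R * (r%:R - 1) / 2 :> R.
Proof.
elim: r => [|r IH]; first by rewrite big_ord0 !mul0r.
by rewrite big_ord_recr /= IH -[r.+1]addn1 natrD; lra.
Qed.

(** Since [k p] is an integer, [Y] may be replaced by its floor; the quotient by [r] is then exact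
    up to the residue of [k p + floor Y], and these residues run through [0, ..., r - 1] once
    ([sum_modz_coprime]). *)
Lemma floor_sum_coprime (r : nat) (p : int) Y : (0 < r)%N -> coprimez p r ->
  \sum_(k < r) (Num.floor ((k%:R * p%:~R + Y) / r%:R))%:~R =
  \sum_(k < r) (k%:R * p%:~R / r%:R) + (Num.floor Y)%:~R - (r%:R - 1) / 2 :> R.
Proof.
move=> r_gt0 co; have r0 : r%:Z != 0 by lia.
have rR : 0 < r%:R :> R by rewrite ltr0n.
have flE (k : 'I_r) : (Num.floor ((k%:R * p%:~R + Y) / r%:R))%:~R =
    (k%:R * p%:~R / r%:R + (Num.floor Y)%:~R / r%:R
    - (((k%:Z * p + Num.floor Y) %% r)%Z)%:~R / r%:R : R).
  set n := k%:Z * p + Num.floor Y.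
  have nE : n%:~R = k%:R * p%:~R + (Num.floor Y)%:~R :> R.
    by rewrite /n intrD intrM -pmulrn.
  have dE : n%:~R = ((n %/ r)%Z)%:~R * r%:R + ((n %% r)%Z)%:~R :> R.
    by rewrite {1}(divz_eq n r) intrD intrM -pmulrn.
  have -> : Num.floor ((k%:R * p%:~R + Y) / r%:R) = (n %/ r)%Z.
    apply: floor_def; rewrite ler_pdivlMr // ltr_pdivrMr //.
    have m0 : 0 <= ((n %% r)%Z)%:~R :> R by rewrite ler0z modz_ge0.
    have m1 : ((n %% r)%Z)%:~R + 1 <= r%:R :> R.
      have := ltz_pmod n (_ : 0 < r%:Z) => /(_ _).
      by rewrite pmulrn -[1]/(1%:~R) -intrD ler_int; lia.
    have := floor_le Y; have := floorD1_gt Y; rewrite !intrD mulrDl mul1r.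
    lra.
  rewrite -mulrDl -mulrBl -nE {1}dE addrK mulfK //.
  by rewrite gt_eqF.
under eq_bigr do rewrite flE.
rewrite sumrB big_split /= -[X in _ - X]big_distrl /=.
have -> : \sum_(i < r) (((i%:Z * p + Num.floor Y) %% r)%Z)%:~R =
   \sum_(k < r) k%:R :> R.
  rewrite -rmorph_sum /= sum_modz_coprime // rmorph_sum /=.
  by apply: eq_bigr => k _; rewrite -pmulrn.
rewrite sum_ord_half sumr_const card_ord -mulr_natl.
by field; rewrite gt_eqF.
Qed.

(** Pigeonhole: [T + 1] fractional parts fall into [T] boxes of width [1/T]. Dividing the resulting
    fraction by its gcd makes it reduced, and only shrinks the denominator and the error. *)
Lemma dirichlet_approx beta (T : nat) : (0 < T)%N ->
  exists (r : nat) (p : int), [/\ (0 < r <= T)%N, coprimez p r &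
    `|beta * r%:R - p%:~R| <= T%:R^-1].
Proof.
move=> T_gt0; have TR : 0 < T%:R :> R by rewrite ltr0n.
pose fr k : R := beta * k%:R - (Num.floor (beta * k%:R))%:~R.
have fr01 k : 0 <= fr k < 1.
  rewrite /fr; have := floor_le (beta * k%:R); have := floorD1_gt (beta * k%:R).
  by rewrite intrD; lra.
have lt k : (Num.trunc (T%:R * fr k) < T)%N.
  have /andP[f0 f1] := fr01 k.
  by rewrite truncn_lt_nat ?gtr_pMr // mulr_ge0 // ltW.
pose f (k : 'I_T.+1) := Ordinal (lt k).
have /injectivePn[k' [l' kl' /(congr1 val) /= flE']] : ~~ injectiveb f.
  by apply/injectiveP => /leq_card; rewrite !card_ord ltnn.
have [k [l [lk kT flE]]] : exists k l, [/\ (l < k)%N, (k <= T)%N &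
    Num.trunc (T%:R * fr k) = Num.trunc (T%:R * fr l)].
  move: kl' flE' (ltn_ord k') (ltn_ord l').
  rewrite neq_ltn !ltnS => /orP[kl|kl] flE kT lT; last by exists k', l'.
  by exists l', k'.
pose r0 := (k - l)%N; pose P := Num.floor (beta * k%:R) - Num.floor (beta * l%:R).
have r0_gt0 : (0 < r0)%N by rewrite subn_gt0.
have app : `|beta * r0%:R - P%:~R| <= T%:R^-1.
  have -> : beta * r0%:R - P%:~R = fr k - fr l.
    by rewrite /r0 natrB ?(ltnW lk) // /P intrB /fr; ring.
  rewrite -(ler_pM2l TR) mulfV ?gt_eqF // -{1}(gtr0_norm TR) -normrM mulrBr.
  have /andP[k0 _] := fr01 k; have /andP[l0 _] := fr01 l.
  have /andP[] := truncn_itv (mulr_ge0 (ltW TR) k0).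
  have /andP[] := truncn_itv (mulr_ge0 (ltW TR) l0).
  by rewrite flE -!natr1 ler_norml; lra.
pose g := gcdn `|P| r0.
have g_gt0 : (0 < g)%N by rewrite gcdn_gt0 r0_gt0 orbT.
have [r rE] := dvdnP (dvdn_gcdr `|P| r0); rewrite -/g in rE.
have /dvdzP[p pE] : (g%:Z %| P)%Z by rewrite dvdzE /= dvdn_gcdl.
have r_gt0 : (0 < r)%N by move: r0_gt0; rewrite rE; case: (r).
exists r, p; split.
- rewrite r_gt0 /=; apply: (@leq_trans r0); first by rewrite rE leq_pmulr.
  by apply: leq_trans kT; rewrite leq_subr.
- rewrite /coprimez /gcdz /=; apply/eqP; congr Posz; apply/eqP.
  by rewrite -(eqn_pmul2r g_gt0) muln_gcdl -rE mul1n {2}/g pE abszM.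
apply: le_trans app; rewrite rE pE intrM natrM -pmulrn mulrA -mulrBl normrM.
by rewrite ler_peMr // normr_nat ler1n.
Qed.

Section Block.
Variables (beta : R) (r : nat) (p : int).
Hypotheses (r_gt0 : (0 < r)%N) (co : coprimez p r).
Hypothesis approx : `|beta * r%:R - p%:~R| <= r%:R^-1.

(** Over one period, [beta k + y = (k p + r y + d k) / r] with [|d k| <= 1]. By monotonicity, each
    floor lies between those with [r y - 1] and [r y + 1] in place of [r y + d k], whose sums
    [floor_sum_coprime] evaluates. *)
Lemma saw_block y : `|\sum_(k < r) saw (beta * k%:R + y)| <= 3.
Proof.
have rR : 0 < r%:R :> R by rewrite ltr0n.
have r1 : 1 <= r%:R :> R by rewrite ler1n.
pose d := beta * r%:R - p%:~R.
have dk (k : 'I_r) : `|d * k%:R| <= 1.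
  rewrite normrM normr_nat; apply: le_trans (_ : r%:R^-1 * r%:R <= _); last by rewrite mulVf ?gt_eqF.
  by rewrite ler_pM // ler_nat ltnW.
have bE (k : 'I_r) : beta * k%:R + y = (k%:R * p%:~R + (d * k%:R + r%:R * y)) / r%:R.
  by rewrite /d; field; rewrite gt_eqF.
have up (k : 'I_r) : (Num.floor (beta * k%:R + y))%:~R <=
    (Num.floor ((k%:R * p%:~R + (r%:R * y + 1)) / r%:R))%:~R :> R.
  rewrite ler_int; apply: le_floor; rewrite bE ler_pM2r ?invr_gt0 // lerD2l.
  by move: (dk k); rewrite ler_norml => /andP[_]; lra.
have dn (k : 'I_r) : (Num.floor ((k%:R * p%:~R + (r%:R * y - 1)) / r%:R))%:~R <=
    (Num.floor (beta * k%:R + y))%:~R :> R.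
  rewrite ler_int; apply: le_floor; rewrite bE ler_pM2r ?invr_gt0 // lerD2l.
  by move: (dk k); rewrite ler_norml => /andP[+ _]; lra.
have sE : \sum_(k < r) saw (beta * k%:R + y) =
    \sum_(k < r) (Num.floor (beta * k%:R + y))%:~R
    - \sum_(k < r) (k%:R * p%:~R / r%:R) - \sum_(k < r) (d * k%:R / r%:R)
    - r%:R * y + r%:R / 2.
  rewrite /saw big_split sumrB /= sumr_const card_ord -mulr_natl.
  under [X in _ - X]eq_bigr do rewrite bE mulrDl mulrDl.
  rewrite big_split big_split /= sumr_const card_ord -[X in _ + X]mulr_natl.
  by field; rewrite gt_eqF.
have dS : `|\sum_(k < r) (d * k%:R / r%:R)| <= 1.
  apply: le_trans (ler_norm_sum _ _ _) _.
  apply: (@le_trans _ _ (\sum_(k < r) r%:R^-1)).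
    apply: ler_sum => k _; rewrite normrM normfV normr_nat -[leRHS]mul1r.
    by apply: ler_wpM2r (dk k); rewrite invr_ge0 ltW.
  by rewrite sumr_const card_ord -[leLHS]mulr_natl mulfV ?gt_eqF.
have U := ler_sum (index_enum _) (fun k (_ : predT k) => up k).
have L := ler_sum (index_enum _) (fun k (_ : predT k) => dn k).
rewrite floor_sum_coprime // in U; rewrite floor_sum_coprime // in L.
have := floor_le (r%:R * y + 1); have := floorD1_gt (r%:R * y - 1).
rewrite intrD => h1 h2.
rewrite sE; move: dS; rewrite !ler_norml => /andP[d1 d2].
apply/andP; split; lra.
Qed.

Lemma saw_sum_leq W y :
  `|\sum_(k < W) saw (beta * k%:R + y)| <= 3 * (W%:R / r%:R) + r%:R.
Proof.
have rR : 0 < r%:R :> R by rewrite ltr0n.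
pose n := (W %/ r)%N; pose t := (W %% r)%N.
have blocks m : `|\sum_(k < m * r) saw (beta * k%:R + y)| <= 3 * m%:R.
  elim: m => [|m IH]; first by rewrite mul0n big_ord0 normr0 mulr0.
  rewrite mulSn addnC big_split_ord /=; apply: le_trans (ler_normD _ _) _.
  rewrite -[m.+1]addn1 natrD mulrDr mulr1; apply: lerD => //.
  rewrite (eq_bigr (fun k : 'I_r => saw (beta * k%:R + (beta * (m * r)%:R + y)))).
    exact: saw_block.
  by move=> k _; rewrite natrD; congr saw; ring.
rewrite (divn_eq W r) -/n -/t big_split_ord /=.
apply: le_trans (ler_normD _ _) _; apply: lerD.
  apply: le_trans (blocks n) _; rewrite ler_pM2l // ler_pdivlMr //.
  by rewrite -natrM ler_nat leq_addr.
apply: le_trans (ler_norm_sum _ _ _) _.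
apply: (@le_trans _ _ (\sum_(k < t) 1)).
  by apply: ler_sum => k _; exact: saw_bound.
by rewrite sumr_const card_ord ler_nat ltnW // ltn_mod.
Qed.

End Block.

(** Because [ceil x = - floor (- x)], each bound on [n w] is [b - a] plus or minus two sawtooth
    values, one along [beta] and one along [- beta]. [saw_sum_leq] bounds each of the four sums by
    [3 W / r + r]. *)
Lemma count_discrepancy beta (r : nat) (p : int) a b W (n : nat -> nat) :
  (0 < r)%N -> coprimez p r -> `|beta * r%:R - p%:~R| <= r%:R^-1 ->
  (forall w, (n w)%:Z <= Num.floor (beta * w%:R + b) - Num.ceil (beta * w%:R + a) + 1) ->
  (forall w, Num.ceil (beta * w%:R + b) - Num.floor (beta * w%:R + a) - 1 <= (n w)%:Z) ->
  `|\sum_(w < W) (n w)%:R - W%:R * (b - a)| <= 6 * (W%:R / r%:R) + 2 * r%:R.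
Proof.
move=> r_gt0 co app n_le n_ge.
have coN : coprimez (- p) r by rewrite coprimeNz.
have appN : `|- beta * r%:R - (- p)%:~R| <= r%:R^-1.
  by rewrite mulNr intrN -opprD normrN.
have E (s : R) : \sum_(w < W) s = W%:R * s by rewrite sumr_const card_ord mulr_natl.
have S1 := saw_sum_leq r_gt0 co app W b.
have S2 := saw_sum_leq r_gt0 coN appN W (- a).
have S3 := saw_sum_leq r_gt0 co app W a.
have S4 := saw_sum_leq r_gt0 coN appN W (- b).
have U : \sum_(w < W) (n w)%:R <= \sum_(w < W) (b - a + saw (beta * w%:R + b)
    + saw (- beta * w%:R + - a)).
  apply: ler_sum => w _; have := n_le w; rewrite -(ler_int R) intrD intrB -pmulrn.
  by rewrite ceilNfloor intrN /saw mulNr -opprD; lra.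
have L : \sum_(w < W) (b - a - saw (beta * w%:R + a)
    - saw (- beta * w%:R + - b)) <= \sum_(w < W) (n w)%:R.
  apply: ler_sum => w _; have := n_ge w; rewrite -(ler_int R) !intrB -pmulrn.
  rewrite ceilNfloor intrN /saw.
  have -> : - beta * w%:R + - b = - (beta * w%:R + b) by ring.
  lra.
move: U L S1 S2 S3 S4; move: saw => sw.
rewrite !sumrB !big_split /= !E mulrN mulrBr !ler_norml.
move: (W%:R * a) (W%:R * b) (W%:R / r%:R) => Wa Wb Wr.
move=> U L /andP[? ?] /andP[? ?] /andP[? ?] /andP[? ?].
apply/andP; split; lra.
Qed.

End Discrepancy.

Local Open Scope classical_set_scope.
Local Open Scope ring_scope.

(** * Exchange of divisor sums, harmonic sums, spaced sequences *)

Section General.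
Variable R : realType.

Lemma sum_divisors_swap (F : nat -> nat -> R) X :
  \sum_(1 <= u < X.+1) \sum_(e <- divisors u) F e (u %/ e)%N =
  \sum_(1 <= e < X.+1) \sum_(1 <= w < (X %/ e).+1) F e w.
Proof.
pose D u e w := if (e * w == u)%N then F e w else 0.
have one u e : (0 < u <= X)%N -> (0 < e)%N ->
    \sum_(1 <= w < X.+1) D u e w = if (e %| u)%N then F e (u %/ e)%N else 0.
  move=> /andP[u0 uX] e0; case: ifP => [/dvdnP[w uE]|eu]; last first.
    rewrite big1_seq // => w _; rewrite /D; case: eqP => // uE.
    by rewrite -uE dvdn_mulr in eu.
  have w0 : (0 < w)%N by move: u0; rewrite uE muln_gt0 => /andP[].
  have wi : w \in index_iota 1 X.+1.
    by rewrite mem_index_iota w0 ltnS (leq_trans _ uX) // uE leq_pmulr.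
  rewrite (bigD1_seq w) ?iota_uniq //= uE mulnK // big1 => [|v vw].
    by rewrite addr0 /D mulnC eqxx.
  by rewrite /D [(w * e)%N]mulnC eqn_pmul2l // (negPf vw).
transitivity (\sum_(1 <= u < X.+1) \sum_(1 <= e < X.+1) \sum_(1 <= w < X.+1) D u e w).
  apply: eq_big_nat => u uX; have u0 : (0 < u)%N by lia.
  rewrite big_seq_cond [RHS]big_seq_cond.
  rewrite [RHS](eq_bigr (fun e => if (e %| u)%N then F e (u %/ e)%N else 0)); last first.
    by move=> e; rewrite mem_index_iota andbT => eX; rewrite one //; lia.
  rewrite -big_mkcondr -[LHS]big_filter -[RHS]big_filter; apply: perm_big; apply: uniq_perm.
  - by rewrite filter_uniq ?divisors_uniq.
  - by rewrite filter_uniq ?iota_uniq.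
  move=> e; rewrite !mem_filter -!dvdn_divisors // mem_index_iota.
  have [eu|] /= := boolP (e %| u)%N; last by rewrite andbF.
  by have := dvdn_leq u0 eu; have := dvdn_gt0 u0 eu; lia.
rewrite exchange_big /=; apply: eq_big_nat => e eX.
rewrite exchange_big /= (@big_cat_nat _ _ _ (X %/ e).+1 1 X.+1) //=; last first.
  by rewrite ltnS leq_div.
rewrite [X in _ + X]big_nat_cond [X in _ + X]big1 ?addr0; last first.
  move=> w /andP[wX _]; rewrite big1_seq // => u; rewrite mem_index_iota => uX.
  rewrite /D; case: eqP => // uE; exfalso; have : (X < e * w)%N; last by lia.
  by rewrite mulnC -ltn_divLR; lia.
apply: eq_big_nat => w wX; have ew : (e * w <= X)%N.
  by rewrite mulnC -leq_divRL; lia.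
have wi : (e * w)%N \in index_iota 1 X.+1.
  by rewrite mem_index_iota ltnS ew andbT muln_gt0; case/andP: eX => -> _; case/andP: wX => ->.
rewrite (bigD1_seq (e * w)%N) ?iota_uniq //= big1 ?addr0 /D ?eqxx // => u.
by rewrite eq_sym => /negPf ->.
Qed.

Definition harmonic_sum (X : nat) : R := \sum_(1 <= e < X.+1) e%:R^-1.

Lemma harmonic_sum_ln X : (0 < X)%N -> harmonic_sum X <= 1 + ln X%:R.
Proof.
case: X => // X _; elim: X => [|X IH].
  by rewrite /harmonic_sum big_nat1 invr1 ln1 addr0.
rewrite /harmonic_sum big_nat_recr //= -/(harmonic_sum X.+1).
have X1 : 0 < X.+1%:R :> R by rewrite ltr0n.
have X2 : 0 < X.+2%:R :> R by rewrite ltr0n.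
suff : X.+2%:R^-1 <= ln X.+2%:R - ln X.+1%:R :> R.
  move=> h; apply: le_trans (lerD IH h) _.
  by rewrite le_eqVlt; apply/orP; left; apply/eqP; ring.
rewrite -opprB -ln_div ?posrE //.
have q0 : 0 < X.+1%:R / X.+2%:R :> R by rewrite divr_gt0.
have qE : X.+2%:R^-1 = - (X.+1%:R / X.+2%:R - 1) :> R.
  have h (t : R) : 0 < t -> (t + 1)^-1 = - (t / (t + 1) - 1).
    by move=> t0; field; rewrite gt_eqF //; lra.
  by rewrite -[X.+2%:R]natr1; apply: h.
rewrite [leLHS]qE lerN2; move: (X.+1%:R / X.+2%:R) q0 => t t0.
by rewrite -{1}(subrK 1 t) [t - 1 + 1]addrC; apply: le_ln1Dx; lra.
Qed.

Lemma harmonic_sum_ge0 X : 0 <= harmonic_sum X.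
Proof. by apply: sumr_ge0 => e _; rewrite invr_ge0. Qed.

(** The map sending [x] to the integer part of [x / g] is injective on [s], with values between 1
    and the integer part of [Y / g]. *)
Lemma spaced_count (s : seq nat) (g : R) (Y : nat) : 0 < g -> uniq s ->
  (forall x, x \in s -> g <= x%:R) -> (forall x, x \in s -> (x <= Y)%N) ->
  (forall x y, x \in s -> y \in s -> (x < y)%N -> g <= (y - x)%:R) ->
  (size s)%:R * g <= Y%:R.
Proof.
move=> g0 us gs sY sg; pose f (x : nat) := Num.trunc (x%:R / g).
have q0 x : 0 <= x%:R / g by rewrite divr_ge0 // ltW.
have lt_f x y : x \in s -> y \in s -> (x < y)%N -> (f x < f y)%N.
  move=> xs ys xy; have := sg _ _ xs ys xy; rewrite natrB ?(ltnW xy) // => gxy.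
  rewrite /f truncn_gt_nat.
  have /andP[le_x _] := truncn_itv (q0 x).
  rewrite -natr1 ler_pdivlMr // mulrDl mul1r.
  by move: le_x; rewrite ler_pdivlMr //; lra.
have inj_f : {in s &, injective f}.
  move=> x y xs ys fxy; apply/eqP; rewrite eqn_leq; apply/andP; split; rewrite leqNgt.
    by apply/negP => /(lt_f _ _ ys xs); rewrite fxy ltnn.
  by apply/negP => /(lt_f _ _ xs ys); rewrite fxy ltnn.
have : (size (map f s) <= size (iota 1 (f Y)))%N.
  apply: uniq_leq_size; first by rewrite map_inj_in_uniq.
  move=> _ /mapP[x xs ->]; rewrite mem_iota add1n ltnS; apply/andP; split.
    by rewrite truncn_gt_nat ler_pdivlMr // mul1r gs.
  by apply: le_truncn; rewrite ler_pM2r ?invr_gt0 // ler_nat sY.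
rewrite size_map size_iota -(ler_nat R) => /le_trans; rewrite -ler_pdivlMr //; apply.
by have /andP[] := truncn_itv (q0 Y).
Qed.

End General.

(** * Diophantine input: the admissible [h], their divisors, and the mean local density *)

Section Dioph.
Variable R : realType.
Variables (kappa alpha C : R).
Hypotheses (kappa2 : 2 <= kappa) (C_gt0 : 0 < C).
Hypothesis dioph : forall (p : int) (q : nat), (0 < q)%N ->
  C / q%:R `^ kappa < `|alpha - p%:~R / q%:R|.

(** The exponent with which an approximation error [d] of [alpha q] by an integer forces
    [q >= (C / d)^nu], see [dioph_denominator]. *)
Definition nu : R := (kappa - 1)^-1.

Lemma nu_gt0 : 0 < nu. Proof. by rewrite invr_gt0; move: kappa2; lra. Qed.

Lemma nu_le1 : nu <= 1.
Proof. by rewrite invf_le1; move: kappa2; lra. Qed.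

Lemma dioph_denominator (p : int) (q : nat) d : (0 < q)%N -> 0 < d ->
  `|alpha * q%:R - p%:~R| <= d -> (C / d) `^ nu <= q%:R.
Proof.
move=> q_gt0 d_gt0 le_d; have q0 : 0 < q%:R :> R by rewrite ltr0n.
have k1 : 0 < kappa - 1 by move: kappa2; lra.
have : C / d <= q%:R `^ (kappa - 1).
  have := dioph p q_gt0.
  have -> : alpha - p%:~R / q%:R = (alpha * q%:R - p%:~R) / q%:R.
    by field; rewrite gt_eqF.
  rewrite normrM normfV normr_nat ltr_pdivlMr // mulrAC => lt.
  have {}lt := lt_le_trans lt le_d.
  rewrite ler_pdivrMr // powRB ?(gt_eqF q0) ?implybT // powRr1 ?ltW //.
  move: lt; rewrite ltr_pdivrMr ?powR_gt0 // => lt.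
  by rewrite mulrAC ltr_pdivlMr // [ltRHS]mulrC.
move=> le; have : (C / d) `^ nu <= (q%:R `^ (kappa - 1)) `^ nu.
  apply: ge0_ler_powR le; rewrite ?nnegrE ?powR_ge0 ?divr_ge0 ?ltW //.
  exact: nu_gt0.
by rewrite -powRrM /nu mulfV ?gt_eqF // (powRr1 (ltW q0)).
Qed.

Variables (A : set R) (a b : R).
Hypotheses (ab : a <= b) (A_open : forall x, a < x < b -> A x)
  (A_closed : forall x, A x -> a <= x <= b).

(* With [u = i - j], this is the condition for [h = u j - N m] to come from a
   pair [(i, j)] with [phi_N i - phi_N j] in [A / N + m]. *)
Definition inH (u : nat) (h : int) : bool :=
  h%:~R + u%:R ^+ 2 / 2 - alpha * u%:R \in A.

Definition Hseq (u : nat) : seq int :=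
  [seq h <- zitv (a + alpha * u%:R - u%:R ^+ 2 / 2) (b + alpha * u%:R - u%:R ^+ 2 / 2)
    | inH u h].

Lemma mem_Hseq u h : (h \in Hseq u) = inH u h.
Proof.
rewrite mem_filter mem_zitv; have [|//] := boolP (inH u h).
by rewrite /inH inE => /A_closed /andP[h1 h2]; apply/andP; split; lra.
Qed.

Lemma Hseq_uniq u : uniq (Hseq u). Proof. by rewrite filter_uniq ?zitv_uniq. Qed.

Lemma size_Hseq u : (size (Hseq u))%:R <= b - a + 1.
Proof.
rewrite size_filter; apply: (@le_trans _ _ (size (zitv (a + alpha * u%:R - u%:R ^+ 2 / 2)
   (b + alpha * u%:R - u%:R ^+ 2 / 2)))%:R).
  by rewrite ler_nat count_size.
apply: le_trans (size_zitv_leq _) _; move: ab; lra.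
Qed.

Definition nH (e w : nat) : nat := count (fun h => (e%:Z %| h)%Z) (Hseq (e * w)).

Lemma nH_leq e w : (nH e w)%:R <= b - a + 1.
Proof. by apply: le_trans (size_Hseq (e * w)); rewrite ler_nat count_size. Qed.

Definition absA : R := `|a| + `|b| + 1.

Lemma absA_gt0 : 0 < absA.
Proof. by rewrite /absA addrC ltr_pwDl // addr_ge0. Qed.

Lemma inH_norm u h : inH u h -> `|h%:~R + u%:R ^+ 2 / 2 - alpha * u%:R| <= absA.
Proof.
rewrite /inH inE => /A_closed /andP[ax xb]; rewrite /absA ler_norml.
have := ler_norm b; have := ler_norm (- a); rewrite normrN.
have := normr_ge0 a; have := normr_ge0 b.
by move: (h%:~R + _ - _) ax xb => x ax xb *; apply/andP; split; lra.
Qed.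

(** Let [h = e k] lie in [Hseq (e w)]. Dividing the condition on [h] by [e] puts
    [alpha w - k - e w^2 / 2] within [absA / e] of 0; doubling makes the subtracted number an
    integer. *)
Lemma nH_approx e w : (0 < e)%N -> (0 < nH e w)%N ->
  exists p : int, `|alpha * (2 * w)%:R - p%:~R| <= 2 * absA / e%:R.
Proof.
move=> e_gt0; rewrite -has_count => /hasP[h]; rewrite mem_Hseq => /inH_norm Hh.
move=> /dvdzP[k hE]; exists (2 * k + e%:Z * w%:Z ^+ 2).
have e0 : 0 < e%:R :> R by rewrite ltr0n.
rewrite ler_pdivlMr // -{1}(gtr0_norm e0) -normrM.
have -> : (alpha * (2 * w)%:R - (2 * k + e%:Z * w%:Z ^+ 2)%:~R) * e%:R =
   - 2 * (h%:~R + (e * w)%:R ^+ 2 / 2 - alpha * (e * w)%:R).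
  rewrite hE !intrD !intrM !natrM -!pmulrn.
  by field.
by rewrite normrM normrN normr_nat ler_pM2l.
Qed.

(** The constant of [dioph_gap]: the 4 allows for the difference of two approximations from
    [nH_approx], and the final 2 is there because the denominator is [2 w]. *)
Definition gapH : R := (C / (4 * absA)) `^ nu / 2.

Lemma gapH_gt0 : 0 < gapH.
Proof.
by rewrite divr_gt0 // powR_gt0 // divr_gt0 // mulr_gt0 // absA_gt0.
Qed.

Lemma dioph_gap e (w : nat) (p : int) : (0 < e)%N -> (0 < w)%N ->
  `|alpha * (2 * w)%:R - p%:~R| <= 4 * absA / e%:R -> gapH * e%:R `^ nu <= w%:R.
Proof.
move=> e_gt0 w_gt0 le.
have e0 : 0 < e%:R :> R by rewrite ltr0n.
have := dioph_denominator (_ : (0 < 2 * w)%N) _ le.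
rewrite muln_gt0 /= => /(_ w_gt0).
have c0 : 0 < 4 * absA by rewrite mulr_gt0 // absA_gt0.
move=> /(_ (divr_gt0 c0 e0)).
have -> : C / (4 * absA / e%:R) = C / (4 * absA) * e%:R.
  by field; rewrite !gt_eqF // absA_gt0.
have x0 : 0 <= C / (4 * absA) by rewrite ltW // divr_gt0.
rewrite (powRM _ x0 (ltW e0)) natrM /gapH; set x := _ `^ nu; set y := _ `^ nu.
by move=> le2; rewrite mulrAC ler_pdivrMr // [leRHS]mulrC.
Qed.

(** Subtracting the approximations for two such [w] gives one for their difference, so these [w] are
    spaced by [gapH * e^nu]. *)
Lemma count_nH_leq e Y : (0 < e)%N ->
  (size [seq w <- iota 1 Y | 0 < nH e w]%N)%:R * (gapH * e%:R `^ nu) <= Y%:R.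
Proof.
move=> e_gt0; have e0 : 0 < e%:R :> R by rewrite ltr0n.
have ge0 : 0 <= 2 * absA / e%:R by rewrite divr_ge0 ?ltW // mulr_gt0 // absA_gt0.
have h4 : 4 * absA / e%:R = 2 * absA / e%:R + 2 * absA / e%:R by field; rewrite gt_eqF.
apply: spaced_count.
- by rewrite mulr_gt0 ?gapH_gt0 ?powR_gt0.
- by rewrite filter_uniq ?iota_uniq.
- move=> w; rewrite mem_filter mem_iota => /andP[/(nH_approx e_gt0)[p hp] /andP[w1 _]].
  by apply: dioph_gap e_gt0 w1 _; apply: le_trans hp _; rewrite h4 lerDl.
- by move=> w; rewrite mem_filter mem_iota => /andP[_]; lia.
move=> x y; rewrite !mem_filter => /andP[/(nH_approx e_gt0)[p hp] _].
move=> /andP[/(nH_approx e_gt0)[r hr] _] xy.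
apply: (@dioph_gap e (y - x)%N (r - p)) => //; first by rewrite subn_gt0.
have -> : alpha * (2 * (y - x))%:R - (r - p)%:~R =
  (alpha * (2 * y)%:R - r%:~R) - (alpha * (2 * x)%:R - p%:~R).
  by rewrite intrB !natrM (natrB _ (ltnW xy)); ring.
by rewrite h4; apply: le_trans (ler_normB _ _) _; exact: lerD.
Qed.

(** This improves on the trivial O([Y]) by the factor [e^(- nu)]; it serves whenever [e] is
    large. *)
Lemma sum_nH_leq e Y : (0 < e)%N ->
  \sum_(1 <= w < Y.+1) (nH e w)%:R <= (b - a + 1) / gapH * (Y%:R * e%:R `^ (- nu)).
Proof.
move=> e_gt0; have e0 : 0 < e%:R :> R by rewrite ltr0n.
have := count_nH_leq Y e_gt0.
rewrite -ler_pdivlMr; last exact: mulr_gt0 gapH_gt0 (powR_gt0 _ e0).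
move=> le.
have ba : 0 <= b - a + 1 by move: ab; lra.
apply: (@le_trans _ _ ((size [seq w <- iota 1 Y | 0 < nH e w]%N)%:R * (b - a + 1))).
  rewrite /index_iota subSS subn0 size_filter.
  have -> : (count (fun w => 0 < nH e w)%N (iota 1 Y))%:R * (b - a + 1) =
      \sum_(w <- iota 1 Y | (0 < nH e w)%N) (b - a + 1).
    by rewrite big_const_seq iter_addr_0 mulr_natl.
  rewrite [leRHS]big_mkcond; apply: ler_sum => w _.
  by case: ifPn => [_|]; [exact: nH_leq | rewrite -eqn0Ngt => /eqP ->].
apply: le_trans (ler_wpM2r ba le) _.
rewrite powRN invfM; set g := gapH^-1; set z := (_ `^ nu)^-1.
by rewrite le_eqVlt; apply/orP; left; apply/eqP; ring.
Qed.

Definition psi (w : nat) : R := (totient w)%:R / w%:R.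

Lemma psi_ge0 w : 0 <= psi w. Proof. by rewrite divr_ge0. Qed.

Lemma psi_le1 w : psi w <= 1.
Proof.
rewrite /psi; case: w => [|w]; first by rewrite invr0 mulr0 ler01.
rewrite ler_pdivrMr ?ltr0n // mul1r ler_nat totient_count_coprime big_mkord.
apply: (@leq_trans (\sum_(i < w.+1) 1)); first by apply: leq_sum => i _; case: coprime.
by rewrite sum1_card card_ord.
Qed.

(** Divide [u], the sum of [totient (u / e)] over [e] dividing [u], by [u] itself. This identity is
    why [aS] has mean [b - a] once [nH e w] is replaced by its expected value [(b - a) / e]. *)
Lemma sum_psi u : (0 < u)%N -> \sum_(e <- divisors u) psi (u %/ e) / e%:R = 1.
Proof.
move=> u_gt0; have u0 : u%:R != 0 :> R by rewrite pnatr_eq0 -lt0n.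
have tot : (\sum_(e <- divisors u) totient (u %/ e) = u)%N.
  rewrite -[RHS]card_ord -sum1_card.
  rewrite (eq_bigr (fun x : 'I_u => \sum_(e <- divisors u) (gcdn x u == e))%N); last first.
    move=> x _; have gd : gcdn x u \in divisors u by rewrite -dvdn_divisors ?dvdn_gcdr.
    rewrite (bigD1_seq _ gd) ?divisors_uniq //= eqxx big1 // => e.
    by rewrite eq_sym => /negPf ->.
  rewrite exchange_big /= big_seq [RHS]big_seq; apply: eq_bigr => e eu.
  by rewrite count_gcdn // dvdn_divisors.
have totR : u%:R = \sum_(e <- divisors u) (totient (u %/ e))%:R :> R.
  by rewrite -natr_sum tot.
apply: (mulIf u0); rewrite mul1r [RHS]totR big_distrl /= big_seq [RHS]big_seq.
apply: eq_bigr => e eu; have e_gt0 := divisors_gt0 u_gt0 eu.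
rewrite -dvdn_divisors // in eu.
have q_gt0 : (0 < u %/ e)%N by rewrite divn_gt0 // dvdn_leq.
rewrite /psi -[X in _ * X%:R](divnK eu) natrM; field.
by rewrite !pnatr_eq0 -!lt0n e_gt0 q_gt0.
Qed.

(** The density of solutions modulo [u], normalised so that a typical residue [h] contributes about
    1, and added over the admissible [h]. *)
Definition aS (u : nat) : R := \sum_(h <- Hseq u) (cong_count u h)%:R / u%:R.

Lemma aS_divisors u : (0 < u)%N ->
  aS u = \sum_(e <- divisors u) psi (u %/ e) * (nH e (u %/ e))%:R.
Proof.
move=> u_gt0; rewrite /aS.
rewrite (eq_bigr (fun h => \sum_(e <- divisors u) psi (u %/ e) * (e%:Z %| h)%Z%:R)).
  rewrite exchange_big /= big_seq [RHS]big_seq; apply: eq_bigr => e eu.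
  rewrite -big_distrr /=; congr (_ * _); rewrite -natr_sum; congr (_%:R).
  rewrite /nH [(e * _)%N]mulnC divnK; last by rewrite dvdn_divisors.
  by rewrite -sum1_count [RHS]big_mkcond; apply: eq_bigr => h _; case: ifP.
move=> h _; rewrite cong_count_divisors // natr_sum big_distrl /= big_mkcond /=.
rewrite big_seq [RHS]big_seq; apply: eq_bigr => e eu.
have e_gt0 := divisors_gt0 u_gt0 eu; rewrite -dvdn_divisors // in eu.
have q_gt0 : (0 < u %/ e)%N by rewrite divn_gt0 // dvdn_leq.
case: ifP => _; rewrite ?mulr0 // mulr1 /psi -[X in _ / X%:R = _](divnK eu) !natrM.
by field; rewrite !pnatr_eq0 -!lt0n e_gt0 q_gt0.
Qed.

(** A bad [h] is a multiple of [e = gcdn |h| u > G], hence is counted by [nH e (u / e)]. For each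
    [e], [sum_nH_leq] gives [(X / e) e^(- nu)], at most [(X / e) G^(- nu)], and the [1 / e] add up
    to the harmonic sum. *)
Lemma bad_pairs_leq (G : R) X : 0 < G ->
  \sum_(1 <= u < X.+1) (count (fun h : int => G < (gcdn `|h| u)%:R) (Hseq u))%:R <=
  (b - a + 1) / gapH * (X%:R * G `^ (- nu) * harmonic_sum R X).
Proof.
move=> G_gt0.
have K0 : 0 <= (b - a + 1) / gapH.
  by rewrite divr_ge0 ?(ltW gapH_gt0) //; move: ab; lra.
pose F e w : R := if G < e%:R then (nH e w)%:R else 0.
apply: (@le_trans _ _ (\sum_(1 <= u < X.+1) \sum_(e <- divisors u) F e (u %/ e)%N)).
  apply: ler_sum_nat => u /andP[u_gt0 _].
  rewrite -sum1_count natr_sum big_mkcond /=.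
  apply: (@le_trans _ _ (\sum_(h <- Hseq u) \sum_(e <- divisors u)
      (if (G < e%:R) && (e%:Z %| h)%Z then 1 else 0))).
    apply: ler_sum => h _; case: ifP => [Gg|_]; last first.
      by apply: sumr_ge0 => e _; case: ifP.
    have gd : gcdn `|h| u \in divisors u by rewrite -dvdn_divisors ?dvdn_gcdr.
    rewrite (bigD1_seq _ gd) ?divisors_uniq //= Gg dvdzE /= dvdn_gcdl lerDl.
    by apply: sumr_ge0 => e _; case: ifP.
  rewrite exchange_big /= big_seq [leRHS]big_seq; apply: ler_sum => e eu.
  rewrite /F /nH [(e * _)%N]mulnC divnK; last by rewrite dvdn_divisors.
  case: ifP => _ /=; last by rewrite big1.
  by rewrite -sum1_count natr_sum [leRHS]big_mkcond.
rewrite sum_divisors_swap mulrA /harmonic_sum big_distrr /=.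
apply: ler_sum_nat => e /andP[e_gt0 _].
have e0 : 0 < e%:R :> R by rewrite ltr0n.
case Ge: (G < e%:R); rewrite /F Ge; last first.
  by rewrite big1 // mulr_ge0 ?invr_ge0 // mulr_ge0 // mulr_ge0 ?powR_ge0.
apply: le_trans (sum_nH_leq (X %/ e) e_gt0) _.
rewrite -[leRHS]mulrA; apply: ler_wpM2l => //.
rewrite -[leRHS]mulrA [G `^ _ * _]mulrC [leRHS]mulrA.
apply: ler_pM; rewrite ?powR_ge0 //; last first.
  rewrite !powRN lef_pV2 ?posrE ?powR_gt0 //.
  by apply: ge0_ler_powR; rewrite ?nnegrE ?ltW // nu_gt0.
by rewrite ler_pdivlMr // -natrM ler_nat leq_trunc_div.
Qed.

(* Dividing [inH (e c w) (e h)] by [e] leaves the quadratic term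
   [e c^2 w^2 / 2], which modulo 1 is [0] or [w / 2]. *)
Lemma nH_floor_bounds e c w (o := odd (e * c ^ 2)%N) (beta := alpha * c%:R - o%:R / 2) :
  (0 < e)%N ->
  (nH e (c * w))%:Z <= Num.floor (beta * w%:R + b / e%:R)
     - Num.ceil (beta * w%:R + a / e%:R) + 1 /\
  Num.ceil (beta * w%:R + b / e%:R) - Num.floor (beta * w%:R + a / e%:R) - 1
    <= (nH e (c * w))%:Z.
Proof.
move=> e_gt0; have e0 : 0 < e%:R :> R by rewrite ltr0n.
(* The integer part of the quadratic term: [o] is the parity of [e c^2], and [w^2] and [w] have the
   same parity. The remaining [o w / 2] goes into the slope [beta]. *)
pose k := ((e * c ^ 2 * w ^ 2 - o * w)./2)%N.
have kE : (k%:R : R) = (e%:R * c%:R ^+ 2 * w%:R ^+ 2 - o%:R * w%:R) / 2.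
  have le_o : (o * w <= e * c ^ 2 * w ^ 2)%N.
    rewrite /o; case: odd (odd_gt0 (n := e * c ^ 2)) => [/(_ isT) p0|_]; last by rewrite mul0n.
    rewrite mul1n; apply: (@leq_trans (w ^ 2)); last by rewrite leq_pmull.
    by case: (w) => // m; rewrite -mulnn leq_pmulr.
  have ev : ~~ odd (e * c ^ 2 * w ^ 2 - o * w).
    by rewrite oddB // [odd (o * w)]oddM oddb oddM oddX /= -/o addbb.
  have kk : (2 * k = e * c ^ 2 * w ^ 2 - o * w)%N by rewrite mul2n even_halfK.
  move/(congr1 (fun n => n%:R : R)): kk; rewrite natrM natrB // !natrM => kk.
  have n2 : 2 != 0 :> R by rewrite pnatr_eq0.
  by apply: (mulfI n2); rewrite kk; field.
have be (h : int) : (h%:~R + (e * (c * w))%:R ^+ 2 / 2 - alpha * (e * (c * w))%:R) / e%:R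
   = h%:~R / e%:R + k%:R - beta * w%:R.
  by rewrite kE /beta !natrM; field; rewrite gt_eqF.
pose s := [seq h <- Hseq (e * (c * w)) | (e%:Z %| h)%Z].
pose L := [seq ((h %/ e)%Z + k%:Z) | h <- s].
have hE h : h \in s -> (h%:~R : R) / e%:R = ((h %/ e)%Z)%:~R.
  rewrite mem_filter => /andP[/divzK Eh _].
  rewrite -[X in X%:~R / _]Eh intrM -pmulrn mulfK //.
  by rewrite gt_eqF.
have uL : uniq L.
  rewrite map_inj_in_uniq; first exact: filter_uniq (Hseq_uniq _).
  move=> x y.
  rewrite !mem_filter => /andP[/divzK xE _] /andP[/divzK yE _] /addIr xy.
  by rewrite -xE -yE xy.
have -> : (nH e (c * w))%:Z = (count predT L)%:Z by rewrite count_predT size_map size_filter.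
have ab_e : beta * w%:R + a / e%:R <= beta * w%:R + b / e%:R.
  by rewrite lerD2l ler_pM2r ?invr_gt0.
split.
  rewrite -(@size_filter _ predT) filter_predT -size_zitv // lez_nat.
  apply: uniq_leq_size => // _ /mapP[h hs ->]; rewrite mem_zitv.
  have := hs; rewrite mem_filter => /andP[_]; rewrite mem_Hseq /inH inE => /A_closed.
  rewrite intrD -(hE _ hs) -pmulrn.
  rewrite -(ler_pM2r (_ : 0 < e%:R^-1)) ?invr_gt0 // -[X in _ && X -> _](ler_pM2r (_ : 0 < e%:R^-1)) ?invr_gt0 //.
  by rewrite be => /andP[h1 h2]; apply/andP; split; lra.
apply: count_zitv_geq => // g /andP[g1 g2]; split=> //.
pose h : int := (g - k%:Z) * e%:Z.
have dh : (e%:Z %| h)%Z by rewrite dvdz_mull.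
have hq : (h %/ e)%Z = g - k%:Z by rewrite /h mulzK // eqz_nat -lt0n.
apply/mapP; exists h; last by rewrite hq subrK.
rewrite mem_filter dh /= mem_Hseq /inH inE; apply: A_open.
have := be h; rewrite [X in _ = X + _ - _](_ : _ = g%:~R - k%:R); last first.
  by rewrite /h intrM intrB -!pmulrn mulfK // gt_eqF.
rewrite subrK => bg.
rewrite -(ltr_pM2r (_ : 0 < e%:R^-1)) ?invr_gt0 // -[X in _ && X](ltr_pM2r (_ : 0 < e%:R^-1)) ?invr_gt0 //.
by rewrite bg; apply/andP; split; lra.
Qed.

(** Approximate the slope [beta] by a reduced fraction with denominator [r <= T]. Since [2 beta] is
    [2 alpha c] minus an integer, [2 c r] is a denominator for [alpha] with error at most [2 / T],
    so the Diophantine condition gives [2 c r >= (C T / 2)^nu]. [count_discrepancy] then applies. *)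
Lemma nH_discrepancy e c W (T : nat) : (0 < e)%N -> (0 < c)%N -> (0 < T)%N ->
  `|\sum_(1 <= w < W.+1) ((nH e (c * w))%:R - (b - a) / e%:R)| <=
  12 * c%:R * W%:R * (C * T%:R / 2) `^ (- nu) + 2 * T%:R.
Proof.
move=> e_gt0 c_gt0 T_gt0.
have e0 : 0 < e%:R :> R by rewrite ltr0n.
have c0 : 0 < c%:R :> R by rewrite ltr0n.
have T0 : 0 < T%:R :> R by rewrite ltr0n.
set o := odd (e * c ^ 2); pose beta := alpha * c%:R - o%:R / 2.
have [r [p [/andP[r_gt0 rT] co app]]] := dirichlet_approx beta T_gt0.
have r0 : 0 < r%:R :> R by rewrite ltr0n.
have app' : `|beta * r%:R - p%:~R| <= r%:R^-1.
  by apply: le_trans app _; rewrite lef_pV2 ?posrE // ler_nat.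
have r_ge : (C * T%:R / 2) `^ nu <= 2 * c%:R * r%:R.
  have := @dioph_denominator (o%:Z * r%:Z + 2 * p) (2 * c * r) (2 / T%:R).
  rewrite !muln_gt0 c_gt0 r_gt0 divr_gt0 // => /(_ isT isT).
  have -> : alpha * (2 * c * r)%:R - (o%:Z * r%:Z + 2 * p)%:~R =
     2 * (beta * r%:R - p%:~R).
    by rewrite /beta !natrM intrD !intrM -!pmulrn; field.
  have -> : C / (2 / T%:R) = C * T%:R / 2 by field; rewrite gt_eqF.
  rewrite !natrM; apply.
  by rewrite normrM normr_nat ler_wpM2l.
have pw0 : 0 < (C * T%:R / 2) `^ nu by rewrite powR_gt0 // divr_gt0 // mulr_gt0.
(* [count_discrepancy] starts at 0 and the sum here at 1; the shift adds [beta] to both end points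
   and leaves the length unchanged. *)
pose n w := nH e (c * w.+1).
have bE w : beta * w.+1%:R = beta * w%:R + beta by rewrite -natr1; ring.
have n_le w : (n w)%:Z <= Num.floor (beta * w%:R + (beta + b / e%:R))
    - Num.ceil (beta * w%:R + (beta + a / e%:R)) + 1.
  by rewrite !(addrA (beta * w%:R) beta) -bE; have [] := nH_floor_bounds c w.+1 e_gt0.
have n_ge w : Num.ceil (beta * w%:R + (beta + b / e%:R))
    - Num.floor (beta * w%:R + (beta + a / e%:R)) - 1 <= (n w)%:Z.
  by rewrite !(addrA (beta * w%:R) beta) -bE; have [] := nH_floor_bounds c w.+1 e_gt0.
have := count_discrepancy W r_gt0 co app' n_le n_ge.
have -> : \sum_(1 <= w < W.+1) ((nH e (c * w))%:R - (b - a) / e%:R) =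
   \sum_(w < W) (n w)%:R - W%:R * (beta + b / e%:R - (beta + a / e%:R)).
  rewrite big_add1 /= big_mkord sumrB sumr_const card_ord -[X in _ - X]mulr_natl.
  by congr (_ - _ * _); ring.
move=> /le_trans; apply; apply: lerD; last by rewrite ler_pM2l // ler_nat.
rewrite powRN -[12 * _ * _]mulrA [12 * _](_ : _ = 6 * (W%:R * (2 * c%:R))); last by ring.
rewrite -[leRHS]mulrA ler_pM2l // -[leRHS]mulrA ler_wpM2l //.
rewrite ler_pdivlMr // mulrC ler_pdivrMr //.
Qed.

(** Expanding [psi] by [totient_mu] turns the weighted sum into unweighted ones over multiples
    [c w], with coefficients at most [1 / c]. This is what the parameter [c] of [nH_discrepancy] is
    for. *)
Lemma nH_weighted_leq e Y (T : nat) : (0 < e)%N -> (0 < T)%N ->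
  `|\sum_(1 <= w < Y.+1) psi w * ((nH e w)%:R - (b - a) / e%:R)| <=
  (12 * Y%:R * (C * T%:R / 2) `^ (- nu) + 2 * T%:R) * harmonic_sum R Y.
Proof.
move=> e_gt0 T_gt0.
have e0 : 0 < e%:R :> R by rewrite ltr0n.
pose g w : R := (nH e w)%:R - (b - a) / e%:R.
have -> : \sum_(1 <= w < Y.+1) psi w * ((nH e w)%:R - (b - a) / e%:R) =
   \sum_(1 <= c < Y.+1) \sum_(1 <= w < (Y %/ c).+1) mu R c / c%:R * g (c * w)%N.
  rewrite -(sum_divisors_swap (fun c w => mu R c / c%:R * g (c * w)%N)).
  apply: eq_big_nat => w /andP[w_gt0 _].
  rewrite /psi totient_mu // big_distrl /= big_seq [RHS]big_seq; apply: eq_bigr => c cw.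
  by rewrite [(c * _)%N]mulnC divnK // dvdn_divisors.
apply: le_trans (ler_norm_sum _ _ _) _.
pose Z := (C * T%:R / 2) `^ (- nu).
have Z0 : 0 <= Z by exact: powR_ge0.
rewrite /harmonic_sum big_distrr /=; apply: ler_sum_nat => c /andP[c_gt0 _].
have c0 : 0 < c%:R :> R by rewrite ltr0n.
rewrite -big_distrr /= normrM normrM normfV normr_nat mulrAC ler_wpM2r ?invr_ge0 //.
have Yc : (Y %/ c)%:R <= Y%:R / c%:R :> R.
  by rewrite ler_pdivlMr // -natrM ler_nat leq_trunc_div.
apply: (@le_trans _ _ `|\sum_(1 <= w < (Y %/ c).+1) g (c * w)%N|).
  by rewrite ler_piMl // norm_mu_le1.
apply: le_trans (nH_discrepancy (Y %/ c) e_gt0 c_gt0 T_gt0) _.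
rewrite lerD2r -/Z ler_wpM2r // -mulrA ler_pM2l // mulrC -ler_pdivlMr //.
Qed.

(** By [aS_divisors] and [sum_psi], the sum is that of [psi w * (nH e w - (b - a) / e)] over
    [e w <= X]. For [e <= E] the discrepancy bound is used; for [e > E] the two parts are bounded
    separately, by [sum_nH_leq] and by [1 / e <= e^(- nu)]. *)
Lemma aS_average X (T : nat) (E : R) : (0 < T)%N -> 0 < E ->
  `|\sum_(1 <= u < X.+1) (aS u - (b - a))| <=
  E * ((12 * X%:R * (C * T%:R / 2) `^ (- nu) + 2 * T%:R) * harmonic_sum R X)
  + ((b - a + 1) / gapH + (b - a)) * (X%:R * E `^ (- nu) * harmonic_sum R X).
Proof.
move=> T_gt0 E_gt0.
have H0 : 0 <= b - a + 1 by move: ab; lra.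
have ba : 0 <= b - a by rewrite subr_ge0.
have g0 := ltW gapH_gt0.
pose g e w : R := psi w * ((nH e w)%:R - (b - a) / e%:R).
have -> : \sum_(1 <= u < X.+1) (aS u - (b - a)) =
    \sum_(1 <= e < X.+1) \sum_(1 <= w < (X %/ e).+1) g e w.
  rewrite -sum_divisors_swap; apply: eq_big_nat => u /andP[u_gt0 _].
  rewrite aS_divisors // -[X in _ - X]mul1r -[X in _ - X * _](sum_psi u_gt0) big_distrl -sumrB /=.
  apply: eq_bigr => e _; rewrite /g.
  by rewrite [RHS]mulrBr; congr (_ - _); rewrite mulrAC mulrA.
set B := _ * harmonic_sum R X.
have B0 : 0 <= B.
  by rewrite mulr_ge0 ?harmonic_sum_ge0 // !addr_ge0 ?mulr_ge0 ?powR_ge0 ?invr_ge0 // ltW.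
have HX0 := harmonic_sum_ge0 R X.
apply: le_trans (ler_norm_sum _ _ _) _.
apply: (@le_trans _ _ (\sum_(1 <= e < X.+1) ((if e%:R <= E then B else 0) +
   ((b - a + 1) / gapH + (b - a)) * (X%:R * E `^ (- nu) * e%:R^-1)))); last first.
  rewrite big_split /= lerD //; last by rewrite -!big_distrr.
  rewrite -big_mkcond /= big_const_seq iter_addr_0 -[leLHS]mulr_natl ler_wpM2r //.
  rewrite -size_filter.
  have [t tE] : exists t, t = Num.trunc E by eexists.
  apply: (@le_trans _ _ (size (iota 1 t))%:R).
    rewrite ler_nat uniq_leq_size ?filter_uniq ?iota_uniq // => e.
    rewrite mem_filter mem_index_iota mem_iota => /and3P[eE e1 _].
    by rewrite e1 add1n ltnS tE truncn_ge_nat // ltW.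
  by rewrite size_iota tE; have /andP[] := truncn_itv (ltW E_gt0).
apply: ler_sum_nat => e /andP[e_gt0 eX].
have e0 : 0 < e%:R :> R by rewrite ltr0n.
have K0 : 0 <= ((b - a + 1) / gapH + (b - a)) * (X%:R * E `^ (- nu) / e%:R).
  apply: mulr_ge0; first by apply: addr_ge0 => //; exact: divr_ge0.
  by apply: divr_ge0 => //; apply: mulr_ge0 => //; exact: powR_ge0.
have Xe : (X %/ e)%:R <= X%:R / e%:R :> R.
  by rewrite ler_pdivlMr // -natrM ler_nat leq_trunc_div.
have [eE|eE] := leP e%:R E.
  apply: le_trans (nH_weighted_leq (X %/ e) e_gt0 T_gt0) _.
  rewrite -[leLHS]addr0 lerD //.
  have XX : (X %/ e)%:R <= X%:R :> R by rewrite ler_nat leq_div.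
  apply: ler_pM; rewrite ?harmonic_sum_ge0 //.
  - by rewrite !addr_ge0 ?mulr_ge0 ?powR_ge0 ?invr_ge0 // ltW.
  - by rewrite lerD2r; apply: ler_wpM2r; rewrite ?powR_ge0 // ler_pM2l.
  rewrite /harmonic_sum [leRHS](@big_cat_nat _ _ _ (X %/ e).+1) //=; last first.
    by rewrite ltnS leq_div.
  by rewrite lerDl sumr_ge0 // => k _; rewrite invr_ge0.
rewrite add0r.
apply: (@le_trans _ _ (\sum_(1 <= w < (X %/ e).+1) ((nH e w)%:R + (b - a) / e%:R))).
  apply: le_trans (ler_norm_sum _ _ _) _; apply: ler_sum => w _.
  rewrite normrM ger0_norm ?psi_ge0 //.
  apply: (@le_trans _ _ `|(nH e w)%:R - (b - a) / e%:R|).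
    by rewrite ler_piMl // psi_le1.
  by apply: le_trans (ler_normB _ _) _; rewrite !ger0_norm ?divr_ge0.
have eEn : e%:R `^ (- nu) <= E `^ (- nu).
  rewrite !powRN lef_pV2 ?posrE ?powR_gt0 //.
  by apply: ge0_ler_powR; rewrite ?nnegrE ?ltW // nu_gt0.
rewrite big_split /= [leRHS]mulrDl; apply: lerD.
  apply: le_trans (sum_nH_leq _ e_gt0) _.
  apply: ler_wpM2l; first exact: divr_ge0.
  by rewrite mulrAC ler_pM ?powR_ge0.
rewrite sumr_const_nat subSS subn0 -[leLHS]mulr_natr -mulrA ler_wpM2l //.
rewrite mulrC mulrAC; apply: ler_pM; rewrite ?invr_ge0 //.
have e1 : e%:R^-1 <= e%:R `^ (- nu) :> R.
  rewrite powRN lef_pV2 ?posrE ?powR_gt0 // -[leRHS](powRr1 (ltW e0)).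
  by apply: ler_powR; rewrite ?ler1n // nu_le1.
by apply: le_trans e1 eEn.
Qed.

End Dioph.

(** * Smoothing by shifts, and counting in progressions *)

Section Tents.
Variable R : realType.

Lemma eq_sum_support (T : eqType) (s1 s2 : seq T) (f : T -> R) :
  uniq s1 -> uniq s2 -> (forall x, f x != 0 -> (x \in s1) = (x \in s2)) ->
  \sum_(x <- s1) f x = \sum_(x <- s2) f x.
Proof.
move=> u1 u2 s12; rewrite (bigID (fun x => f x != 0)) /= [X in _ + X]big1 ?addr0; last first.
  by move=> x; rewrite negbK => /eqP.
rewrite [RHS](bigID (fun x => f x != 0)) /= [X in _ = _ + X]big1 ?addr0; last first.
  by move=> x; rewrite negbK => /eqP.
rewrite -[LHS]big_filter -[RHS]big_filter; apply: perm_big; apply: uniq_perm.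
- exact: filter_uniq.
- exact: filter_uniq.
by move=> x; rewrite !mem_filter; case: eqVneq => //= /s12 ->.
Qed.

Lemma sum_shift (s : seq int) (f : int -> R) (c : int) : uniq s ->
  (forall x, f x != 0 -> (x \in s) && (x - c \in s)) ->
  \sum_(x <- s) f (x + c) = \sum_(x <- s) f x.
Proof.
move=> us fs.
rewrite -(big_map (fun x => x + c) xpredT f); apply: eq_sum_support => //.
  by rewrite map_inj_uniq // => x y /addIr.
move=> x /fs /andP[-> xc]; apply/mapP; exists (x - c) => //.
by rewrite subrK.
Qed.

Section Smoothing.
Variables (s1 s2 : seq int) (F osc : int -> int -> R) (P : int -> int -> bool).
Variables (S1 S2 : nat) (c err : R).
Hypotheses (u1 : uniq s1) (u2 : uniq s2) (S1_gt0 : (0 < S1)%N) (S2_gt0 : (0 < S2)%N).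
Hypothesis F_ge0 : forall N m, 0 <= F N m.
Hypothesis supp : forall N m (k l : nat), F N m != 0 -> (k < 2 * S1)%N -> (l < 2 * S2)%N ->
  (N - k%:Z \in s1) && (m - l%:Z \in s2).
Hypothesis oscP : forall N m (k l : nat), (k < 2 * S1)%N -> (l < 2 * S2)%N ->
  `|F (N + k%:Z) (m + l%:Z) - F N m| <= osc N m.

Definition local_count (N m : int) : nat :=
  (\sum_(a < S1) \sum_(b < S1) \sum_(c < S2) \sum_(d < S2)
    P (N + a%:Z + b%:Z) (m + c%:Z + d%:Z))%N.

Hypothesis local_countP : forall N m,
  `|(local_count N m)%:R - c * (S1 ^ 2 * S2 ^ 2)%:R| <= err * (S1 ^ 2 * S2 ^ 2)%:R.

(** [F] is a weight, [P] a set of points. The sum of [F P] is unchanged by each shift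
    [(a + b, c + d)], because the lists contain the shifted support; average over all shifts.
    Replacing the shifted [F] by [F] costs [osc], and what is left is [F] times the local count of
    [P], which is [c] up to [err] per shift. *)
Lemma smoothing :
  `|\sum_(N <- s1) \sum_(m <- s2) F N m * (P N m)%:R
    - c * \sum_(N <- s1) \sum_(m <- s2) F N m| <=
  err * \sum_(N <- s1) \sum_(m <- s2) F N m
  + (c + err) * \sum_(N <- s1) \sum_(m <- s2) osc N m.
Proof.
pose Q : R := (S1 ^ 2 * S2 ^ 2)%:R.
have Q0 : 0 < Q by rewrite ltr0n muln_gt0 !expn_gt0 S1_gt0 S2_gt0.
pose G N m := F N m * (P N m)%:R.
have sh (k l : nat) : (k < 2 * S1)%N -> (l < 2 * S2)%N ->
    \sum_(N <- s1) \sum_(m <- s2) G (N + k%:Z) (m + l%:Z) =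
    \sum_(N <- s1) \sum_(m <- s2) G N m.
  move=> kS lS.
  have in_s N m : F N m != 0 -> [/\ N \in s1, N - k%:Z \in s1, m \in s2 & m - l%:Z \in s2].
    move=> Fn; have /andP[-> ->] := supp Fn kS lS.
    have := @supp N m 0%N 0%N Fn; rewrite !subr0 !muln_gt0 S1_gt0 S2_gt0.
    by move=> /(_ isT isT) /andP[-> ->].
  have GF N m : G N m != 0 -> F N m != 0.
    by apply: contra => /eqP F0; rewrite /G F0 mul0r.
  rewrite (@sum_shift s1 (fun N => \sum_(m <- s2) G N (m + l%:Z)) k%:Z) //.
    apply: eq_bigr => N _; apply: (@sum_shift s2 (G N)) => //.
    by move=> m /GF /in_s [_ _ -> ->].
  move=> N; have [/hasP[m _ Gn] _|/hasPn none] := boolP (has (fun m => G N (m + l%:Z) != 0) s2).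
    by have [-> ->] := in_s _ _ (GF _ _ Gn).
  by rewrite big1_seq ?eqxx // => m /andP[_ /none]; rewrite negbK => /eqP.
have avg : Q * \sum_(N <- s1) \sum_(m <- s2) G N m =
  \sum_(N <- s1) \sum_(m <- s2) \sum_(a < S1) \sum_(b < S1) \sum_(e < S2) \sum_(d < S2)
    G (N + a%:Z + b%:Z) (m + e%:Z + d%:Z).
  transitivity (\sum_(a < S1) \sum_(b < S1) \sum_(e < S2) \sum_(d < S2)
     \sum_(N <- s1) \sum_(m <- s2) G (N + a%:Z + b%:Z) (m + e%:Z + d%:Z)); last first.
    rewrite [RHS](eq_bigr (fun N => \sum_(a < S1) \sum_(b < S1) \sum_(e < S2) \sum_(d < S2)
      \sum_(m <- s2) G (N + a%:Z + b%:Z) (m + e%:Z + d%:Z))); last first.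
      move=> N _; rewrite exchange_big; apply: eq_bigr => a _ /=.
      rewrite exchange_big; apply: eq_bigr => b _ /=.
      rewrite exchange_big; apply: eq_bigr => e _ /=.
      by rewrite exchange_big.
    rewrite [RHS]exchange_big; apply: eq_bigr => a _ /=.
    rewrite [RHS]exchange_big; apply: eq_bigr => b _ /=.
    rewrite [RHS]exchange_big; apply: eq_bigr => e _ /=.
    by rewrite [RHS]exchange_big.
  rewrite [RHS](eq_bigr (fun=> \sum_(b < S1) \sum_(e < S2) \sum_(d < S2)
     \sum_(N <- s1) \sum_(m <- s2) G N m)); last first.
    move=> a _; apply: eq_bigr => b _; apply: eq_bigr => e _; apply: eq_bigr => d _.
    rewrite -(sh (a + b)%N (e + d)%N).
    - by apply: eq_bigr => N _; apply: eq_bigr => m _; rewrite !PoszD !addrA.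
    - by have := ltn_ord a; have := ltn_ord b; lia.
    - by have := ltn_ord e; have := ltn_ord d; lia.
  by rewrite !sumr_const !card_ord -!mulrnA -[RHS]mulr_natl /Q; congr (_%:R * _); ring.
pose D N m := \sum_(a < S1) \sum_(b < S1) \sum_(e < S2) \sum_(d < S2)
  (F (N + a%:Z + b%:Z) (m + e%:Z + d%:Z) - F N m) *
  (P (N + a%:Z + b%:Z) (m + e%:Z + d%:Z))%:R.
have lc N m : (local_count N m)%:R = \sum_(a < S1) \sum_(b < S1) \sum_(e < S2)
    \sum_(d < S2) (P (N + a%:Z + b%:Z) (m + e%:Z + d%:Z))%:R :> R.
  by rewrite /local_count natr_sum; do 3!(apply: eq_bigr => ? _; rewrite natr_sum).
have avg2 : Q * \sum_(N <- s1) \sum_(m <- s2) G N m =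
  \sum_(N <- s1) \sum_(m <- s2) (F N m * (local_count N m)%:R + D N m).
  rewrite avg; apply: eq_bigr => N _; apply: eq_bigr => m _.
  rewrite lc /D big_distrr -big_split; apply: eq_bigr => a _ /=.
  rewrite big_distrr -big_split; apply: eq_bigr => b _ /=.
  rewrite big_distrr -big_split; apply: eq_bigr => e _ /=.
  rewrite big_distrr -big_split; apply: eq_bigr => d _ /=.
  by rewrite -mulrDl [F N m + _]addrC subrK.
have DP N m : `|D N m| <= osc N m * (local_count N m)%:R.
  rewrite lc big_distrr; apply: le_trans (ler_norm_sum _ _ _) _; apply: ler_sum => a _.
  rewrite big_distrr; apply: le_trans (ler_norm_sum _ _ _) _; apply: ler_sum => b _.
  rewrite big_distrr; apply: le_trans (ler_norm_sum _ _ _) _; apply: ler_sum => e _.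
  rewrite big_distrr; apply: le_trans (ler_norm_sum _ _ _) _; apply: ler_sum => d _ /=.
  rewrite normrM normr_nat ler_wpM2r // -!addrA -!PoszD; apply: oscP.
    by have := ltn_ord a; have := ltn_ord b; lia.
  by have := ltn_ord e; have := ltn_ord d; lia.
have osc_ge0 N m : 0 <= osc N m.
  have := @oscP N m 0%N 0%N; rewrite !muln_gt0 S1_gt0 S2_gt0 => /(_ isT isT).
  by apply: le_trans.
have lc_le N m : (local_count N m)%:R <= (c + err) * Q.
  by have := local_countP N m; rewrite -/Q ler_norml => /andP[_]; rewrite lerBlDr mulrDl addrC.
rewrite -(ler_pM2l Q0) -{1}(gtr0_norm Q0) -normrM mulrBr avg2 mulrDr.
have -> : Q * (c * \sum_(N <- s1) \sum_(m <- s2) F N m) =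
   \sum_(N <- s1) \sum_(m <- s2) F N m * (c * Q).
  transitivity ((\sum_(N <- s1) \sum_(m <- s2) F N m) * (c * Q)); first by ring.
  by rewrite big_distrl; apply: eq_bigr => N _ /=; rewrite big_distrl.
rewrite -sumrB; apply: le_trans (ler_norm_sum _ _ _) _.
apply: (@le_trans _ _ (\sum_(N <- s1) \sum_(m <- s2)
   (F N m * (err * Q) + osc N m * ((c + err) * Q)))).
  apply: ler_sum => N _; rewrite -sumrB; apply: le_trans (ler_norm_sum _ _ _) _.
  apply: ler_sum => m _; rewrite addrAC -mulrBr.
  apply: le_trans (ler_normD _ _) _; apply: lerD.
    by rewrite normrM ger0_norm // ler_wpM2l // local_countP.
  by apply: le_trans (DP N m) _; rewrite ler_wpM2l.
rewrite le_eqVlt; apply/orP; left; apply/eqP.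
under eq_bigr do rewrite big_split -!big_distrl.
by rewrite big_split -!big_distrl /=; ring.
Qed.

End Smoothing.

Lemma count_itv_leq (s : seq int) (p : pred int) (lo hi : R) : lo <= hi -> uniq s ->
  (forall h, p h -> lo <= h%:~R <= hi) -> (count p s)%:R <= hi - lo + 1.
Proof.
move=> lh us ph; apply: le_trans (size_zitv_leq lh).
rewrite ler_nat -size_filter; apply: uniq_leq_size; rewrite ?filter_uniq // => h.
by rewrite mem_filter mem_zitv => /andP[/ph].
Qed.

(* [m] runs over integers in a progression modulo [u / gcdn N u]. *)
Lemma count_cong_itv (s : seq int) (N h : int) (u : nat) (lo hi : R) : (0 < u)%N ->
  lo <= hi -> uniq s ->
  (count (fun m : int => (lo <= m%:~R <= hi) && (u%:Z %| (N * m + h)%R)%Z) s)%:R <=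
  (gcdn `|N| u)%:R * ((hi - lo) / u%:R) + 1.
Proof.
move=> u_gt0 lh us; set p := fun m => _; set g := gcdn `|N| u.
have g_gt0 : (0 < g)%N by rewrite gcdn_gt0 u_gt0 orbT.
have [k kE] := dvdnP (dvdn_gcdr `|N| u); rewrite -/g in kE.
have k_gt0 : (0 < k)%N by move: u_gt0; rewrite kE muln_gt0 => /andP[].
have k0 : 0 < k%:R :> R by rewrite ltr0n.
have [/hasP[m0 m0s /andP[m0i um0]]|] := boolP (has p s); last first.
  rewrite has_count -eqn0Ngt => /eqP ->.
  by rewrite addr_ge0 // mulr_ge0 // divr_ge0 // subr_ge0.
pose f (m : int) : int := ((m - m0) %/ k%:Z)%Z.
have km m : p m -> m = f m * k%:Z + m0.
  move=> /andP[_ um]; rewrite /f divzK ?subrK //.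
  have := rpredB um um0; rewrite opprD addrACA subrr addr0 -mulrBr.
  have [n nE] : exists n : int, N = n * g%:Z.
    by apply/dvdzP; rewrite dvdzE /= dvdn_gcdl.
  rewrite nE kE PoszM mulrAC dvdz_mul2r ?Gauss_dvdzr //.
    rewrite coprimez_sym /coprimez /gcdz /=; apply/eqP; congr Posz; apply/eqP.
    by rewrite -(eqn_pmul2r g_gt0) muln_gcdl mul1n -kE {2}/g nE abszM.
  by rewrite eqz_nat -lt0n.
have fE m : p m -> ((f m)%:~R : R) = (m%:~R - m0%:~R) / k%:R.
  by move=> /km {2}->; rewrite intrD intrM -pmulrn addrK mulfK // gt_eqF.
have le1 : (lo - m0%:~R) / k%:R <= (hi - m0%:~R) / k%:R.
  by rewrite ler_pM2r ?invr_gt0 // lerD2r.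
have -> : g%:R * ((hi - lo) / u%:R) = (hi - m0%:~R) / k%:R - (lo - m0%:~R) / k%:R.
  by rewrite kE natrM; field; rewrite !pnatr_eq0 -!lt0n g_gt0 k_gt0.
apply: le_trans (size_zitv_leq le1); rewrite ler_nat -size_filter.
rewrite -(size_map f); apply: uniq_leq_size.
  rewrite map_inj_in_uniq ?filter_uniq // => x y; rewrite !mem_filter.
  by move=> /andP[/km xE _] /andP[/km yE _] fxy; rewrite xE yE fxy.
move=> _ /mapP[m + ->]; rewrite mem_filter => /andP[pm _].
rewrite mem_zitv (fE _ pm) !ler_pM2r ?invr_gt0 // !lerD2r.
by case/andP: pm.
Qed.

Lemma count_multiples_itv (s : seq int) (e : nat) (lo hi : R) : (0 < e)%N -> lo <= hi ->
  uniq s -> (forall N, N \in s -> lo <= N%:~R <= hi) ->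
  (count (fun N : int => (e%:Z %| N)%Z) s)%:R <= (hi - lo) / e%:R + 1.
Proof.
move=> e_gt0 lh us slh; have e0 : 0 < e%:R :> R by rewrite ltr0n.
have le1 : lo / e%:R <= hi / e%:R by rewrite ler_pM2r ?invr_gt0.
rewrite mulrBl; apply: le_trans (size_zitv_leq le1).
rewrite ler_nat -size_filter -(size_map (fun N => (N %/ e%:Z)%Z)).
apply: uniq_leq_size.
  rewrite map_inj_in_uniq ?filter_uniq // => x y; rewrite !mem_filter.
  by move=> /andP[/divzK xE _] /andP[/divzK yE _] xy; rewrite -xE -yE xy.
move=> _ /mapP[N + ->]; rewrite mem_filter => /andP[/divzK NE /slh].
rewrite mem_zitv !ler_pdivrMr // !ler_pdivlMr //.
by rewrite -{1 2}NE intrM -pmulrn.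
Qed.

(** As in [sum_gcdn_leq], a gcd is at most the sum of the divisors of [u] that divide [N]; a divisor
    [e] contributes at most the length of the interval plus [e]. *)
Lemma sum_gcdn_itv (s : seq int) (u : nat) (lo hi : R) : (0 < u)%N -> lo <= hi ->
  uniq s -> (forall N, N \in s -> lo <= N%:~R <= hi) ->
  \sum_(N <- s) (gcdn `|N| u)%:R <= (tau u)%:R * (hi - lo + u%:R).
Proof.
move=> u_gt0 lh us slh.
apply: (@le_trans _ _ (\sum_(N <- s) \sum_(e <- divisors u)
    (if (e%:Z %| N)%Z then e%:R else 0))).
  apply: ler_sum => N _.
  have gd : gcdn `|N| u \in divisors u by rewrite -dvdn_divisors ?dvdn_gcdr.
  rewrite (bigD1_seq _ gd) ?divisors_uniq //= dvdzE /= dvdn_gcdl lerDl.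
  by apply: sumr_ge0 => e _; case: ifP.
rewrite exchange_big /= /tau -sum1_size natr_sum big_distrl /= big_seq [leRHS]big_seq.
apply: ler_sum => e eu; have e_gt0 := divisors_gt0 u_gt0 eu.
rewrite -dvdn_divisors // in eu.
rewrite -big_mkcond /= big_const_seq iter_addr_0 -[leLHS]mulr_natr mul1r.
have e0 : 0 < e%:R :> R by rewrite ltr0n.
apply: le_trans (ler_wpM2l (ltW e0) (count_multiples_itv e_gt0 lh us slh)) _.
rewrite mulrDr mulr1 mulrCA mulfV ?gt_eqF // mulr1 lerD2l ler_nat.
exact: dvdn_leq.
Qed.

End Tents.

(** * The weight carried by a point [(N, m)] and its oscillation *)

Section Kernel.
Variable R : realType.

(** Fixes the end points of an interval and leaves open whether they belong to it; the empty set
    qualifies with [a = b]. *)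
Definition between (B : set R) (a b : R) : Prop :=
  [/\ a <= b, forall x, a < x < b -> B x & forall x, B x -> a <= x <= b].

Lemma between_change B a b x y r : between B a b -> `|y - x| <= r ->
  (y \in B) != (x \in B) -> (`|x - a| <= r) || (`|x - b| <= r).
Proof.
move=> [ab op cl]; rewrite !ler_norml => /andP[r1 r2].
have out z : z \notin B -> (z <= a) || (b <= z).
  rewrite notin_setE => nB; rewrite !leNgt -negb_and; apply/negP => ?; exact/nB/op.
have inn z : z \in B -> a <= z <= b by rewrite inE; exact: cl.
have [yB|yB] := boolP (y \in B); have [xB|xB] //= := boolP (x \in B) => _.
  by case/andP: (inn _ yB) => ? ?; case/orP: (out _ xB) => ?; apply/orP;
    [left|right]; apply/andP; split; lra.
by case/andP: (inn _ xB) => ? ?; case/orP: (out _ yB) => ?; apply/orP;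
  [left|right]; apply/andP; split; lra.
Qed.

Variables (B1 B2 : set R) (a1 b1 a2 b2 : R).
Hypotheses (btw1 : between B1 a1 b1) (btw2 : between B2 a2 b2).

Section Fixed.
Variables (M V : R) (u : nat) (h : int).

(* For [j = (N m + h) / u] and [i = j + u] these are [j / N] and [i / N]. *)
Definition ycoord (N m : int) : R := (m%:~R + h%:~R / N%:~R) / u%:R.
Definition zcoord (N m : int) : R := ycoord N m + u%:R / N%:~R.

Definition kernel (N m : int) : R :=
  if [&& M <= N%:~R <= M + V, ycoord N m \in B2 & zcoord N m \in B1]
  then N%:~R^-1 else 0.

Definition ballind (x p r : R) : R := (`|x - p| <= r)%R%:R.

(** An upper bound for the change of [kernel] under shifts by less than [2 S1] and [2 S2], given
    that [y] and [z] move by at most [rho] and [rho']. The indicators can change only near the two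
    ends of the range of [N] or near the four end points of [B2] and [B1]; the last summand is the
    change of [1 / N]. The factor [wide] says that [y] is within [rho] of [[a2, b2]]. *)
Definition kernel_osc (S1 : nat) (rho rho' : R) (N m : int) : R :=
  let y := ycoord N m in let z := zcoord N m in
  let wide := ballind y ((a2 + b2) / 2) ((b2 - a2) / 2 + rho) in
  if M - 2 * S1%:R <= N%:~R <= M + V then
    M^-1 * (((N%:~R < M) || (M + V - 2 * S1%:R < N%:~R))%R%:R * wide
    + ballind y a2 rho + ballind y b2 rho
    + ballind z a1 rho' + ballind z b1 rho' + 2 * S1%:R / M * wide)
  else 0.

Hypotheses (M_gt0 : 0 < M) (u_gt0 : (0 < u)%N).

Lemma kernel_ge0 N m : 0 <= kernel N m.
Proof.
rewrite /kernel; case: ifP => // /and3P[/andP[MN _] _ _].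
by rewrite invr_ge0 (le_trans _ MN) // ltW.
Qed.

Lemma kernel_leV N m : kernel N m <= M^-1.
Proof.
rewrite /kernel; case: ifP => [/and3P[/andP[MN _] _ _]|_].
  by rewrite lef_pV2 ?posrE // (lt_le_trans M_gt0).
by rewrite invr_ge0 ltW.
Qed.

Lemma ballind_ge0 x p r : 0 <= ballind x p r. Proof. exact: ler0n. Qed.

Lemma kernel_oscP (S1 S2 : nat) (Hm rho rho' : R) :
  `|h%:~R| <= Hm -> (4 * S1%:R : R) <= M ->
  rho = (2 * S2%:R + Hm * (8 * S1%:R / M ^+ 2)) / u%:R ->
  rho' = rho + u%:R * (8 * S1%:R / M ^+ 2) ->
  forall (N m : int) (k l : nat), (k < 2 * S1)%N -> (l < 2 * S2)%N ->
  `|kernel (N + k%:Z) (m + l%:Z) - kernel N m| <= kernel_osc S1 rho rho' N m.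
Proof.
move=> hH SM rhoE rho'E N m k l kS lS; have Mgt0 : 0 < M := M_gt0.
have u0 : 0 < u%:R :> R by rewrite ltr0n.
have k0 : 0 <= k%:R :> R by [].
have kR : k%:R <= 2 * S1%:R :> R by rewrite -natrM ler_nat ltnW.
have lR : l%:R <= 2 * S2%:R :> R by rewrite -natrM ler_nat ltnW.
have Nk : (N + k%:Z)%:~R = N%:~R + k%:R :> R by rewrite intrD -pmulrn.
have M0 : 0 < M^-1 by rewrite invr_gt0.
rewrite /kernel_osc; set wide := ballind _ _ _.
case: ifPn => [/andP[N1 N2]|Nout]; last first.
  rewrite /kernel Nk ifF; last first.
    apply/negP => /and3P[/andP[n1 n2] _ _]; move/negP: Nout; apply.
    by apply/andP; split; lra.
  rewrite ifF ?subrr ?normr0 //.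
  apply/negP => /and3P[/andP[n1 n2] _ _]; move/negP: Nout; apply.
  have S0 : 0 <= S1%:R :> R by [].
  by apply/andP; split; lra.
have N0 : 0 < N%:~R :> R by lra.
have Nk0 : 0 < N%:~R + k%:R :> R by lra.
have NM : M / 2 <= N%:~R by lra.
pose d : R := N%:~R^-1 - (N%:~R + k%:R)^-1.
have dE : d = k%:R / (N%:~R * (N%:~R + k%:R)).
  by rewrite /d; field; rewrite !gt_eqF.
have d0 : 0 <= d by rewrite dE divr_ge0 // mulr_ge0 // ltW.
have d1 : d <= 8 * S1%:R / M ^+ 2.
  rewrite dE ler_pdivrMr ?mulr_gt0 //.
  (* As [4 S1 <= M], both [N] and [N + k] are at least [M / 2]; with [k <= 2 S1] this is where
     [8 S1 / M^2] comes from. *)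
  have q : M ^+ 2 / 4 <= N%:~R * (N%:~R + k%:R) by nra.
  apply: (@le_trans _ _ (8 * S1%:R / M ^+ 2 * (M ^+ 2 / 4))).
    have -> : 8 * S1%:R / M ^+ 2 * (M ^+ 2 / 4) = 2 * S1%:R by field; rewrite gt_eqF.
    by [].
  by rewrite ler_wpM2l // divr_ge0 // exprn_ge0 // ltW.
have yd : `|ycoord (N + k%:Z) (m + l%:Z) - ycoord N m| <= rho.
  have -> : ycoord (N + k%:Z) (m + l%:Z) - ycoord N m = (l%:R - h%:~R * d) / u%:R.
    by rewrite /ycoord Nk intrD -pmulrn /d; field; rewrite !gt_eqF.
  rewrite rhoE normrM normfV normr_nat ler_pM2r ?invr_gt0 //.
  apply: le_trans (ler_normB _ _) _; rewrite normr_nat normrM (ger0_norm d0).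
  by apply: lerD => //; apply: ler_pM.
have zd : `|zcoord (N + k%:Z) (m + l%:Z) - zcoord N m| <= rho'.
  have -> : zcoord (N + k%:Z) (m + l%:Z) - zcoord N m =
     (ycoord (N + k%:Z) (m + l%:Z) - ycoord N m) - u%:R * d.
    by rewrite /zcoord Nk /d; field; rewrite !gt_eqF.
  apply: le_trans (ler_normB _ _) _; rewrite rho'E; apply: lerD => //.
  by rewrite normrM normr_nat (ger0_norm d0) ler_wpM2l.
have b0 x p r : 0 <= ballind x p r by exact: ler0n.
have rest_ge0 : 0 <= 2 * S1%:R / M * wide by rewrite !mulr_ge0 // ltW.
have wideE : (ycoord N m \in B2) || (ycoord (N + k%:Z) (m + l%:Z) \in B2) -> wide = 1.
  have [_ _ cl] := btw2; move: yd; rewrite /wide /ballind !ler_norml => /andP[y1 y2].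
  move=> HB; suff -> : - ((b2 - a2) / 2 + rho) <= ycoord N m - (a2 + b2) / 2 <= (b2 - a2) / 2 + rho by [].
  case/orP: HB; rewrite inE => /cl/andP[? ?]; apply/andP; split; lra.
have diff_le : `|kernel (N + k%:Z) (m + l%:Z) - kernel N m| <= M^-1.
  have := kernel_ge0 N m; have := kernel_ge0 (N + k%:Z) (m + l%:Z).
  have := kernel_leV N m; have := kernel_leV (N + k%:Z) (m + l%:Z).
  by rewrite ler_norml => *; apply/andP; split; lra.
have S0 : 0 <= S1%:R :> R by [].
have [HB|] := boolP ((ycoord N m \in B2) || (ycoord (N + k%:Z) (m + l%:Z) \in B2)); last first.
  rewrite negb_or => /andP[/negPf y1 /negPf y2]; rewrite /kernel y1 y2 !andbF /= subrr normr0.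
  by rewrite mulr_ge0 ?addr_ge0 ?mulr_ge0 // ltW.
have big1 (X : R) : 1 <= X -> `|kernel (N + k%:Z) (m + l%:Z) - kernel N m| <= M^-1 * X.
  by move=> X1; apply: le_trans diff_le _; rewrite ler_peMr // ltW.
have w1 := wideE HB; rewrite w1 !mulr1 in rest_ge0 *.
have bl x p r := b0 x p r.
have [Ends|NE] := boolP ((N%:~R < M) || (M + V - 2 * S1%:R < N%:~R)).
  by apply: big1; rewrite -!addrA lerDl !addr_ge0.
rewrite mulr0n add0r; move: NE; rewrite negb_or -!leNgt => /andP[e1 e2].
have [yc|/negPn /eqP yc] := boolP ((ycoord (N + k%:Z) (m + l%:Z) \in B2) != (ycoord N m \in B2)).
  have := between_change btw2 yd yc => /orP[] H; apply: big1.
    have -> : ballind (ycoord N m) a2 rho = 1 by rewrite /ballind H.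
    have := bl (ycoord N m) b2 rho; have := bl (zcoord N m) a1 rho'.
    have := bl (zcoord N m) b1 rho'; lra.
  have -> : ballind (ycoord N m) b2 rho = 1 by rewrite /ballind H.
  have := bl (ycoord N m) a2 rho; have := bl (zcoord N m) a1 rho'.
  have := bl (zcoord N m) b1 rho'; lra.
have [zc|/negPn /eqP zc] := boolP ((zcoord (N + k%:Z) (m + l%:Z) \in B1) != (zcoord N m \in B1)).
  have := between_change btw1 zd zc => /orP[] H; apply: big1.
    have -> : ballind (zcoord N m) a1 rho' = 1 by rewrite /ballind H.
    have := bl (ycoord N m) b2 rho; have := bl (ycoord N m) a2 rho.
    have := bl (zcoord N m) b1 rho'; lra.
  have -> : ballind (zcoord N m) b1 rho' = 1 by rewrite /ballind H.
  have := bl (ycoord N m) a2 rho; have := bl (zcoord N m) a1 rho'.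
  have := bl (ycoord N m) b2 rho; lra.
(* No indicator changes here, so only [1 / N] moves, by at most [2 S1 / M^2]. *)
apply: (@le_trans _ _ (M^-1 * (2 * S1%:R / M))); last first.
  rewrite ler_pM2l //; have := bl (ycoord N m) b2 rho; have := bl (ycoord N m) a2 rho.
  have := bl (zcoord N m) b1 rho'; have := bl (zcoord N m) a1 rho'; lra.
rewrite /kernel yc zc Nk.
have -> : M <= N%:~R + k%:R <= M + V by apply/andP; split; lra.
have -> : M <= N%:~R <= M + V by apply/andP; split; lra.
case: ifP => _ /=; last by rewrite subrr normr0 mulr_ge0 // ltW.
rewrite distrC -/d (ger0_norm d0) dE.
rewrite ler_pdivrMr ?mulr_gt0 //.
apply: (@le_trans _ _ (M^-1 * (2 * S1%:R / M) * (M * M))).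
  have -> : M^-1 * (2 * S1%:R / M) * (M * M) = 2 * S1%:R by field; rewrite gt_eqF.
  by [].
rewrite ler_wpM2l ?mulr_ge0 ?invr_ge0 ?(ltW M_gt0) //.
by apply: ler_pM; rewrite ?(ltW M_gt0) //; lra.
Qed.

End Fixed.
End Kernel.

(** * Sums of the weight and of its oscillation *)

Section KernelSums.
Variable R : realType.

Lemma sum_bool_count (s : seq int) (p : pred int) :
  \sum_(x <- s) (p x)%:R = (count p s)%:R :> R.
Proof. by rewrite -sum1_count natr_sum [RHS]big_mkcond; apply: eq_bigr => x _; case: (p x). Qed.

Lemma sum_itv_ind (s : seq int) (lo hi : R) : lo <= hi -> uniq s ->
  \sum_(N <- s) (lo <= N%:~R <= hi)%R%:R <= hi - lo + 1.
Proof. by move=> lh us; rewrite sum_bool_count; apply: count_itv_leq. Qed.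

(** For fixed [N], [ycoord] is affine in [m] with slope [1 / u], so [m] ranges over an interval of
    length [2 r u]. *)
Lemma sum_ballind (s : seq int) (u : nat) (h N : int) (p r : R) :
  (0 < u)%N -> 0 <= r -> uniq s ->
  \sum_(m <- s) ballind (ycoord R u h N m) p r <= 2 * r * u%:R + 1.
Proof.
move=> u_gt0 r0 us; have u0 : 0 < u%:R :> R by rewrite ltr0n.
pose lo : R := u%:R * (p - r) - h%:~R / N%:~R.
pose hi : R := u%:R * (p + r) - h%:~R / N%:~R.
have lh : lo <= hi by rewrite lerD2r ler_pM2l // lerD2l; lra.
have -> : 2 * r * u%:R + 1 = hi - lo + 1 by rewrite /hi /lo; ring.
rewrite sum_bool_count; apply: count_itv_leq => // m.
rewrite /ycoord ler_norml => /andP[]; rewrite lerBrDr lerBlDr.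
rewrite ler_pdivlMr // ler_pdivrMr // /lo /hi => h1 h2.
rewrite lerBlDr lerBrDr; apply/andP; split.
  by apply: le_trans h1; rewrite mulrC [- r + p]addrC.
by apply: le_trans h2 _; rewrite mulrC [r + p]addrC.
Qed.

Variables (B1 B2 : set R) (a1 b1 a2 b2 : R).
Hypotheses (btw1 : between B1 a1 b1) (btw2 : between B2 a2 b2).

Section Fixed.
Variables (M V : R) (u : nat) (h : int) (s1 s2 : seq int).
Hypotheses (M_gt0 : 0 < M) (V_ge0 : 0 <= V) (u_gt0 : (0 < u)%N) (us1 : uniq s1) (us2 : uniq s2).

Lemma sum_kernel_osc (S1 : nat) (rho rho' : R) : 4 * S1%:R <= M -> 0 <= rho -> 0 <= rho' ->
  \sum_(N <- s1) \sum_(m <- s2) kernel_osc a1 b1 a2 b2 M V u h S1 rho rho' N m <=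
  M^-1 * (2 * (2 * S1%:R + 1) * (2 * ((b2 - a2) / 2 + rho) * u%:R + 1)
    + (V + 2 * S1%:R + 1) * (2 * (2 * rho * u%:R + 1) + 2 * (2 * rho' * u%:R + 1)
        + 2 * S1%:R / M * (2 * ((b2 - a2) / 2 + rho) * u%:R + 1))).
Proof.
move=> SM r0 r0'; have Mgt0 : 0 < M := M_gt0; have V0 : 0 <= V := V_ge0.
have [ab2 _ _] := btw2.
have w0 : 0 <= (b2 - a2) / 2 + rho by lra.
set W := 2 * ((b2 - a2) / 2 + rho) * u%:R + 1.
set Y := 2 * rho * u%:R + 1; set Z := 2 * rho' * u%:R + 1.
have S0 : 0 <= S1%:R :> R by [].
have W0 : 0 <= W by rewrite addr_ge0 // !mulr_ge0.
have Y0 : 0 <= Y by rewrite addr_ge0 // !mulr_ge0.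
have Z0 : 0 <= Z by rewrite addr_ge0 // !mulr_ge0.
have M0 : 0 <= M^-1 by rewrite invr_ge0 ltW.
pose E1 (N : int) : R := (M - 2 * S1%:R <= N%:~R <= M)%R%:R.
pose E2 (N : int) : R := (M + V - 2 * S1%:R <= N%:~R <= M + V)%R%:R.
pose E3 (N : int) : R := (M - 2 * S1%:R <= N%:~R <= M + V)%R%:R.
apply: (@le_trans _ _ (\sum_(N <- s1) M^-1 * ((E1 N + E2 N) * W
   + E3 N * (2 * Y + 2 * Z + 2 * S1%:R / M * W)))).
  apply: ler_sum => N _; rewrite /E3 /kernel_osc.
  case Nr: (M - 2 * S1%:R <= N%:~R <= M + V); last first.
    rewrite big1 // mul0r addr0 mulr_ge0 // mulr_ge0 // addr_ge0 //; exact: ler0n.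
  rewrite mul1r -big_distrr /= ler_wpM2l //.
  rewrite !big_split /= -!big_distrr /=.
  have bw := sum_ballind h N ((a2 + b2) / 2) u_gt0 w0 us2.
  have by1 := sum_ballind h N a2 u_gt0 r0 us2.
  have by2 := sum_ballind h N b2 u_gt0 r0 us2.
  have bz1 : \sum_(m <- s2) ballind (zcoord R u h N m) a1 rho' <= Z.
    apply: le_trans (sum_ballind h N (a1 - u%:R / N%:~R) u_gt0 r0' us2).
    apply: ler_sum => m _; rewrite /ballind /zcoord.
    by rewrite (_ : ycoord R u h N m + _ - _ = ycoord R u h N m - (a1 - u%:R / N%:~R)) //; ring.
  have bz2 : \sum_(m <- s2) ballind (zcoord R u h N m) b1 rho' <= Z.
    apply: le_trans (sum_ballind h N (b1 - u%:R / N%:~R) u_gt0 r0' us2).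
    apply: ler_sum => m _; rewrite /ballind /zcoord.
    by rewrite (_ : ycoord R u h N m + _ - _ = ycoord R u h N m - (b1 - u%:R / N%:~R)) //; ring.
  have ends : ((N%:~R < M) || (M + V - 2 * S1%:R < N%:~R))%R%:R *
     (\sum_(m <- s2) ballind (ycoord R u h N m) ((a2 + b2) / 2) ((b2 - a2) / 2 + rho))
     <= (E1 N + E2 N) * W.
    case/andP: Nr => N1 N2; apply: ler_pM => //.
      by apply: sumr_ge0 => m _; exact: ballind_ge0.
    rewrite /E1 /E2 N1 N2 andbT /=; case: ltP => [l1|l1] /=.
      by rewrite (ltW l1) lerDl ler0n.
    by case: ltP => [l2|l2]; rewrite /= ?(ltW l2) ?lerDr ?addr_ge0 ?ler0n.
  rewrite (_ : (E1 N + E2 N) * W + (2 * Y + 2 * Z + 2 * S1%:R / M * W) =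
     (E1 N + E2 N) * W + Y + Y + Z + Z + 2 * S1%:R / M * W); last by ring.
  apply: lerD; first by do 4!(apply: lerD => //).
  by apply: ler_wpM2l => //; rewrite divr_ge0 ?mulr_ge0 // ltW.
rewrite -big_distrr /= ler_wpM2l // big_split /= -!big_distrl big_split /=.
have e1 : \sum_(N <- s1) E1 N <= 2 * S1%:R + 1.
  have h1 : M - 2 * S1%:R <= M by lra.
  by apply: le_trans (sum_itv_ind h1 us1) _; lra.
have e2 : \sum_(N <- s1) E2 N <= 2 * S1%:R + 1.
  have h1 : M + V - 2 * S1%:R <= M + V by lra.
  by apply: le_trans (sum_itv_ind h1 us1) _; lra.
have e3 : \sum_(N <- s1) E3 N <= V + 2 * S1%:R + 1.
  have h1 : M - 2 * S1%:R <= M + V by lra.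
  by apply: le_trans (sum_itv_ind h1 us1) _; lra.
have X0 : 0 <= 2 * Y + 2 * Z + 2 * S1%:R / M * W.
  by rewrite !addr_ge0 ?mulr_ge0 ?invr_ge0 // ltW.
apply: lerD; first by rewrite ler_wpM2r //; lra.
by rewrite ler_wpM2r.
Qed.

Lemma sum_kernel_leq :
  \sum_(N <- s1) \sum_(m <- s2) kernel B1 B2 M V u h N m <=
  M^-1 * ((V + 1) * ((b2 - a2) * u%:R + 1)).
Proof.
have Mgt0 : 0 < M := M_gt0; have V0 : 0 <= V := V_ge0.
have [ab2 _ cl2] := btw2.
have M0 : 0 <= M^-1 by rewrite invr_ge0 ltW.
have w0 : 0 <= (b2 - a2) / 2 by lra.
pose E (N : int) : R := (M <= N%:~R <= M + V)%R%:R.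
apply: (@le_trans _ _ (\sum_(N <- s1) M^-1 * (E N * ((b2 - a2) * u%:R + 1)))).
  apply: ler_sum => N _; rewrite /E.
  case: (boolP (M <= N%:~R <= M + V)) => Nr; last first.
    by rewrite big1 ?mul0r ?mulr0 // => m _; rewrite /kernel (negPf Nr).
  rewrite mul1r.
  have := sum_ballind h N ((a2 + b2) / 2) u_gt0 w0 us2.
  rewrite (_ : 2 * ((b2 - a2) / 2) = b2 - a2); last by field.
  move=> /(ler_wpM2l M0); apply: le_trans; rewrite big_distrr /=.
  apply: ler_sum => m _; rewrite /ballind.
  case: (boolP (`|_| <= _)) => [_|nb] /=.
    by rewrite mulr1; apply: kernel_leV.
  rewrite mulr0 /kernel ifF //; apply/negP => /and3P[_ + _]; rewrite inE => /cl2 /andP[y1 y2].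
  by move/negP: nb; apply; rewrite ler_norml; apply/andP; split; lra.
rewrite -big_distrr /= -big_distrl /= ler_wpM2l // ler_wpM2r //.
  by rewrite addr_ge0 // mulr_ge0 // subr_ge0.
have h1 : M <= M + V by lra.
by apply: le_trans (sum_itv_ind h1 us1) _; lra.
Qed.

(** The trivial bound for bad pairs: for fixed [N], [m] lies in a progression modulo [u / gcdn N u],
    which leaves at most [(b2 - a2) gcdn N u + 1] values; the gcds are summed by [sum_gcdn_itv]. *)
Lemma sum_kernel_cong_leq :
  \sum_(N <- s1) \sum_(m <- s2) kernel B1 B2 M V u h N m * (u%:Z %| (N * m + h)%R)%Z%:R <=
  M^-1 * ((b2 - a2 + 1) * ((tau u)%:R * (V + u%:R))).
Proof.
have Mgt0 : 0 < M := M_gt0; have V0 : 0 <= V := V_ge0.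
have u0 : 0 < u%:R :> R by rewrite ltr0n.
have [ab2 _ cl2] := btw2.
have M0 : 0 <= M^-1 by rewrite invr_ge0 ltW.
pose E := fun N : int => (M <= N%:~R <= M + V)%R.
apply: (@le_trans _ _ (\sum_(N <- s1 | E N) M^-1 * ((b2 - a2 + 1) * (gcdn `|N| u)%:R))).
  rewrite [leRHS]big_mkcond; apply: ler_sum => N _.
  case: (boolP (E N)) => Nr; last first.
    rewrite /E in Nr.
    by rewrite big1 // => m _; rewrite /kernel (negPf Nr) mul0r.
  pose lo : R := u%:R * a2 - h%:~R / N%:~R; pose hi : R := u%:R * b2 - h%:~R / N%:~R.
  have lh : lo <= hi by rewrite lerD2r ler_pM2l.
  have := count_cong_itv N h u_gt0 lh us2.
  rewrite -sum_bool_count.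
  have -> : (hi - lo) / u%:R = b2 - a2.
    rewrite (_ : hi - lo = (b2 - a2) * u%:R); last by rewrite /hi /lo; ring.
    by rewrite mulfK // gt_eqF.
  have g1 : 1 <= (gcdn `|N| u)%:R :> R by rewrite ler1n gcdn_gt0 u_gt0 orbT.
  have le3 : (gcdn `|N| u)%:R * (b2 - a2) + 1 <= (b2 - a2 + 1) * (gcdn `|N| u)%:R.
    by rewrite mulrDl mul1r mulrC lerD2l.
  move=> le1; apply: le_trans (ler_wpM2l M0 (le_trans le1 le3)).
  rewrite big_distrr /=; apply: ler_sum => m _.
  have [um|_] := boolP (u%:Z %| _)%Z; rewrite ?andbT ?andbF ?mulr0 //= mulr1.
  case: (boolP (_ && _)) => [_|nb].
    by rewrite mulr1; exact: kernel_leV.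
  rewrite mulr0 /kernel ifF //; apply/negP => /and3P[_ + _]; rewrite inE => /cl2.
  rewrite /ycoord ler_pdivlMr // ler_pdivrMr // => /andP[y1 y2].
  move/negP: nb; apply; rewrite /lo /hi lerBlDr lerBrDr.
  by rewrite ![u%:R * _]mulrC y1 y2.
rewrite -big_distrr -big_distrr /= ler_wpM2l // ler_wpM2l //; first by lra.
rewrite -big_filter.
have h1 : M <= M + V by lra.
apply: le_trans (sum_gcdn_itv u_gt0 h1 _ _) _.
- exact: filter_uniq.
- by move=> N; rewrite mem_filter => /andP[].
by rewrite (_ : M + V - M = V) //; ring.
Qed.

End Fixed.
End KernelSums.

(** * Equidistribution for one pair [(u, h)] with small gcd *)

Section GoodPairs.
Variable R : realType.

(** [shift_count_estimate] with [Kl = k0 * u], rewritten per shift. The bounds [T], [G], [X] remove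
    the dependence on [u] and [h] apart from the factor [1 / u]. *)
Lemma shift_count_normalized (u : nat) (h t1 t2 : int) (S1 S2 : nat) (T G D k0 X : R) :
  (0 < u)%N -> (0 < S1)%N -> (0 < S2)%N -> 0 <= D -> 0 <= k0 ->
  (tau u)%:R <= T -> (gcdn `|h| u)%:R <= G -> u%:R <= X ->
  2 * G ^+ 4 * T ^+ 3 <= D * k0 ^+ 4 ->
  `|(shift_count u h t1 S1 t2 S2)%:R - (cong_count u h)%:R / u%:R ^+ 2 * (S1 ^ 2 * S2 ^ 2)%:R| <=
  (k0 * ((1 + X / S1%:R) * (1 + X / S2%:R))
   + T * ((1 + T * D / S1%:R) * (1 + T * D / S2%:R) - 1)) / u%:R * (S1 ^ 2 * S2 ^ 2)%:R.
Proof.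
move=> u_gt0 S1_gt0 S2_gt0 D0 k00 tT gG uX Kl.
have u0 : 0 < u%:R :> R by rewrite ltr0n.
have s10 : 0 < S1%:R :> R by rewrite ltr0n.
have s20 : 0 < S2%:R :> R by rewrite ltr0n.
have T0 : 0 <= T by apply: le_trans tT.
have G0 : 0 <= G by apply: le_trans gG.
have X0 : 0 <= X by apply: le_trans uX; rewrite ltW.
have HK : (2 * gcdn `|h| u ^ 4 * tau u ^ 3 * u ^ 4)%:R <= D * (k0 * u%:R) ^+ 4.
  have -> : (2 * gcdn `|h| u ^ 4 * tau u ^ 3 * u ^ 4)%:R =
    2 * (gcdn `|h| u)%:R ^+ 4 * (tau u)%:R ^+ 3 * u%:R ^+ 4 :> R by rewrite !natrM; ring.
  rewrite exprMn [leRHS]mulrA; apply: ler_wpM2r; first by rewrite exprn_ge0 // ltW.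
  have g4 : (gcdn `|h| u)%:R ^+ 4 <= G ^+ 4 by rewrite lerXn2r ?nnegrE.
  have t3 : (tau u)%:R ^+ 3 <= T ^+ 3 by rewrite lerXn2r ?nnegrE.
  apply: le_trans Kl; by apply: ler_pM; rewrite ?ler_pM2l ?mulr_ge0 ?exprn_ge0.
have := shift_count_estimate t1 S1 t2 S2 u_gt0 D0 (mulr_ge0 k00 (ltW u0)) HK.
set W := shift_count _ _ _ _ _ _; set c := cong_count u h.
have cT : c%:R <= u%:R * T.
  apply: (@le_trans _ _ (u * tau u)%:R); first by rewrite ler_nat cong_count_leq.
  by rewrite natrM ler_pM2l.
have Q0 : 0 < (S1 ^ 2 * S2 ^ 2)%:R :> R.
  by rewrite ltr0n muln_gt0 !expn_gt0 S1_gt0 S2_gt0.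
move=> est; rewrite -(ler_pM2l (exprn_gt0 2 u0)) -{1}(gtr0_norm (exprn_gt0 2 u0)) -normrM.
have -> : u%:R ^+ 2 * (W%:R - c%:R / u%:R ^+ 2 * (S1 ^ 2 * S2 ^ 2)%:R) =
   (u ^ 2 * W)%:R - (S1 ^ 2 * S2 ^ 2 * c)%:R :> R.
  by rewrite !natrM; field; rewrite !gt_eqF.
apply: le_trans est _.
have -> : k0 * u%:R * ((S1 * (S1 + u))%:R * (S2 * (S2 + u))%:R) =
   u%:R * (k0 * ((1 + u%:R / S1%:R) * (1 + u%:R / S2%:R))) * (S1 ^ 2 * S2 ^ 2)%:R.
  rewrite !natrM !natrD; field.
  by rewrite !gt_eqF.
have -> : c%:R * (S1%:R * (S1%:R + (tau u)%:R * D) * (S2%:R * (S2%:R + (tau u)%:R * D))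
    - (S1 ^ 2 * S2 ^ 2)%:R) =
  c%:R * ((1 + (tau u)%:R * D / S1%:R) * (1 + (tau u)%:R * D / S2%:R) - 1) * (S1 ^ 2 * S2 ^ 2)%:R.
  by rewrite !natrM; field; rewrite !gt_eqF.
rewrite -mulrDl [leRHS]mulrA ler_pM2r //.
have -> (x : R) : u%:R ^+ 2 * (x / u%:R) = u%:R * x by field; rewrite gt_eqF.
rewrite [leRHS]mulrDr; apply: lerD.
  have w1 : u%:R / S1%:R <= X / S1%:R by rewrite ler_pM2r ?invr_gt0.
  have w2 : u%:R / S2%:R <= X / S2%:R by rewrite ler_pM2r ?invr_gt0.
  have z1 : 0 <= u%:R / S1%:R :> R by rewrite divr_ge0.
  have z2 : 0 <= u%:R / S2%:R :> R by rewrite divr_ge0.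
  by rewrite ler_pM2l // ler_wpM2l //; apply: ler_pM; rewrite ?addr_ge0 ?lerD2l.
have tD : (tau u)%:R * D <= T * D by rewrite ler_wpM2r.
have x1 : (tau u)%:R * D / S1%:R <= T * D / S1%:R by rewrite ler_pM2r ?invr_gt0.
have x2 : (tau u)%:R * D / S2%:R <= T * D / S2%:R by rewrite ler_pM2r ?invr_gt0.
have y1 : 0 <= (tau u)%:R * D / S1%:R by rewrite divr_ge0 ?mulr_ge0.
have y2 : 0 <= (tau u)%:R * D / S2%:R by rewrite divr_ge0 ?mulr_ge0.
rewrite [leRHS]mulrA; apply: ler_pM => //.
  rewrite subr_ge0 -[leLHS]mulr1; apply: ler_pM; rewrite ?ler01 ?lerDl //.
rewrite lerD2r; apply: ler_pM; rewrite ?addr_ge0 // ?lerD2l //.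
Qed.

(** The inequality that simplifies [sum_kernel_osc]: [s] and [S] stand for [S1] and [S2], [w] for
    the number of [m] in a whole row, [z] for the number near the four end points. *)
Lemma osc_sum_arith (M V s S w z k K0 K1 : R) :
  0 < M -> 1 <= V -> V <= M -> 1 <= s -> s <= V -> 0 <= S -> 0 <= w -> 0 <= z ->
  0 <= K0 -> 0 <= K1 -> w <= (2 * K0 + 1) * M -> z <= 20 * S + K1 * s ->
  M^-1 * (2 * (2 * s + 1) * w + (V + 2 * s + 1) * (z + 2 * s / M * w)) <=
  (14 * (2 * K0 + 1) + 4 * K1 + 80) * (s + V * S / M).
Proof.
move=> M0 V1 VM s1 sV S0 w0 z0 K00 K10 wM zS.
have VM1 : V / M <= 1 by rewrite ler_pdivrMr // mul1r.
have VM0 : 0 <= V / M by rewrite divr_ge0 // ltW //; lra.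
have WM : w / M <= 2 * K0 + 1 by rewrite ler_pdivrMr.
have WM0 : 0 <= w / M by rewrite divr_ge0 // ltW.
have VS : (V + 2 * s + 1) / M <= 4 * (V / M).
  by rewrite mulrA ler_pM2r ?invr_gt0 //; lra.
have VS0 : 0 <= (V + 2 * s + 1) / M by rewrite divr_ge0 //; lra.
rewrite (_ : M^-1 * _ = 2 * (2 * s + 1) * (w / M) + (V + 2 * s + 1) / M * z
     + 2 * s * ((V + 2 * s + 1) / M) * (w / M)); last by field; rewrite gt_eqF.
have p1 : 2 * (2 * s + 1) * (w / M) <= 6 * s * (2 * K0 + 1).
  by apply: ler_pM => //; lra.
have p2 : (V + 2 * s + 1) / M * z <= 4 * (V / M) * (20 * S + K1 * s).
  by apply: ler_pM.
have p3 : 2 * s * ((V + 2 * s + 1) / M) * (w / M) <= 2 * s * 4 * (2 * K0 + 1).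
  have s0 : 0 <= 2 * s by lra.
  apply: ler_pM => //; first by rewrite mulr_ge0.
  by rewrite ler_wpM2l //; lra.
have p4 : (V / M) * (K1 * s) <= K1 * s by rewrite ler_piMl // mulr_ge0 //; lra.
have p5 : 0 <= V * S / M by rewrite mulrAC mulr_ge0.
have p6 : 4 * (V / M) * (20 * S + K1 * s) = 80 * (V * S / M) + 4 * ((V / M) * (K1 * s)).
  by field; rewrite gt_eqF.
have p8 : 0 <= (14 * (2 * K0 + 1) + 4 * K1) * (V * S / M).
  by rewrite mulr_ge0 //; lra.
have -> : (14 * (2 * K0 + 1) + 4 * K1 + 80) * (s + V * S / M) =
    14 * (s * (2 * K0 + 1)) + 4 * (K1 * s) + 80 * s
    + (14 * (2 * K0 + 1) + 4 * K1) * (V * S / M) + 80 * (V * S / M) by ring.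
apply: (@le_trans _ _ (6 * s * (2 * K0 + 1) + (80 * (V * S / M) + 4 * (K1 * s))
   + 2 * s * 4 * (2 * K0 + 1))).
  by apply: lerD => //; apply: lerD => //; apply: le_trans p2 _; rewrite p6 lerD2l ler_pM2l.
have -> : 6 * s * (2 * K0 + 1) = 6 * (s * (2 * K0 + 1)) by ring.
have -> : 2 * s * 4 * (2 * K0 + 1) = 8 * (s * (2 * K0 + 1)) by ring.
move: (s * (2 * K0 + 1)) (V * S / M) p8 (K1 * s) => X Y p8 Z.
have : 0 <= 80 * s by lra.
move: (_ * Y) p8 => YY; lra.
Qed.

(** [rho u] and [rho' u] are the displacements measured in units of [m]: [2 S] from the shift of
    [m], and multiples of [s] times powers of [u / M <= C0] from the shift of [N]. *)
Lemma rho_arith (M u s S C0 Ch d rho rho' : R) :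
  0 < M -> 0 < u -> u <= C0 * M -> 0 <= C0 -> 0 <= Ch -> 1 <= M -> 1 <= S -> S <= M ->
  1 <= s -> s <= M -> 0 <= d ->
  rho = (2 * S + Ch * u * M * (8 * s / M ^+ 2)) / u ->
  rho' = rho + u * (8 * s / M ^+ 2) ->
  [/\ 0 <= rho, 0 <= rho',
   2 * (d / 2 + rho) * u + 1 <= (2 * (d * C0 / 2 + 2 + 8 * Ch * C0) + 1) * M &
   2 * (2 * rho * u + 1) + 2 * (2 * rho' * u + 1) <=
     20 * S + (64 * Ch * C0 + 32 * C0 ^+ 2) * s].
Proof.
move=> M0 u0 uM C00 Ch0 M1 S1 SM s1 sM d0 rhoE rho'E.
have s0 : 0 <= s by lra.
have q0 : 0 <= 8 * s / M ^+ 2 by rewrite divr_ge0 ?mulr_ge0 ?exprn_ge0 // ltW.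
have r0 : 0 <= rho.
  rewrite rhoE; apply: divr_ge0; last exact: ltW.
  apply: addr_ge0; first by rewrite mulr_ge0 //; lra.
  by rewrite mulr_ge0 // mulr_ge0 ?(ltW M0) // mulr_ge0 // ltW.
have r'0 : 0 <= rho' by rewrite rho'E addr_ge0 // mulr_ge0 // ltW.
have ruE : rho * u = 2 * S + 8 * Ch * s * (u / M).
  by rewrite rhoE; field; rewrite !gt_eqF.
have uM' : u / M <= C0 by rewrite ler_pdivrMr.
have uM0 : 0 <= u / M by rewrite divr_ge0 // ltW.
have ru : rho * u <= 2 * S + 8 * Ch * C0 * s.
  rewrite ruE lerD2l; have -> : 8 * Ch * C0 * s = 8 * Ch * s * C0 by ring.
  by rewrite ler_wpM2l // !mulr_ge0.
have r'u : rho' * u <= 2 * S + 8 * Ch * C0 * s + 8 * C0 ^+ 2 * s.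
  have -> : rho' * u = rho * u + 8 * s * (u / M) ^+ 2.
    by rewrite rho'E; field; rewrite gt_eqF.
  apply: lerD => //; have -> : 8 * C0 ^+ 2 * s = 8 * s * C0 ^+ 2 by ring.
  by rewrite ler_wpM2l ?mulr_ge0 // lerXn2r ?nnegrE.
split=> //.
  have -> : 2 * (d / 2 + rho) * u + 1 = d * u + 2 * (rho * u) + 1 by field.
  have t1 : d * u <= d * C0 * M by rewrite -mulrA ler_wpM2l.
  have t2 : 8 * Ch * C0 * s <= 8 * Ch * C0 * M by rewrite ler_wpM2l ?mulr_ge0.
  have -> : (2 * (d * C0 / 2 + 2 + 8 * Ch * C0) + 1) * M =
     d * C0 * M + 4 * M + 2 * (8 * Ch * C0 * M) + M by field.
  move: (8 * Ch * C0 * s) (8 * Ch * C0 * M) (rho * u) (d * u) (d * C0 * M) t1 t2 ru.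
  clear - M1 SM; move=> *; lra.
have -> : 2 * (2 * rho * u + 1) + 2 * (2 * rho' * u + 1) =
    4 * (rho * u) + 4 * (rho' * u) + 4 by ring.
have -> : (64 * Ch * C0 + 32 * C0 ^+ 2) * s = 8 * (8 * Ch * C0 * s) + 4 * (8 * C0 ^+ 2 * s).
  by ring.
move: (8 * Ch * C0 * s) (8 * C0 ^+ 2 * s) (rho * u) (rho' * u) ru r'u.
clear - S1; move=> *; lra.
Qed.

Variables (B1 B2 : set R) (a1 b1 a2 b2 : R).
Hypotheses (btw1 : between B1 a1 b1) (btw2 : between B2 a2 b2).

(** The support condition of [smoothing]: the two lists are long enough to contain every backward
    shift of the support of the kernel. *)
Lemma kernel_support (M V L : R) (u : nat) (h N m : int) (S1 S2 k l : nat) :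
  1 <= M -> (0 < u)%N ->
  u%:R * (`|a2| + `|b2|) + `|h%:~R| + 2 * S2%:R <= L ->
  kernel B1 B2 M V u h N m != 0 -> (k < 2 * S1)%N -> (l < 2 * S2)%N ->
  (N - k%:Z \in zitv (M - 2 * S1%:R) (M + V)) && (m - l%:Z \in zitv (- L) L).
Proof.
move=> M1 u_gt0 LL; rewrite /kernel; case: ifP; last by rewrite eqxx.
move=> /and3P[/andP[N1 N2] + _] _ kS lS; rewrite inE => yB.
have [_ _ /(_ _ yB) /andP[y1 y2]] := btw2.
have u0 : 0 < u%:R :> R by rewrite ltr0n.
have kR : k%:R <= 2 * S1%:R :> R by rewrite -natrM ler_nat ltnW.
have lR : l%:R <= 2 * S2%:R :> R by rewrite -natrM ler_nat ltnW.
have k0 : 0 <= k%:R :> R by [].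
have l0 : 0 <= l%:R :> R by [].
have N0 : 1 <= N%:~R :> R by lra.
have hN : `|h%:~R / N%:~R| <= `|h%:~R| :> R.
  rewrite normrM ler_piMr // normfV invf_le1 ger0_norm //; lra.
have y_le : `|u%:R * ycoord R u h N m| <= u%:R * (`|a2| + `|b2|).
  rewrite normrM normr_nat ler_pM2l // ler_norml.
  have := ler_norm b2; have := ler_norm (- a2); rewrite normrN.
  have := normr_ge0 a2; have := normr_ge0 b2 => *; apply/andP; split; lra.
have mE : m%:~R = u%:R * ycoord R u h N m - h%:~R / N%:~R.
  by rewrite /ycoord mulrC divfK ?gt_eqF // addrK.
have m_le : `|m%:~R| <= u%:R * (`|a2| + `|b2|) + `|h%:~R| :> R.
  by rewrite mE; apply: le_trans (ler_normB _ _) _; apply: lerD.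
rewrite !mem_zitv !intrB -!pmulrn; move: m_le; rewrite ler_norml => /andP[m1 m2].
by apply/andP; split; apply/andP; split; lra.
Qed.

(** [smoothing] applied to [kernel] and the congruence modulo [u]. The relative error [eps0 / u]
    multiplies the mass of the kernel, about [u V / M]; the oscillation, of size [S1 + V S2 / M], is
    multiplied by the density, at most [T / u], plus the error. *)
Lemma good_pair_estimate (C0 Ch : R) : 0 <= C0 -> 0 <= Ch ->
  exists2 K : R, 0 <= K &
  forall (M V L : R) (u : nat) (h : int) (S1 S2 : nat) (T G D k0 eps0 : R),
  1 <= M -> 1 <= V -> V <= M -> (0 < u)%N -> u%:R <= C0 * M ->
  `|h%:~R| <= Ch * u%:R * M ->
  (0 < S1)%N -> (4 * S1%:R : R) <= M -> S1%:R <= V -> (0 < S2)%N -> S2%:R <= M ->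
  0 <= D -> 0 <= k0 -> (tau u)%:R <= T -> (gcdn `|h| u)%:R <= G ->
  2 * G ^+ 4 * T ^+ 3 <= D * k0 ^+ 4 ->
  u%:R * (`|a2| + `|b2|) + `|h%:~R| + 2 * S2%:R <= L ->
  eps0 = k0 * ((1 + C0 * M / S1%:R) * (1 + C0 * M / S2%:R))
     + T * ((1 + T * D / S1%:R) * (1 + T * D / S2%:R) - 1) ->
  `|\sum_(N <- zitv (M - 2 * S1%:R) (M + V)) \sum_(m <- zitv (- L) L)
      kernel B1 B2 M V u h N m * (u%:Z %| (N * m + h)%R)%Z%:R
    - (cong_count u h)%:R / u%:R ^+ 2 *
      \sum_(N <- zitv (M - 2 * S1%:R) (M + V)) \sum_(m <- zitv (- L) L)
        kernel B1 B2 M V u h N m|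
  <= K * (eps0 * (V / M) + (T + eps0) / u%:R * (S1%:R + V * S2%:R / M)).
Proof.
move=> C00 Ch0.
have [ab2 _ _] := btw2.
pose K1 := 64 * Ch * C0 + 32 * C0 ^+ 2.
pose K0 := (b2 - a2) * C0 / 2 + 2 + 8 * Ch * C0.
pose K := 14 * (2 * K0 + 1) + 4 * K1 + 80 + 2 * (b2 - a2 + 1).
have K10 : 0 <= K1 by rewrite addr_ge0 ?mulr_ge0 ?exprn_ge0.
have K00 : 0 <= K0 by rewrite !addr_ge0 ?mulr_ge0 ?invr_ge0 ?subr_ge0.
have Kge0 : 0 <= K by rewrite /K; lra.
have KA : 2 * (b2 - a2 + 1) <= K by rewrite /K; lra.
have KB : 14 * (2 * K0 + 1) + 4 * K1 + 80 <= K by rewrite /K; lra.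
exists K => // M V L u h S1 S2 T G D k0 eps0 M1 V1 VM u_gt0 uM hM S1_gt0 S1M S1V S2_gt0 S2M.
move=> D0 k00 tT gG Kl LL eps0E.
set s1 := zitv (M - _) _; set s2 := zitv (- L) L.
have M0 : 0 < M by lra.
have u0 : 0 < u%:R :> R by rewrite ltr0n.
have u1 : 1 <= u%:R :> R by rewrite ler1n.
have S11 : 1 <= S1%:R :> R by rewrite ler1n.
have S21 : 1 <= S2%:R :> R by rewrite ler1n.
have T0 : 0 <= T by apply: le_trans tT.
have e0 : 0 <= eps0.
  rewrite eps0E addr_ge0 // mulr_ge0 //.
    by rewrite mulr_ge0 // addr_ge0 // divr_ge0 // mulr_ge0 // ltW.
  rewrite subr_ge0 -[leLHS]mulr1; apply: ler_pM; rewrite ?ler01 // lerDl divr_ge0 // mulr_ge0 //.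
pose rho : R := (2 * S2%:R + Ch * u%:R * M * (8 * S1%:R / M ^+ 2)) / u%:R.
pose rho' : R := rho + u%:R * (8 * S1%:R / M ^+ 2).
have sM : S1%:R <= M by apply: le_trans VM.
have d0 : 0 <= b2 - a2 by rewrite subr_ge0.
have [r0 r'0 wide ZS] := rho_arith M0 u0 uM C00 Ch0 M1 S21 S2M S11 sM d0
  (erefl : rho = _) (erefl : rho' = _).
have u_s1 : uniq s1 by exact: zitv_uniq.
have u_s2 : uniq s2 by exact: zitv_uniq.
pose c : R := (cong_count u h)%:R / u%:R ^+ 2.
(* The hyperbola is [N m = - h], so the count is for [- h]; [cong_countN] brings the density back to
   [h]. *)
have lcP N m : `|(local_count (fun N m : int => (u%:Z %| (N * m + h)%R)%Z) S1 S2 N m)%:R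
   - c * (S1 ^ 2 * S2 ^ 2)%:R| <= eps0 / u%:R * (S1 ^ 2 * S2 ^ 2)%:R.
  have -> : local_count (fun N m : int => (u%:Z %| (N * m + h)%R)%Z) S1 S2 N m =
     shift_count u (- h) N S1 m S2.
    by rewrite /shift_count; do 4!(apply: eq_bigr => ? _); rewrite opprK.
  rewrite /c -(cong_countN h u_gt0).
  rewrite eps0E.
  by apply: (@shift_count_normalized u (- h) N m S1 S2 T G D k0 (C0 * M)); rewrite ?abszN.
have V0 : 0 <= V by lra.
have main := @smoothing R s1 s2 (kernel B1 B2 M V u h)
  (kernel_osc a1 b1 a2 b2 M V u h S1 rho rho')
  (fun N m : int => (u%:Z %| (N * m + h)%R)%Z) S1 S2 c (eps0 / u%:R) u_s1 u_s2 S1_gt0 S2_gt0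
  (kernel_ge0 B1 B2 V u h M0)
  (fun N m k l => @kernel_support M V L u h N m S1 S2 k l M1 u_gt0 LL)
  (@kernel_oscP R B1 B2 a1 b1 a2 b2 btw1 btw2 M V u h M0 u_gt0 S1 S2 _ rho rho' hM S1M erefl erefl)
  lcP.
apply: le_trans main _.
have B1' := sum_kernel_leq B1 btw2 h M0 V0 u_gt0 u_s1 u_s2.
have B2' := sum_kernel_osc a1 b1 btw2 h M0 V0 u_gt0 u_s1 u_s2 S1M r0 r'0.
have cu : c <= T / u%:R.
  rewrite /c expr2 invfM mulrA ler_pM2r ?invr_gt0 // ler_pdivrMr //.
  apply: (@le_trans _ _ (u * tau u)%:R); first by rewrite ler_nat cong_count_leq.
  by rewrite natrM mulrC ler_pM2r.
have c0 : 0 <= c by rewrite divr_ge0 // exprn_ge0.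
have eu0 : 0 <= eps0 / u%:R by rewrite divr_ge0.
have V_M : V / M <= 1 by rewrite ler_pdivrMr // mul1r.
have VM0 : 0 <= V / M by rewrite divr_ge0 // ltW.
have P1 : eps0 / u%:R * \sum_(N <- s1) \sum_(m <- s2) kernel B1 B2 M V u h N m <=
   2 * (b2 - a2 + 1) * (eps0 * (V / M)).
  apply: le_trans (ler_wpM2l eu0 B1') _.
  have -> : 2 * (b2 - a2 + 1) * (eps0 * (V / M)) =
     eps0 / u%:R * (M^-1 * ((2 * V) * ((b2 - a2 + 1) * u%:R))).
    by field; rewrite !gt_eqF.
  rewrite ler_wpM2l // ler_pM2l ?invr_gt0 //; apply: ler_pM; rewrite ?addr_ge0 ?mulr_ge0 ?subr_ge0 //.
    by lra.
  by rewrite [leRHS]mulrDl mul1r lerD2l.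
have P2 : \sum_(N <- s1) \sum_(m <- s2) kernel_osc a1 b1 a2 b2 M V u h S1 rho rho' N m <=
   (14 * (2 * K0 + 1) + 4 * K1 + 80) * (S1%:R + V * S2%:R / M).
  apply: le_trans B2' _.
  have w0 : 0 <= 2 * ((b2 - a2) / 2 + rho) * u%:R + 1.
    by rewrite addr_ge0 // !mulr_ge0 // addr_ge0 // divr_ge0.
  have z0 : 0 <= 2 * (2 * rho * u%:R + 1) + 2 * (2 * rho' * u%:R + 1).
    by apply: addr_ge0; apply: mulr_ge0 => //; apply: addr_ge0 => //; rewrite mulr_ge0 // mulr_ge0.
  exact: osc_sum_arith.
have X0 : 0 <= S1%:R + V * S2%:R / M by rewrite addr_ge0 // divr_ge0 ?mulr_ge0 // ltW.
have e1 : 0 <= eps0 * (V / M) by rewrite mulr_ge0.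
have e2 : 0 <= (T + eps0) / u%:R by rewrite divr_ge0 // addr_ge0.
rewrite [leRHS]mulrDr; apply: lerD.
  by apply: le_trans P1 _; rewrite ler_wpM2r.
have ce : c + eps0 / u%:R <= (T + eps0) / u%:R by rewrite mulrDl lerD2r.
apply: (@le_trans _ _ ((T + eps0) / u%:R *
   ((14 * (2 * K0 + 1) + 4 * K1 + 80) * (S1%:R + V * S2%:R / M)))).
  apply: ler_pM => //; first by rewrite addr_ge0.
  apply: sumr_ge0 => N _; apply: sumr_ge0 => m _.
  have := @kernel_oscP R B1 B2 a1 b1 a2 b2 btw1 btw2 M V u h M0 u_gt0 S1 S2 _ rho rho' hM
    S1M erefl erefl N m 0%N 0%N.
  by rewrite !muln_gt0 S1_gt0 S2_gt0 => /(_ isT isT); apply: le_trans.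
by rewrite mulrCA; apply: ler_wpM2r => //; exact: mulr_ge0.
Qed.

End GoodPairs.

(** * From pairs [(i, j)] to quadruples [(u, h, N, m)] *)

Section CountIdentity.
Variable R : realType.

Lemma card_fset_set_seq (T : choiceType) (S : set T) (s : seq T) : uniq s ->
  (forall x, S x -> x \in s) -> #|` fset_set S| = count (fun x => x \in S) s.
Proof.
move=> us Ss.
have SE : S = [set` [fset x in [seq x <- s | x \in S]]%fset].
  apply/seteqP; split => x /=; rewrite !inE mem_filter.
    by move=> Sx; rewrite (mem_set Sx) Ss.
  by move=> /andP[/set_mem].
rewrite {1}SE set_fsetK card_fseq undup_id ?filter_uniq //.
by rewrite size_filter.
Qed.

Section Pairs.
Variables (alpha : R) (N : nat).
Hypothesis N_gt0 : (0 < N)%N.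

Lemma pairs_swap (A B1 B2 : set R) (i j : int) :
  pairs N A B1 B2 (phiN alpha N) (i, j) <->
  pairs N [set - x | x in A] B2 B1 (phiN alpha N) (j, i).
Proof.
have imp (A' C1 C2 : set R) (i' j' : int) :
    pairs N A' C1 C2 (phiN alpha N) (i', j') ->
    pairs N [set - x | x in A'] C2 C1 (phiN alpha N) (j', i').
  move=> [/= ij [x Ax [m mE]] C1i C2j]; split=> //=; first by move=> e; apply: ij.
  exists (- x); first by exists x.
  exists (- m); rewrite intrN mulrN -opprD -mE; ring.
split; first exact: imp.
move=> /imp; congr (pairs N _ B1 B2 _ (i, j)).
by apply/seteqP; split => [_ [_ [x Ax <-] <-]|x Ax]; rewrite ?opprK //;
   exists (- x); rewrite ?opprK //; exists x.
Qed.

(** The squares of [alpha] cancel: [phiN (j + u) - phiN j = (u j + u^2/2 - alpha u) / N], and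
    subtracting the integer [m] turns [u j] into [u j - N m]. *)
Lemma pairs_inH (A B1 B2 : set R) (j : int) (u : nat) : (0 < u)%N ->
  pairs N A B1 B2 (phiN alpha N) (j + u%:Z, j) <->
  [/\ exists m : int, inH alpha A u (u%:Z * j - N%:Z * m),
      B1 ((j + u%:Z)%:~R / N%:R) & B2 (j%:~R / N%:R)].
Proof.
move=> u_gt0; have N0 : 0 < N%:R :> R by rewrite ltr0n.
have key (m : int) (x : R) :
  (phiN alpha N (j + u%:Z)%:~R - phiN alpha N j%:~R = N%:R^-1 * x + m%:~R) <->
  ((u%:Z * j - N%:Z * m)%:~R + u%:R ^+ 2 / 2 - alpha * u%:R = x).
  have e : phiN alpha N (j + u%:Z)%:~R - phiN alpha N j%:~R =
    N%:R^-1 * ((u%:Z * j - N%:Z * m)%:~R + u%:R ^+ 2 / 2 - alpha * u%:R) + m%:~R.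
    rewrite /phiN intrB !intrM intrD -!pmulrn; field.
    by rewrite gt_eqF.
  rewrite e; split=> [/addIr /mulfI|-> //]; apply.
  by rewrite invr_neq0 // gt_eqF.
split=> [[/= _ [x Ax [m /key mE]] H1 H2]|[[m Hm] H1 H2]]; split=> //=.
- by exists m; rewrite /inH mE inE.
- by move=> e; move: u_gt0 e; clear; lia.
exists ((u%:Z * j - N%:Z * m)%:~R + u%:R ^+ 2 / 2 - alpha * u%:R).
  by move: Hm; rewrite /inH inE.
by exists m; apply/key.
Qed.

End Pairs.

Section Positive.
Variables (alpha : R) (A B1 B2 : set R) (a b a1 b1 a2 b2 : R).
Hypotheses (btwA : between A a b) (btw1 : between B1 a1 b1) (btw2 : between B2 a2 b2).

Definition pind (u : nat) (h N m : int) : bool :=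
  (ycoord R u h N m \in B2) && (zcoord R u h N m \in B1).

Definition Psum (X : nat) (L : R) (N : int) : R :=
  \sum_(1 <= u < X.+1) \sum_(h <- Hseq alpha A a b u) \sum_(m <- zitv (- L) L)
    ((u%:Z %| (N * m + h)%R)%Z && pind u h N m)%:R.

(** For a given [j], the relation [u j = N m + h] determines [h] and [m]: two admissible [h] differ
    by at most [b - a < N], and also by a multiple of [N]. Conversely [(h, m)] with [u] dividing
    [N m + h] determines [j], and [ycoord] is then [j / N]. *)
Lemma pair_sum_fixed (N : nat) (u : nat) (I : seq int) (L : R) :
  (0 < N)%N -> b - a < N%:R -> (0 < u)%N -> uniq I ->
  (forall j : int, B2 (j%:~R / N%:R) -> j \in I) ->
  (forall h : int, h \in Hseq alpha A a b u -> u%:R * (`|a2| + `|b2|) + `|h%:~R| <= L) ->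
  \sum_(j <- I) ((j + u%:Z, j) \in pairs N A B1 B2 (phiN alpha N))%:R =
  \sum_(h <- Hseq alpha A a b u) \sum_(m <- zitv (- L) L)
    ((u%:Z %| (N%:Z * m + h)%R)%Z && pind u h N m)%:R :> R.
Proof.
move=> N_gt0 abN u_gt0 uI Ij LL; have N0 : 0 < N%:R :> R by rewrite ltr0n.
have u0 : 0 < u%:R :> R by rewrite ltr0n.
have N1 : 1 <= N%:R :> R by rewrite ler1n.
have [ab_ Aop Acl] := btwA.
pose p (j : int) := ((j + u%:Z)%:~R / N%:R \in B1) && (j%:~R / N%:R \in B2).
have step1 (j : int) : ((j + u%:Z, j) \in pairs N A B1 B2 (phiN alpha N))%:R =
   \sum_(h <- Hseq alpha A a b u) \sum_(m <- zitv (- L) L)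
     ((u%:Z * j == N%:Z * m + h) && p j)%:R :> R.
  have [pj|/negPf pj] := boolP (p j); last first.
    rewrite big1 => [|h _]; last by rewrite big1 // => m _; rewrite andbF.
    case: (boolP (_ \in _)) => //; rewrite inE => /(pairs_inH alpha N_gt0 A B1 B2 j u_gt0).
    by move=> [_ H1 H2]; move: pj; rewrite /p (mem_set H1) (mem_set H2).
  have [H1 H2] : B1 ((j + u%:Z)%:~R / N%:R) /\ B2 (j%:~R / N%:R).
    by move: pj; rewrite /p => /andP[/set_mem ? /set_mem ?].
  have [|nin] := boolP (_ \in _); last first.
    rewrite big1_seq // => h /andP[_ hH]; rewrite big1 // => m _.
    case: eqP => //= e; move/negP: nin; case; apply/mem_set.
    apply/(pairs_inH alpha N_gt0 A B1 B2 j u_gt0); split=> //.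
    by exists m; rewrite e addrAC subrr add0r -(mem_Hseq _ Acl).
  rewrite inE => /(pairs_inH alpha N_gt0 A B1 B2 j u_gt0)[[m Hm] _ _].
  pose h := u%:Z * j - N%:Z * m; rewrite -/h in Hm.
  have hH : h \in Hseq alpha A a b u by rewrite (mem_Hseq _ Acl).
  have mL : m \in zitv (- L) L.
    have [_ _ /(_ _ H2) /andP[y1 y2]] := btw2.
    have mE : m%:~R = u%:R * (j%:~R / N%:R) - h%:~R / N%:R :> R.
      by rewrite /h intrB !intrM -!pmulrn; field; rewrite gt_eqF.
    have m_le : `|m%:~R| <= u%:R * (`|a2| + `|b2|) + `|h%:~R| :> R.
      rewrite mE; apply: le_trans (ler_normB _ _) _; apply: lerD.
        rewrite normrM normr_nat ler_pM2l // ler_norml.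
        have := ler_norm b2; have := ler_norm (- a2); rewrite normrN.
        have := normr_ge0 a2; have := normr_ge0 b2 => *; apply/andP; split; lra.
      by rewrite normrM ler_piMr // normfV normr_nat invf_le1.
    by rewrite mem_zitv -ler_norml; apply: le_trans m_le (LL _ hH).
  have diam x y : x \in Hseq alpha A a b u -> y \in Hseq alpha A a b u ->
      `|x - y| < N%:Z.
    rewrite !(mem_Hseq _ Acl) /inH !inE => /Acl/andP[x1 x2] /Acl/andP[y1 y2].
    rewrite -(ltr_int R) intr_norm intrB -pmulrn ltr_norml; apply/andP; split; lra.
  rewrite (bigD1_seq h) ?Hseq_uniq //= (bigD1_seq m) ?zitv_uniq //=.
  have e0 : u%:Z * j == N%:Z * m + h by apply/eqP; rewrite /h; ring.
  rewrite e0 [X in _ + X + _]big1 ?addr0 => [|m' m'm].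
    rewrite big1_seq ?addr0 // => h' /andP[h'h h'H]; rewrite big1 // => m' _.
    case: eqP => //= e; have := diam _ _ hH h'H.
    have hN : h - h' = N%:Z * (m' - m) by rewrite /h e; ring.
    rewrite hN normrM; have [m'm|m'm] := eqVneq m' m.
      by move: hN; rewrite m'm subrr mulr0 => /subr0_eq hE; rewrite hE eqxx in h'h.
    have d1 : 1 <= `|m' - m| by move: m'm; clear; lia.
    rewrite ltNge; case/negP; rewrite [X in X * _]ger0_norm // -[leLHS]mulr1.
    exact: ler_pM.
  case: eqP => //= e; exfalso; move: e; rewrite (eqP e0) => /addIr /mulfI e.
  by move: m'm; rewrite e ?eqxx // eqz_nat -lt0n.
under eq_bigr do rewrite step1.
rewrite exchange_big; apply: eq_bigr => h hH /=.
rewrite exchange_big; apply: eq_bigr => m _ /=.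
have [/dvdzP[j jE]|ndiv] := boolP (u%:Z %| _)%Z; last first.
  rewrite big1 // => j _; case: eqP => //= e; exfalso; move/negP: ndiv; apply.
  by rewrite -e dvdz_mulr.
have yE : ycoord R u h N m = j%:~R / N%:R.
  have : (N%:Z * m + h)%:~R = (j * u%:Z)%:~R :> R by rewrite jE.
  rewrite intrD !intrM -!pmulrn => e.
  have un : u%:R != 0 :> R by rewrite gt_eqF.
  have Nn : N%:R != 0 :> R by rewrite gt_eqF.
  have mE : m%:~R = (j%:~R * u%:R - h%:~R) / N%:R :> R.
    by apply: (mulIf Nn); rewrite divfK // -e addrK mulrC.
  by rewrite /ycoord -!pmulrn mE; field; rewrite un Nn.
have pE : pind u h N m = p j.
  by rewrite /pind /zcoord yE /p andbC intrD -!pmulrn mulrDl.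
rewrite pE /=; have uz : u%:Z != 0 by rewrite eqz_nat -lt0n.
rewrite (eq_bigr (fun j' : int => ((j' == j) && p j)%:R)); last first.
  move=> j' _; rewrite jE mulrC (inj_eq (mulIf uz)).
  by have [->|] := eqVneq j' j.
case pj: (p j) => /=; last by rewrite big1 // => j' _; rewrite andbF.
have jI : j \in I by apply: Ij; move: pj; rewrite /p => /andP[_ /set_mem].
rewrite (bigD1_seq j) //= eqxx big1 ?addr0 // => j' /negPf ->.
by [].
Qed.

End Positive.

(* The pairs with [i > j] are counted by [Psum A B1 B2]; exchanging [i] and [j]
   turns those with [i < j] into pairs for [- A], [B2], [B1]. *)
Lemma R2_Psum (alpha : R) (A B1 B2 : set R) (a b a1 b1 a2 b2 : R) (N X : nat) (L : R) :
  between A a b -> between B1 a1 b1 -> between B2 a2 b2 ->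
  (0 < N)%N -> b - a < N%:R ->
  2 * (N%:R * (`|a1| + `|b1| + `|a2| + `|b2|)) <= X%:R ->
  (forall (u : nat) (h : int), (0 < u <= X)%N -> h \in Hseq alpha A a b u ->
     u%:R * (`|a2| + `|b2|) + `|h%:~R| <= L) ->
  (forall (u : nat) (h : int), (0 < u <= X)%N -> h \in Hseq alpha [set - x | x in A] (- b) (- a) u ->
     u%:R * (`|a1| + `|b1|) + `|h%:~R| <= L) ->
  R2 N A B1 B2 (phiN alpha N) =
  (Psum alpha A B1 B2 a b X L N +
   Psum alpha [set - x | x in A] B2 B1 (- b) (- a) X L N) / N%:R.
Proof.
move=> btwA btw1 btw2 N_gt0 abN NX L1 L2; congr (_ / _).
have N0 : 0 < N%:R :> R by rewrite ltr0n.
pose Q := N%:R * (`|a1| + `|b1| + `|a2| + `|b2|).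
pose I := zitv (- Q) Q.
have uI : uniq I by exact: zitv_uniq.
have inI B c d (i : int) : between B c d -> `|c| + `|d| <= `|a1| + `|b1| + `|a2| + `|b2| ->
    B (i%:~R / N%:R) -> i \in I.
  move=> [_ _ cl] le /cl /andP[c1 d1]; rewrite mem_zitv -ler_norml.
  have -> : i%:~R = N%:R * (i%:~R / N%:R) :> R by rewrite mulrC divfK // gt_eqF.
  rewrite normrM normr_nat /Q ler_pM2l //; apply: le_trans le.
  rewrite ler_norml; have := ler_norm d; have := ler_norm (- c); rewrite normrN.
  have := normr_ge0 c; have := normr_ge0 d => *; apply/andP; split; lra.
have n1 := normr_ge0 a1; have n2 := normr_ge0 b1; have n3 := normr_ge0 a2; have n4 := normr_ge0 b2.
have inI1 (i : int) : B1 (i%:~R / N%:R) -> i \in I by apply: inI btw1 _; lra.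
have inI2 (i : int) : B2 (i%:~R / N%:R) -> i \in I by apply: inI btw2 _; lra.
set S := pairs N A B1 B2 (phiN alpha N).
(* Pairs with [j < i] are regrouped by [u = i - j]; both indices are at most [Q] in absolute value,
   hence [u <= 2 Q <= X]. *)
have split_pos (S' : set (int * int)) :
    (forall i j, S' (i, j) -> i \in I /\ j \in I) ->
    \sum_(j <- I) \sum_(i <- I) ((j < i) && ((i, j) \in S'))%:R =
    \sum_(1 <= u < X.+1) \sum_(j <- I) ((j + u%:Z, j) \in S')%:R :> R.
  move=> S'I; rewrite [RHS]exchange_big; apply: eq_big_seq => j jI /=.
  rewrite -(big_map (fun u : nat => j + u%:Z) xpredT (fun i => ((i, j) \in S')%:R)) /=.
  rewrite [RHS](eq_big_seq (fun i => ((j < i) && ((i, j) \in S'))%:R)); last first.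
    by move=> _ /mapP[u + ->]; rewrite mem_index_iota => u1; rewrite (_ : j < _) //; move: u1; clear; lia.
  apply: eq_sum_support => //.
    by rewrite map_inj_uniq ?iota_uniq // => x y /addrI [].
  move=> i; have [/andP[ji iS] _|] := boolP (_ && _); last by rewrite eqxx.
  have [iI _] := S'I _ _ (set_mem iS); rewrite iI; apply/esym/mapP.
  exists `|i - j|%N; last by move: ji; clear; lia.
  move: iI jI; rewrite !mem_zitv => /andP[i1 i2] /andP[j1 j2].
  rewrite mem_index_iota; apply/andP; split; first by move: ji; clear; lia.
  rewrite ltnS -(ler_nat R); apply: le_trans NX; rewrite -/Q.
  rewrite pmulrn gez0_abs ?intrB; last by rewrite subr_ge0 ltW.
  by clear - i1 i2 j1 j2; lra.
have cnt : (#|` fset_set S|)%:R = \sum_(i <- I) \sum_(j <- I) ((i, j) \in S)%:R :> R.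
  rewrite (@card_fset_set_seq _ S [seq (i, j) | i <- I, j <- I]).
  - rewrite -sum1_count big_mkcond natr_sum big_allpairs_dep /=.
    by apply: eq_bigr => i _; apply: eq_bigr => j _; case: (_ \in S).
  - by apply: allpairs_uniq => // -[x y] [x' y'] _ _ [-> ->].
  - move=> [i j] [/= _ _ /inI1 iI /inI2 jI]; apply/allpairsP; exists (i, j).
    by split.
rewrite cnt.
pose S' := pairs N [set - x | x in A] B2 B1 (phiN alpha N).
have SE (i j : int) : ((i, j) \in S) = ((j, i) \in S').
  by apply/idP/idP => /set_mem H; apply/mem_set; apply/(pairs_swap alpha N A B1 B2 i j).
have -> : \sum_(i <- I) \sum_(j <- I) ((i, j) \in S)%:R =
   \sum_(j <- I) \sum_(i <- I) ((j < i) && ((i, j) \in S))%:R +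
   \sum_(j <- I) \sum_(i <- I) ((j < i) && ((i, j) \in S'))%:R :> R.
  rewrite [X in _ = X + _]exchange_big -big_split; apply: eq_bigr => i _ /=.
  rewrite -big_split; apply: eq_bigr => j _ /=; rewrite -SE.
  case: (ltgtP i j) => [ij|ij|->] /=; rewrite ?add0r ?addr0 //.
  by case: (boolP (_ \in S)) => //; rewrite inE => -[/= ne _ _ _]; case: ne.
have btwN : between [set - x | x in A] (- b) (- a).
  case: btwA => ab op cl; split; first by rewrite lerN2.
    move=> x /andP[x1 x2]; exists (- x); rewrite ?opprK //; apply: op.
    by clear - x1 x2; apply/andP; split; lra.
  move=> _ [x /cl/andP[x1 x2] <-]; rewrite !lerN2 x1 x2 //.
have abN' : - a - - b < N%:R by rewrite opprK addrC.
congr (_ + _).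
  rewrite split_pos.
    apply: eq_big_nat => u /andP[u0 uX].
    have Lu (h : int) (hH : h \in Hseq alpha A a b u) := L1 u h (introT andP (conj u0 uX)) hH.
    exact: (@pair_sum_fixed alpha A B1 B2 a b a2 b2 btwA btw2 N u I L N_gt0 abN u0 uI inI2 Lu).
  by move=> i j [/= _ _ /inI1 ? /inI2 ?].
rewrite split_pos.
  apply: eq_big_nat => u /andP[u0 uX].
  have Lu (h : int) (hH : h \in Hseq alpha [set - x | x in A] (- b) (- a) u) :=
    L2 u h (introT andP (conj u0 uX)) hH.
  exact: (@pair_sum_fixed alpha _ B2 B1 _ _ a1 b1 btwN btw1 N u I L N_gt0 abN' u0 uI inI1 Lu).
by move=> i j [/= _ _ /inI2 ? /inI1 ?].
Qed.

End CountIdentity.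

(** * The main term: interval overlaps and their sum *)

Section Model.
Variable R : realType.

Lemma count_itv_approx (s : seq int) (P : pred int) (lo hi t c : R) : 0 < c -> uniq s ->
  (forall m : int, P m -> lo <= (m%:~R + t) / c <= hi) ->
  (forall m : int, lo < (m%:~R + t) / c < hi -> P m /\ m \in s) ->
  `|(count P s)%:R - c * Num.max 0 (hi - lo)| <= 1.
Proof.
move=> c0 us Pcl Pop; have [lh|hl] := leP lo hi; last first.
  rewrite (_ : count P s = 0%N); last first.
    apply/eqP; rewrite -leqn0 leqNgt -has_count; apply/hasPn => m _.
    by apply/negP => /Pcl /andP[l1 l2]; move: hl; rewrite ltNge (le_trans l1 l2).
  by rewrite (max_idPl _) ?mulr0 ?subr0 ?normr0 // subr_le0 ltW.
rewrite (max_idPr _); last by rewrite subr_ge0.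
have lh' : c * lo - t <= c * hi - t by rewrite lerD2r ler_pM2l.
have up : (count P s)%:R <= c * hi - t - (c * lo - t) + 1.
  apply: count_itv_leq => // m /Pcl; rewrite ler_pdivlMr // ler_pdivrMr //.
  by rewrite ![_ * c]mulrC lerBlDr lerBrDr.
have dn : c * hi - t - (c * lo - t) - 1 <= (count P s)%:R.
  have H (m : int) : c * lo - t < m%:~R < c * hi - t -> P m /\ m \in s.
    rewrite ltrBlDr ltrBrDr ![c * _]mulrC => /andP[h1 h2].
    by apply: Pop; rewrite ltr_pdivlMr // ltr_pdivrMr // h1 h2.
  have := count_zitv_geq us H.
  rewrite -(ler_int R) !intrB -pmulrn; apply: le_trans.
  by have := ceil_ge (c * hi - t); have := floor_le_tmp (c * lo - t); lra.
by rewrite ler_norml mulrBr; apply/andP; split; lra.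
Qed.

(* Length of the intersection of [[a2, b2]] and [[a1 - w, b1 - w]]. *)
Definition overlap (a1 b1 a2 b2 w : R) : R :=
  Num.max 0 (Num.min b2 (b1 - w) - Num.max a2 (a1 - w)).

Lemma overlap_ge0 a1 b1 a2 b2 w : 0 <= overlap a1 b1 a2 b2 w.
Proof. by rewrite /overlap le_max lexx. Qed.

Lemma overlap_leq a1 b1 a2 b2 w : a2 <= b2 -> overlap a1 b1 a2 b2 w <= b2 - a2.
Proof.
move=> ab; rewrite /overlap ge_max subr_ge0 ab /= lerB //.
  by rewrite ge_min lexx.
by rewrite le_max lexx.
Qed.

Lemma overlap_lip a1 b1 a2 b2 w v :
  `|overlap a1 b1 a2 b2 w - overlap a1 b1 a2 b2 v| <= 2 * `|w - v|.
Proof.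
wlog wv : w v / v <= w.
  move=> H; have [|/ltW] := leP v w; first exact: H.
  by move=> /H; rewrite distrC (distrC v w).
rewrite (@ger0_norm _ (w - v)) ?subr_ge0 // /overlap ler_norml.
have d0 : 0 <= w - v by rewrite subr_ge0.
have mx (c x y : R) : Num.max c x <= Num.max c y + Num.max 0 (x - y).
  by rewrite /Num.max; do 3!case: ltP => ?; lra.
have mn (c x y : R) : Num.min c x <= Num.min c y + Num.max 0 (x - y).
  by rewrite /Num.max /Num.min; do 3!case: ltP => ?; lra.
have E0 (x : R) : x <= 0 -> Num.max 0 x = 0 by move=> x0; apply/max_idPl.
have E1 (x : R) : 0 <= x -> Num.max 0 x = x by move=> x0; apply/max_idPr.
have h1 := mn b2 (b1 - w) (b1 - v); have h2 := mn b2 (b1 - v) (b1 - w).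
have h3 := mx a2 (a1 - w) (a1 - v); have h4 := mx a2 (a1 - v) (a1 - w).
rewrite !(E0 (_ - w - _)) in h1 h3; try lra.
rewrite !(E1 (_ - v - _)) in h2 h4; try lra.
have mz (x : R) : x <= 2 * (w - v) -> Num.max 0 x <= 2 * (w - v).
  by move=> xd; rewrite ge_max xd andbT mulr_ge0.
move: h1 h2 h3 h4; set p := Num.min _ _; set q := Num.min _ _.
set r := Num.max _ _; set t := Num.max _ _ => h1 h2 h3 h4.
have h5 := mx 0 (p - r) (q - t); have h6 := mx 0 (q - t) (p - r).
have h7 : Num.max 0 (p - r - (q - t)) <= 2 * (w - v) by apply: mz; lra.
have h8 : Num.max 0 (q - t - (p - r)) <= 2 * (w - v) by apply: mz; lra.
by apply/andP; split; [rewrite lerNl opprB|]; rewrite lerBlDl; [apply: (le_trans h6)|apply: (le_trans h5)]; rewrite lerD2l.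
Qed.

(** The two conditions put [ycoord] in the intersection of [B2] and [B1 - u / N], and [ycoord] has
    slope [1 / u] in [m]. *)
Lemma sum_pind (B1 B2 : set R) (a1 b1 a2 b2 : R) (u : nat) (h N : int) (s : seq int) :
  between B1 a1 b1 -> between B2 a2 b2 -> (0 < u)%N -> uniq s ->
  (forall m : int, pind B1 B2 u h N m -> m \in s) ->
  `|\sum_(m <- s) (pind B1 B2 u h N m)%:R
    - u%:R * overlap a1 b1 a2 b2 (u%:R / N%:~R)| <= 1.
Proof.
move=> [_ op1 cl1] [_ op2 cl2] u_gt0 us Ps; have u0 : 0 < u%:R :> R by rewrite ltr0n.
rewrite sum_bool_count; apply: (@count_itv_approx _ _ _ _ (h%:~R / N%:~R)) => //.
  move=> m /andP[]; rewrite !inE => /cl2 + /cl1; rewrite /zcoord /ycoord => /andP[y1 y2] /andP[z1 z2].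
  by rewrite ge_max le_min y1 y2 lerBlDr lerBrDr z1 z2.
move=> m; rewrite gt_max lt_min ltrBlDr ltrBrDr => /andP[/andP[y1 z1] /andP[y2 z2]].
have pm : pind B1 B2 u h N m.
  by rewrite /pind /zcoord /ycoord; apply/andP; split; apply/mem_set;
    [apply: op2 | apply: op1]; apply/andP.
by split=> //; exact: Ps.
Qed.

Lemma abel_summation (f l : nat -> R) (X : nat) (D Cl V : R) :
  (forall x, (x <= X)%N -> `|\sum_(1 <= u < x.+1) f u| <= D) ->
  (forall u, `|l u| <= Cl) -> (forall u, `|l u.+1 - l u| <= V) ->
  `|\sum_(1 <= u < X.+1) f u * l u| <= D * (Cl + X%:R * V).
Proof.
move=> fD lC lV; pose F x := \sum_(1 <= u < x.+1) f u.
have V0 : 0 <= V by apply: le_trans (lV 0%N).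
have key x : \sum_(1 <= u < x.+1) f u * l u =
    F x * l x - \sum_(0 <= u < x) F u * (l u.+1 - l u).
  elim: x => [|x IH]; first by rewrite /F !big_geq // mul0r subr0.
  rewrite big_nat_recr //= IH [in RHS]big_nat_recr //=.
  have -> : F x.+1 = F x + f x.+1 by rewrite /F big_nat_recr.
  by ring.
have D0 : 0 <= D by apply: le_trans (fD 0%N isT).
rewrite key; apply: le_trans (ler_normB _ _) _; rewrite mulrDr; apply: lerD.
  by rewrite normrM; apply: ler_pM => //; apply: fD.
apply: le_trans (ler_norm_sum _ _ _) _.
apply: (@le_trans _ _ (\sum_(0 <= u < X) D * V)).
  apply: ler_sum_nat => u /andP[_ uX]; rewrite normrM; apply: ler_pM => //.
  by apply: fD; exact: ltnW.
by rewrite sumr_const_nat subn0 -[leLHS]mulr_natr mulrAC -mulrA.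
Qed.

Lemma sum_pairs_gt (J1 J2 : seq int) (X : nat) : uniq J1 -> uniq J2 ->
  (forall i j, i \in J1 -> j \in J2 -> j < i -> (`|i - j| <= X)%N) ->
  \sum_(j <- J2) \sum_(i <- J1) (j < i)%R%:R =
  \sum_(1 <= u < X.+1) (count (fun j : int => j + u%:Z \in J1) J2)%:R :> R.
Proof.
move=> u1 u2 JX; under [RHS]eq_bigr do rewrite -sum_bool_count.
rewrite [RHS]exchange_big; apply: eq_big_seq => j jJ /=.
rewrite -(big_map (fun u : nat => j + u%:Z) xpredT (fun i => (i \in J1)%:R)) /=.
rewrite [RHS](eq_big_seq (fun i => ((j < i) && (i \in J1))%:R)); last first.
  by move=> _ /mapP[u + ->]; rewrite mem_index_iota => u0; rewrite (_ : j < _) //; move: u0; clear; lia.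
rewrite [LHS](eq_big_seq (fun i => ((j < i) && (i \in J1))%:R)); last first.
  by move=> i ->; rewrite andbT.
apply: eq_sum_support => //.
  by rewrite map_inj_uniq ?iota_uniq // => x y /addrI [].
move=> i; have [/andP[ji iJ] _|] := boolP (_ && _); last by rewrite eqxx.
rewrite iJ; apply/esym/mapP; have := JX i j iJ jJ ji.
move=> le; exists `|i - j|%N; last by move: ji; clear; lia.
by rewrite mem_index_iota ltnS le andbT; move: ji; clear; lia.
Qed.

Lemma count_overlap (a1 b1 a2 b2 : R) (N u : nat) : (0 < N)%N ->
  `|(count (fun j : int => j + u%:Z \in zitv (N%:R * a1) (N%:R * b1))
       (zitv (N%:R * a2) (N%:R * b2)))%:R
    - N%:R * overlap a1 b1 a2 b2 (u%:R / N%:R)| <= 1.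
Proof.
move=> N_gt0; have N0 : 0 < N%:R :> R by rewrite ltr0n.
set J2 := zitv (N%:R * a2) _; set J1 := zitv _ _.
have J1E (j : int) : (j + u%:Z \in J1) = (a1 - u%:R / N%:R <= j%:~R / N%:R <= b1 - u%:R / N%:R).
  rewrite mem_zitv intrD -pmulrn lerBlDr lerBrDr -mulrDl.
  by rewrite ler_pdivlMr // ler_pdivrMr // ![_ * N%:R]mulrC.
have J2E (j : int) : (j \in J2) = (a2 <= j%:~R / N%:R <= b2).
  by rewrite mem_zitv ler_pdivlMr // ler_pdivrMr // ![_ * N%:R]mulrC.
rewrite (eq_in_count (a2 := fun j => (j \in J2) && (j + u%:Z \in J1))); last first.
  by move=> j jJ /=; rewrite jJ.
apply: (@count_itv_approx _ _ _ _ 0) => //; first exact: zitv_uniq.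
  move=> m; rewrite addr0 J1E J2E ge_max le_min => /andP[/andP[-> ->] /andP[-> ->]].
  by [].
move=> m; rewrite addr0 gt_max lt_min => /andP[/andP[h1 h2] /andP[h3 h4]].
by rewrite J1E J2E !ltW.
Qed.

(** Count the pairs in [J1] times [J2], the integers in [N B1] and [N B2], in two ways. The product
    of the sizes is about [N^2 (b1 - a1) (b2 - a2)]. Sorted by [u = |i - j|], each sign of [i - j]
    gives [N] times an overlap up to 1 ([count_overlap]), and the diagonal is at most the size of
    [J2]. *)
Lemma overlap_riemann (a1 b1 a2 b2 : R) (N X : nat) : (0 < N)%N -> a1 <= b1 -> a2 <= b2 ->
  N%:R * (`|a1| + `|b1| + `|a2| + `|b2|) <= X%:R ->
  `|\sum_(1 <= u < X.+1) (overlap a1 b1 a2 b2 (u%:R / N%:R) + overlap a2 b2 a1 b1 (u%:R / N%:R))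
    - N%:R * ((b1 - a1) * (b2 - a2))| <=
  (2 * X%:R + 2) / N%:R + (b1 - a1) + 2 * (b2 - a2).
Proof.
move=> N_gt0 ab1 ab2 NX; have N0 : 0 < N%:R :> R by rewrite ltr0n.
set J1 := zitv (N%:R * a1) (N%:R * b1); set J2 := zitv (N%:R * a2) (N%:R * b2).
have u1 : uniq J1 by exact: zitv_uniq.
have u2 : uniq J2 by exact: zitv_uniq.
pose c12 u : R := (count (fun j : int => j + u%:Z \in J1) J2)%:R.
pose c21 u : R := (count (fun j : int => j + u%:Z \in J2) J1)%:R.
have bnd (i j : int) : i \in J1 -> j \in J2 -> `|i - j|%:~R <= X%:R :> R.
  rewrite !mem_zitv => /andP[i1 i2] /andP[j1 j2]; apply: le_trans NX.
  rewrite intr_norm intrB !mulrDr.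
  have [l1 l2 l3 l4] : [/\ - (N%:R * `|a1|) <= N%:R * a1, N%:R * b1 <= N%:R * `|b1|,
      - (N%:R * `|a2|) <= N%:R * a2 & N%:R * b2 <= N%:R * `|b2|].
    by split; rewrite -?mulrN ler_pM2l // ?ler_norm // lerNl -normrN ler_norm.
  have l5 : [/\ 0 <= N%:R * `|a1|, 0 <= N%:R * `|b1|, 0 <= N%:R * `|a2| & 0 <= N%:R * `|b2|].
    by split; rewrite mulr_ge0.
  case: l5 => l5 l6 l7 l8; move: i1 i2 j1 j2 l1 l2 l3 l4 l5 l6 l7 l8; clear => *.
  by rewrite ler_norml; apply/andP; split; lra.

have bnd' (i j : int) : i \in J2 -> j \in J1 -> `|i - j|%:~R <= X%:R :> R.
  by move=> iJ jJ; rewrite distrC; exact: bnd.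
have toN (i j : int) : `|i - j|%:~R <= X%:R :> R -> (`|i - j| <= X)%N.
  by rewrite pmulrn ler_int -lez_nat abszE.
have P12 := @sum_pairs_gt J1 J2 X u1 u2 (fun i j iJ jJ _ => toN _ _ (bnd i j iJ jJ)).
have P21 := @sum_pairs_gt J2 J1 X u2 u1 (fun i j iJ jJ _ => toN _ _ (bnd' i j iJ jJ)).
have prodE : (size J1)%:R * (size J2)%:R =
    \sum_(1 <= u < X.+1) c12 u + \sum_(1 <= u < X.+1) c21 u + \sum_(j <- J2) (j \in J1)%:R :> R.
  rewrite -P12 -P21 [X in _ + X + _]exchange_big -!big_split /=.
  rewrite -(sum1_size J2) natr_sum mulr_sumr; apply: eq_bigr => j _; rewrite mulr1.
  rewrite -(count_uniq_mem _ u1) -sum_bool_count -!big_split /=.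
  rewrite -sum1_size natr_sum; apply: eq_bigr => i _.
  by rewrite /=; have [ij|ij|ij] := ltgtP i j; rewrite ?addr0 ?add0r.
have diag0 : 0 <= \sum_(j <- J2) (j \in J1)%:R :> R by apply: sumr_ge0.
have diag1 : \sum_(j <- J2) (j \in J1)%:R <= (size J2)%:R :> R.
  rewrite -sum1_size natr_sum; apply: ler_sum => j _; rewrite ler_nat; exact: leq_b1.
have le1 : N%:R * a1 <= N%:R * b1 by rewrite ler_pM2l.
have le2 : N%:R * a2 <= N%:R * b2 by rewrite ler_pM2l.
have := size_zitv_leq le1; have := size_zitv_leq le2.
have := size_zitv_geq le1; have := size_zitv_geq le2; rewrite -/J1 -/J2.
set S := \sum_(1 <= u < _) _.
have e12 : `|\sum_(1 <= u < X.+1) c12 u + \sum_(1 <= u < X.+1) c21 u - N%:R * S| <= 2 * X%:R.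
  rewrite /S mulr_sumr -big_split /= -sumrB; apply: le_trans (ler_norm_sum _ _ _) _.
  apply: (@le_trans _ _ (\sum_(1 <= u < X.+1) 2)).
    apply: ler_sum => u _; have h1 := count_overlap a1 b1 a2 b2 u N_gt0.
    have h2 := count_overlap a2 b2 a1 b1 u N_gt0; rewrite -/J1 -/J2 -/(c12 u) -/(c21 u) in h1 h2.
    rewrite mulrDr opprD addrACA; apply: le_trans (ler_normD _ _) _.
    by move: h1 h2; clear; lra.
  by rewrite sumr_const_nat subSS subn0 -[leLHS]mulr_natr.
move: prodE diag0 diag1 e12; move: (S) (\sum_(1 <= u < _) c12 u) (\sum_(1 <= u < _) c21 u).
move: (\sum_(j <- J2) _) (size J1)%:R => dg s1 S' p12 p21 + + + + q1 q2 q3 q4.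
move: (size J2)%:R (ler0n R (size J2)) q1 q2 q3 q4 => s2 s20 q1 q2 q3 q4 pE dg0 dg1 /ler_normlP[e1 e2].
have x0 : 0 <= N%:R * (b1 - a1) by rewrite mulr_ge0 ?subr_ge0 // ltW.
have y0 : 0 <= N%:R * (b2 - a2) by rewrite mulr_ge0 ?subr_ge0 // ltW.
have -> : S' - N%:R * ((b1 - a1) * (b2 - a2)) =
    (N%:R * S' - N%:R * (b1 - a1) * (N%:R * (b2 - a2))) / N%:R.
  by field; rewrite gt_eqF.
have -> : (2 * X%:R + 2) / N%:R + (b1 - a1) + 2 * (b2 - a2) =
    (2 * X%:R + 2 + N%:R * (b1 - a1) + 2 * (N%:R * (b2 - a2))) / N%:R.
  by field; rewrite gt_eqF.
rewrite normrM (@ger0_norm _ N%:R^-1) ?invr_ge0 ?ler0n // ler_pM2r ?invr_gt0 //.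
move: x0 y0 q1 q2 q3 q4; rewrite -!mulrBr; move: (N%:R * (b1 - a1)) (N%:R * (b2 - a2)).
move=> x y x0 y0 q1 q2 q3 q4.
have m1 : `|s1 - x| * s2 <= 1 * (y + 1).
  by apply: ler_pM => //; rewrite ler_norml; apply/andP; split; lra.
have m2 : x * `|s2 - y| <= x * 1.
  by apply: ler_wpM2l => //; rewrite ler_norml; apply/andP; split; lra.
have m3 : `|s1 * s2 - x * y| <= x + y + 1.
  rewrite (_ : _ - _ = (s1 - x) * s2 + x * (s2 - y)); last by ring.
  apply: le_trans (ler_normD _ _) _; rewrite !normrM (ger0_norm x0) (ger0_norm s20).
  by lra.
move: m3 e1 e2; rewrite pE => /ler_normlP[m3 m4] e1 e2.
by apply/ler_normlP; split; lra.
Qed.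

End Model.

Section HalfModel.
Variable R : realType.
Variables (alpha : R) (A B1 B2 : set R) (a b a1 b1 a2 b2 : R).
Hypotheses (ab : a <= b) (btw1 : between B1 a1 b1) (btw2 : between B2 a2 b2).

Lemma pind_mem (u : nat) (h N m : int) (L : R) : (0 < u)%N -> 1 <= N%:~R :> R ->
  u%:R * (`|a2| + `|b2|) + `|h%:~R| <= L -> pind B1 B2 u h N m -> m \in zitv (- L) L.
Proof.
move=> u_gt0 N1 LL; rewrite /pind => /andP[/set_mem yB _].
have [_ _ /(_ _ yB) /andP[y1 y2]] := btw2.
have u0 : 0 < u%:R :> R by rewrite ltr0n.
have mE : m%:~R = u%:R * ycoord R u h N m - h%:~R / N%:~R :> R.
  by rewrite /ycoord; field; rewrite !gt_eqF //; apply: lt_le_trans N1.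
rewrite mem_zitv -ler_norml; apply: le_trans LL; rewrite mE.
apply: le_trans (ler_normB _ _) _; apply: lerD.
  rewrite normrM normr_nat ler_pM2l // ler_norml.
  have := ler_norm b2; have := ler_norm (- a2); rewrite normrN.
  have := normr_ge0 a2; have := normr_ge0 b2.
  by move: y1 y2; clear => *; apply/andP; split; lra.
rewrite normrM ler_piMr // normfV ger0_norm ?(le_trans ler01 N1) // invf_le1 //.
exact: lt_le_trans N1.
Qed.

Lemma cong_count_ratio (u : nat) (h : int) (T : R) : (0 < u)%N -> (tau u)%:R <= T ->
  (cong_count u h)%:R / u%:R ^+ 2 <= T / u%:R :> R.
Proof.
move=> u_gt0 tT; have u0 : 0 < u%:R :> R by rewrite ltr0n.
rewrite expr2 invfM mulrA ler_pM2r ?invr_gt0 // ler_pdivrMr //.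
apply: (@le_trans _ _ (u * tau u)%:R); first by rewrite ler_nat cong_count_leq.
by rewrite natrM mulrC ler_pM2r.
Qed.

(** By [sum_pind], the sum over [m] is [u * overlap] up to 1, which turns the densities into
    [aS u * overlap]. Summation by parts then replaces [aS u] by its mean [b - a], the overlap being
    Lipschitz in [u / N]. *)
Lemma model_sum (N : int) (X : nat) (L T D C0 : R) :
  1 <= N%:~R :> R -> (X%:R <= C0 * N%:~R) ->
  (forall u, (0 < u <= X)%N -> (tau u)%:R <= T) ->
  (forall (u : nat) (h : int), (0 < u <= X)%N -> h \in Hseq alpha A a b u ->
     u%:R * (`|a2| + `|b2|) + `|h%:~R| <= L) ->
  (forall x, (x <= X)%N -> `|\sum_(1 <= u < x.+1) (aS alpha A a b u - (b - a))| <= D) ->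
  `|\sum_(1 <= u < X.+1) \sum_(h <- Hseq alpha A a b u)
      (cong_count u h)%:R / u%:R ^+ 2 * \sum_(m <- zitv (- L) L) (pind B1 B2 u h N m)%:R
    - (b - a) * \sum_(1 <= u < X.+1) overlap a1 b1 a2 b2 (u%:R / N%:~R)|
  <= (b - a + 1) * (T * harmonic_sum R X) + D * (b2 - a2 + 2 * C0).
Proof.
move=> N1 XN tT LL aD; have N0 : 0 < N%:~R :> R by exact: lt_le_trans N1.
have ab2 : a2 <= b2 by case: btw2.
have s1 : `|\sum_(1 <= u < X.+1) \sum_(h <- Hseq alpha A a b u)
      (cong_count u h)%:R / u%:R ^+ 2 * \sum_(m <- zitv (- L) L) (pind B1 B2 u h N m)%:R
    - \sum_(1 <= u < X.+1) aS alpha A a b u * overlap a1 b1 a2 b2 (u%:R / N%:~R)|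
    <= (b - a + 1) * (T * harmonic_sum R X).
  rewrite -sumrB; apply: le_trans (ler_norm_sum _ _ _) _.
  rewrite /harmonic_sum !mulr_sumr; apply: ler_sum_nat => u /andP[u_gt0]; rewrite ltnS => uX.
  have u0 : 0 < u%:R :> R by rewrite ltr0n.
  have uX' : (0 < u <= X)%N by rewrite u_gt0.
  rewrite /aS mulr_suml -sumrB; apply: le_trans (ler_norm_sum _ _ _) _.
  apply: (@le_trans _ _ (\sum_(h <- Hseq alpha A a b u) T / u%:R)); last first.
    rewrite big_const_seq count_predT iter_addr_0 -[leLHS]mulr_natl ler_wpM2r ?size_Hseq //.
    rewrite divr_ge0 //; apply: le_trans (tT _ uX'); exact: ler0n.
  rewrite !big_seq; apply: ler_sum => h hH.
  have -> : (cong_count u h)%:R / u%:R * overlap a1 b1 a2 b2 (u%:R / N%:~R) =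
      (cong_count u h)%:R / u%:R ^+ 2 * (u%:R * overlap a1 b1 a2 b2 (u%:R / N%:~R)).
    by field; rewrite gt_eqF.
  rewrite -mulrBr normrM ger0_norm ?divr_ge0 ?exprn_ge0 //.
  apply: (@le_trans _ _ ((cong_count u h)%:R / u%:R ^+ 2 * 1)).
    rewrite ler_wpM2l ?divr_ge0 ?exprn_ge0 //.
    apply: sum_pind => //; first exact: zitv_uniq.
    by move=> m; apply: pind_mem => //; exact: LL.
  by rewrite mulr1; apply: cong_count_ratio => //; exact: tT.
have s2 : `|\sum_(1 <= u < X.+1) aS alpha A a b u * overlap a1 b1 a2 b2 (u%:R / N%:~R)
    - (b - a) * \sum_(1 <= u < X.+1) overlap a1 b1 a2 b2 (u%:R / N%:~R)|
    <= D * (b2 - a2 + 2 * C0).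
  rewrite mulr_sumr -sumrB; under eq_bigr do rewrite -mulrBl.
  apply: le_trans (@abel_summation _ _ (fun u => overlap a1 b1 a2 b2 (u%:R / N%:~R)) X D (b2 - a2) (2 / N%:~R) aD _ _) _.
  - by move=> u; rewrite ger0_norm ?overlap_ge0 // overlap_leq.
  - move=> u; apply: le_trans (overlap_lip _ _ _ _ _ _) _.
    rewrite -mulrBl.
    rewrite -(natr1 u) (addrC u%:R) addrK.
    rewrite mul1r ger0_norm //.
    by rewrite invr_ge0 ltW.
  - apply: ler_wpM2l; first by apply: le_trans (aD 0%N isT).
    rewrite lerD2l mulrCA ler_pM2l // ler_pdivrMr //.
apply: le_trans (ler_distD (\sum_(1 <= u < X.+1) aS alpha A a b u * overlap a1 b1 a2 b2 (u%:R / N%:~R)) _ _) _.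
exact: lerD.
Qed.

End HalfModel.

(** * Pairs with [i > j], with all parameters free *)

Section HalfEstimate.
Variable R : realType.

Lemma sum_kernel_zitv (B1 B2 : set R) (M V d : R) (u : nat) (h : int) (s : seq int)
    (g : int -> int -> R) : 0 <= d ->
  \sum_(N <- zitv (M - d) (M + V)) \sum_(m <- s) kernel B1 B2 M V u h N m * g N m =
  \sum_(N <- zitv M (M + V)) N%:~R^-1 * \sum_(m <- s) (pind B1 B2 u h N m)%:R * g N m.
Proof.
move=> d0; transitivity (\sum_(N <- zitv (M - d) (M + V))
    if M <= N%:~R <= M + V then N%:~R^-1 * \sum_(m <- s) (pind B1 B2 u h N m)%:R * g N m else 0).
  apply: eq_bigr => N _; rewrite /kernel; case: ifP => _ /=; last first.
    by rewrite big1 // => m _; rewrite mul0r.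
  rewrite mulr_sumr; apply: eq_bigr => m _; rewrite mulrA /pind.
  by case: ifP => _; rewrite ?mulr1 ?mulr0.
rewrite -big_mkcond -big_filter; apply: perm_big; apply: uniq_perm; rewrite ?filter_uniq ?zitv_uniq //.
move=> N; rewrite mem_filter !mem_zitv.
have [/andP[h1 h2]|] := boolP (M <= _ <= _) => //=.
by rewrite h2 andbT; apply: le_trans h1; rewrite gerBl.
Qed.

Lemma sum_exchange3 (X : nat) (H : nat -> seq int) (s : seq int) (w : int -> R)
    (f : nat -> int -> int -> R) :
  \sum_(N <- s) w N * \sum_(1 <= u < X.+1) \sum_(h <- H u) f u h N =
  \sum_(1 <= u < X.+1) \sum_(h <- H u) \sum_(N <- s) w N * f u h N.
Proof.
under eq_bigr do rewrite mulr_sumr.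
rewrite exchange_big; apply: eq_bigr => u _; under eq_bigr do rewrite mulr_sumr.
by rewrite exchange_big.
Qed.

(** Splits the [h] into good ones, bounded by [g u], and bad ones, those in [p u], bounded by the
    constant [Y]. *)
Lemma sum_Hseq_leq (alpha : R) (A : set R) (a b : R) (X : nat) (F Y : R) (f : nat -> int -> R)
    (g : nat -> R) (p : nat -> pred int) : a <= b -> 0 <= Y ->
  (forall u, (0 < u <= X)%N -> 0 <= g u) ->
  (forall u h, (0 < u <= X)%N -> h \in Hseq alpha A a b u -> ~~ p u h -> f u h <= g u) ->
  (forall u h, (0 < u <= X)%N -> h \in Hseq alpha A a b u -> p u h -> f u h <= Y) ->
  \sum_(1 <= u < X.+1) (count (p u) (Hseq alpha A a b u))%:R <= F ->
  \sum_(1 <= u < X.+1) \sum_(h <- Hseq alpha A a b u) f u h <=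
  (b - a + 1) * \sum_(1 <= u < X.+1) g u + Y * F.
Proof.
move=> ab Y0 g0 fg fY pF.
apply: (@le_trans _ _ ((b - a + 1) * \sum_(1 <= u < X.+1) g u +
    Y * \sum_(1 <= u < X.+1) (count (p u) (Hseq alpha A a b u))%:R)); last first.
  by rewrite lerD2l ler_wpM2l.
rewrite !mulr_sumr -big_split /=; apply: ler_sum_nat => u /andP[u_gt0]; rewrite ltnS => uX.
have uX' : (0 < u <= X)%N by rewrite u_gt0.
apply: (@le_trans _ _ (\sum_(h <- Hseq alpha A a b u) (g u + Y * (p u h)%:R))).
  rewrite !big_seq; apply: ler_sum => h hH; have [ph|nph] := boolP (p u h).
    by rewrite mulr1; apply: le_trans (fY _ _ uX' hH ph) _; rewrite lerDr g0.
  by rewrite mulr0 addr0 fg.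
rewrite big_split /= -mulr_sumr sum_bool_count lerD2r.
by rewrite big_const_seq count_predT iter_addr_0 -[leLHS]mulr_natl ler_wpM2r ?size_Hseq ?g0.
Qed.

(** The four error terms are, in order: Kloosterman error, smoothing, pairs with gcd above [G], and
    main term. The constant depends on none of [M], [V] and the parameters. *)
Lemma half_estimate (kappa alpha C : R) (A B1 B2 : set R) (a b a1 b1 a2 b2 C0 Ch : R) :
  2 <= kappa -> 0 < C ->
  (forall (p : int) (q : nat), (0 < q)%N -> C / q%:R `^ kappa < `|alpha - p%:~R / q%:R|) ->
  between A a b -> between B1 a1 b1 -> between B2 a2 b2 -> 0 <= C0 -> 0 <= Ch ->
  exists2 K : R, 0 <= K & forall (M V L : R) (X S1 S2 : nat) (T G D k0 eps0 Dd : R),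
    1 <= M -> 1 <= V -> V <= M -> X%:R <= C0 * M ->
    (forall (u : nat) (h : int), (0 < u <= X)%N -> h \in Hseq alpha A a b u ->
       `|h%:~R| <= Ch * u%:R * M) ->
    (0 < S1)%N -> (4 * S1%:R : R) <= M -> S1%:R <= V -> (0 < S2)%N -> S2%:R <= M ->
    0 <= D -> 0 <= k0 -> 0 < G -> 0 <= T -> (forall u, (0 < u <= X)%N -> (tau u)%:R <= T) ->
    2 * G ^+ 4 * T ^+ 3 <= D * k0 ^+ 4 ->
    (forall (u : nat) (h : int), (0 < u <= X)%N -> h \in Hseq alpha A a b u ->
       u%:R * (`|a2| + `|b2|) + `|h%:~R| + 2 * S2%:R <= L) ->
    eps0 = k0 * ((1 + C0 * M / S1%:R) * (1 + C0 * M / S2%:R))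
      + T * ((1 + T * D / S1%:R) * (1 + T * D / S2%:R) - 1) ->
    (forall x, (x <= X)%N -> `|\sum_(1 <= u < x.+1) (aS alpha A a b u - (b - a))| <= Dd) ->
    `|\sum_(N <- zitv M (M + V)) N%:~R^-1 * (Psum alpha A B1 B2 a b X L N
        - (b - a) * \sum_(1 <= u < X.+1) overlap a1 b1 a2 b2 (u%:R / N%:~R))| <=
    K * (eps0 * V + (T + eps0) * (S1%:R + V * S2%:R / M) * harmonic_sum R X
      + T * (M * G `^ (- nu kappa)) * harmonic_sum R X + V / M * (T * harmonic_sum R X + Dd)).
Proof.
move=> kappa2 C_gt0 dioph btwA btw1 btw2 C00 Ch0.
have [ab Aop Acl] := btwA; have [ab2 _ _] := btw2.
have [Kg Kg0 good] := good_pair_estimate btw1 btw2 C00 Ch0.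
pose cF := (b - a + 1) / gapH kappa C a b.
have ba0 : 0 <= b - a + 1 by rewrite addr_ge0 ?subr_ge0.
have cF0 : 0 <= cF by rewrite divr_ge0 //; exact/ltW/gapH_gt0.
have b2a2 : 0 <= b2 - a2 by rewrite subr_ge0.
pose K1 := (b - a + 1) * Kg; pose K2 := (b2 - a2 + 1) * (3 + C0) * cF * C0.
have K10 : 0 <= K1 by rewrite mulr_ge0.
have K20 : 0 <= K2 by rewrite /K2; move: cF0 (addr_ge0 b2a2 ler01) => ? ?; rewrite mulr_ge0 // mulr_ge0 // mulr_ge0 // addr_ge0.
pose K3 := 2 * (b - a + 1); pose K4 := 2 * (b2 - a2 + 2 * C0).
have K30 : 0 <= K3 by rewrite mulr_ge0.
have K40 : 0 <= K4 by rewrite mulr_ge0 // addr_ge0 // mulr_ge0.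
exists (K1 * C0 + K1 + K2 + K3 + K4); first by rewrite !addr_ge0 // mulr_ge0.
move=> M V L X S1 S2 T G D k0 eps0 Dd M1 V1 VM XM hM S10 S1M S1V S20 S2M D0 k00 G0 T0 tT GT LL eE aD.
set H := harmonic_sum R X; have H0 : 0 <= H by exact: harmonic_sum_ge0.
have M0 : 0 < M by exact: lt_le_trans M1.
have V0 : 0 < V by exact: lt_le_trans V1.
have S1R : 0 < S1%:R :> R by rewrite ltr0n.
have S2R : 0 < S2%:R :> R by rewrite ltr0n.
have e0 : 0 <= eps0.
  rewrite eE addr_ge0 // mulr_ge0 //; last first.
    by rewrite subr_ge0 -[leLHS]mulr1 ler_pM // lerDl divr_ge0 ?mulr_ge0.
  by rewrite mulr_ge0 // addr_ge0 // divr_ge0 ?mulr_ge0 // ltW.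
have Dd0 : 0 <= Dd by apply: le_trans (aD 0%N isT).
pose Q := S1%:R + V * S2%:R / M.
have Q0 : 0 <= Q by rewrite addr_ge0 // divr_ge0 ?mulr_ge0 // ltW.
pose c u h : R := (cong_count u h)%:R / u%:R ^+ 2.
pose s1 : seq int := zitv (M - 2 * S1%:R) (M + V); pose s2 : seq int := zitv (- L) L.
pose k1 u h := \sum_(N <- s1) \sum_(m <- s2) kernel B1 B2 M V u h N m * (u%:Z %| (N * m + h)%R)%Z%:R.
pose k2 u h := \sum_(N <- s1) \sum_(m <- s2) kernel B1 B2 M V u h N m.
pose mo (N : int) : R := \sum_(1 <= u < X.+1) \sum_(h <- Hseq alpha A a b u)
      (cong_count u h)%:R / u%:R ^+ 2 * \sum_(m <- zitv (- L) L) (pind B1 B2 u h N m)%:R.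
have E1 : \sum_(N <- zitv M (M + V)) N%:~R^-1 * Psum alpha A B1 B2 a b X L N =
    \sum_(1 <= u < X.+1) \sum_(h <- Hseq alpha A a b u) k1 u h.
  rewrite /Psum sum_exchange3; apply: eq_bigr => u _; apply: eq_bigr => h _.
  rewrite /k1 sum_kernel_zitv ?mulr_ge0 //; apply: eq_bigr => N _; congr (_ * _).
  by apply: eq_bigr => m _; rewrite -natrM mulnb andbC.
have E2 : \sum_(N <- zitv M (M + V)) N%:~R^-1 * mo N =
    \sum_(1 <= u < X.+1) \sum_(h <- Hseq alpha A a b u) c u h * k2 u h.
  rewrite /mo sum_exchange3; apply: eq_bigr => u _; apply: eq_bigr => h _.
  under eq_bigr do rewrite mulrCA; rewrite -mulr_sumr; congr (_ * _).
  transitivity (\sum_(N <- s1) \sum_(m <- s2) kernel B1 B2 M V u h N m * 1).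
    rewrite sum_kernel_zitv ?mulr_ge0 //; apply: eq_bigr => N _; congr (_ * _).
    by apply: eq_bigr => m _; rewrite mulr1.
  by do 2!apply: eq_bigr => ? _; rewrite mulr1.
have tau0 u : (0 < u <= X)%N -> 0 < u%:R :> R by rewrite ltr0n => /andP[].
(* Replaces the congruence by its density [c u h]: [good_pair_estimate] if the gcd is at most [G],
   otherwise the trivial bounds of both sums, with the number of exceptions from [bad_pairs_leq]. *)
have part1 : `|\sum_(N <- zitv M (M + V)) N%:~R^-1 * Psum alpha A B1 B2 a b X L N
     - \sum_(N <- zitv M (M + V)) N%:~R^-1 * mo N| <=
   K1 * (C0 * (eps0 * V) + (T + eps0) * Q * H) + K2 * (T * (M * G `^ (- nu kappa)) * H).
  rewrite E1 E2 -sumrB; apply: le_trans (ler_norm_sum _ _ _) _.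
  under eq_bigr do rewrite -sumrB.
  apply: (@le_trans _ _ (\sum_(1 <= u < X.+1) \sum_(h <- Hseq alpha A a b u) `|k1 u h - c u h * k2 u h|)).
    by apply: ler_sum => u _; exact: ler_norm_sum.
  pose g (u : nat) := Kg * (eps0 * (V / M) + (T + eps0) / u%:R * Q).
  have g0 u : (0 < u <= X)%N -> 0 <= g u.
    move=> /tau0 u0; rewrite mulr_ge0 // addr_ge0 ?mulr_ge0 ?invr_ge0 ?(ltW V0) ?(ltW M0) //.
    by rewrite addr_ge0.
  apply: le_trans (@sum_Hseq_leq alpha A a b X _ ((b2 - a2 + 1) * (3 + C0) * T) _ g
    (fun u h => G < (gcdn `|h| u)%:R) ab _ g0 _ _ (bad_pairs_leq kappa2 C_gt0 dioph ab Acl X G0)) _.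
  - by rewrite mulr_ge0 // mulr_ge0 // addr_ge0.
  - move=> u h uX hH; rewrite -leNgt => gG; have /andP[u_gt0 _] := uX.
    rewrite /k1 /k2 /c /s1 /s2.
    apply: (good M V L u h S1 S2 T G D k0 eps0) => //.
    + by apply: le_trans XM; rewrite ler_nat; case/andP: uX.
    + exact: hM.
    + exact: tT.
    + exact: LL.
  - move=> u h uX hH _; have /andP[u_gt0 uX'] := uX; have u0 := tau0 _ uX.
    have uM : u%:R <= C0 * M by apply: le_trans XM; rewrite ler_nat.
    have k10 : 0 <= k1 u h.
      by apply: sumr_ge0 => N _; apply: sumr_ge0 => m _; rewrite mulr_ge0 // kernel_ge0.
    have k20 : 0 <= c u h * k2 u h.
      rewrite mulr_ge0 ?divr_ge0 ?exprn_ge0 //.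
      by apply: sumr_ge0 => N _; apply: sumr_ge0 => m _; rewrite kernel_ge0.
    have k1b : k1 u h <= (b2 - a2 + 1) * (1 + C0) * T.
      apply: le_trans (sum_kernel_cong_leq B1 btw2 h M0 (ltW V0) u_gt0 (zitv_uniq _ _) (zitv_uniq _ _)) _.
      rewrite mulrCA -mulrA; apply: ler_wpM2l; first by rewrite addr_ge0.
      rewrite mulrC ler_pdivrMr // -mulrA mulrCA; apply: ler_pM => //.
      - by rewrite addr_ge0 // ltW.
      - exact: tT.
      - by rewrite mulrDl mul1r lerD.
    have k2b : c u h * k2 u h <= (b2 - a2 + 1) * 2 * T.
      apply: (@le_trans _ _ (T / u%:R * (M^-1 * ((V + 1) * ((b2 - a2) * u%:R + 1))))).
        apply: ler_pM; rewrite ?divr_ge0 ?exprn_ge0 //.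
        - by apply: sumr_ge0 => N _; apply: sumr_ge0 => m _; rewrite kernel_ge0.
        - by apply: cong_count_ratio => //; exact: tT.
        - by apply: (sum_kernel_leq B1 btw2) => //; [exact: ltW | exact: zitv_uniq | exact: zitv_uniq].
      have -> : T / u%:R * (M^-1 * ((V + 1) * ((b2 - a2) * u%:R + 1))) =
          T * (((V + 1) / M) * (((b2 - a2) * u%:R + 1) / u%:R)).
        by field; rewrite !gt_eqF.
      rewrite [leRHS]mulrC [_ * 2]mulrC; apply: ler_wpM2l => //; apply: ler_pM.
      - by rewrite divr_ge0 ?addr_ge0 // ltW.
      - by rewrite divr_ge0 ?addr_ge0 ?mulr_ge0.
      - by rewrite ler_pdivrMr //; move: V1 VM; clear; lra.
      - rewrite ler_pdivrMr // [leRHS]mulrDl mul1r lerD2l ler1n //.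
    apply: (@le_trans _ _ (k1 u h + c u h * k2 u h)).
      by apply: le_trans (ler_normB _ _) _; rewrite !ger0_norm.
    apply: le_trans (lerD k1b k2b) _; rewrite -mulrDl -mulrDr.
    by rewrite (_ : 1 + C0 + 2 = 3 + C0) //; ring.
  apply: lerD.
    rewrite /K1 -mulrA; apply: ler_wpM2l => //; rewrite /g -mulr_sumr.
    apply: ler_wpM2l => //; rewrite big_split /=; apply: lerD.
      rewrite sumr_const_nat subSS subn0 -[leLHS]mulr_natl.
      rewrite mulrCA [leRHS]mulrCA; apply: ler_wpM2l => //.
      by rewrite mulrCA [leRHS]mulrC ler_wpM2l ?(ltW V0) // ler_pdivrMr.
    rewrite /H /harmonic_sum mulr_sumr; apply: ler_sum => u _.
    by rewrite mulrAC.
  rewrite -/cF -/H /K2.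
  have -> : (b2 - a2 + 1) * (3 + C0) * T * (cF * (X%:R * G `^ (- nu kappa) * H)) =
    (b2 - a2 + 1) * (3 + C0) * cF * T * G `^ (- nu kappa) * H * X%:R by ring.
  have -> : (b2 - a2 + 1) * (3 + C0) * cF * C0 * (T * (M * G `^ (- nu kappa)) * H) =
    (b2 - a2 + 1) * (3 + C0) * cF * T * G `^ (- nu kappa) * H * (C0 * M) by ring.
  apply: ler_wpM2l => //; rewrite mulr_ge0 // mulr_ge0 ?powR_ge0 // mulr_ge0 // mulr_ge0 //.
  by rewrite mulr_ge0 // addr_ge0.
(* [model_sum] for each of the at most [2 V] integers [N], with weight at most [1 / M]. *)
have part2 : `|\sum_(N <- zitv M (M + V)) N%:~R^-1 * mo N - \sum_(N <- zitv M (M + V)) N%:~R^-1 *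
    ((b - a) * \sum_(1 <= u < X.+1) overlap a1 b1 a2 b2 (u%:R / N%:~R))| <=
    (K3 + K4) * (V / M * (T * H + Dd)).
  rewrite -sumrB; apply: le_trans (ler_norm_sum _ _ _) _.
  pose Z := (b - a + 1) * (T * H) + Dd * (b2 - a2 + 2 * C0).
  have Z0 : 0 <= Z by rewrite addr_ge0 ?mulr_ge0 // addr_ge0 // mulr_ge0.
  apply: (@le_trans _ _ (\sum_(N <- zitv M (M + V)) M^-1 * Z)).
    rewrite !big_seq; apply: ler_sum => N; rewrite mem_zitv => /andP[N1 _].
    rewrite -mulrBr normrM ger0_norm ?invr_ge0 ?(le_trans (ltW M0)) //.
    have N0 : 0 < N%:~R :> R by exact: lt_le_trans N1.
    apply: ler_pM; rewrite ?invr_ge0 ?(ltW N0) //; first by rewrite lef_pV2.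
    apply: model_sum => //; first exact: le_trans N1.
      by apply: le_trans XM _; rewrite ler_wpM2l.
    move=> u h uX hH; apply: le_trans (LL u h uX hH); rewrite lerDl mulr_ge0 //.
  rewrite big_const_seq count_predT iter_addr_0 -[leLHS]mulr_natl.
  have sz : (size (zitv M (M + V)))%:R <= 2 * V.
    apply: le_trans (size_zitv_leq _) _; first by rewrite lerDl ltW.
    by move: V1; clear; lra.
  apply: (@le_trans _ _ (2 * V * (M^-1 * Z))).
    by rewrite ler_wpM2r // mulr_ge0 // invr_ge0 ltW.
  rewrite /Z /K3 /K4.
  have TH0 : 0 <= T * H by rewrite mulr_ge0.
  rewrite -subr_ge0.
  rewrite (_ : _ - _ = V / M * (2 * (b - a + 1) * Dd + 2 * (b2 - a2 + 2 * C0) * (T * H))); last by ring.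
  rewrite mulr_ge0 ?divr_ge0 ?(ltW V0) ?(ltW M0) // addr_ge0 // mulr_ge0 // mulr_ge0 // addr_ge0 // mulr_ge0 //.
under eq_bigr do rewrite mulrBr; rewrite sumrB.
apply: le_trans (ler_distD (\sum_(N <- zitv M (M + V)) N%:~R^-1 * mo N) _ _) _.
apply: le_trans (lerD part1 part2) _; rewrite -/Q -/H.
set t1 := eps0 * V; set t2 := (T + eps0) * Q * H; set t3 := T * _ * H; set t4 := V / M * _.
have t10 : 0 <= t1 by rewrite mulr_ge0 // ltW.
have t20 : 0 <= t2 by rewrite !mulr_ge0 // addr_ge0.
have t30 : 0 <= t3 by rewrite !mulr_ge0 // ?powR_ge0 // ltW.
have t40 : 0 <= t4 by rewrite mulr_ge0 ?divr_ge0 ?addr_ge0 ?mulr_ge0 // ltW.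
rewrite -subr_ge0.
have KC : 0 <= K1 * C0 by rewrite mulr_ge0.
rewrite (_ : _ - _ = (K1 + K2 + K3 + K4) * t1 + (K1 * C0 + K2 + K3 + K4) * t2
  + (K1 * C0 + K1 + K3 + K4) * t3 + (K1 * C0 + K1 + K2) * t4); last by ring.
by rewrite !addr_ge0 // mulr_ge0 // !addr_ge0.
Qed.

End HalfEstimate.

(** * Choice of the parameters as powers *)

Section AveragePower.
Variable R : realType.

Lemma ln_leq_powR (x e : R) : 0 < e -> 1 <= x -> 1 + ln x <= (1 + e^-1) * x `^ e.
Proof.
move=> e0 x1; have x0 : 0 < x by exact: lt_le_trans x1.
have p0 : 0 < x `^ e by rewrite powR_gt0.
have p1 : 1 <= x `^ e by rewrite -(powRr0 x); apply: ler_powR => //; exact: ltW.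
have := ln_sublinear p0; rewrite ln_powR => le.
rewrite mulrDl mul1r lerD // [leRHS]mulrC ler_pdivlMr // mulrC; exact: ltW.
Qed.

Lemma harmonic_sum_powR (X : nat) (e : R) : 0 < e -> (0 < X)%N ->
  harmonic_sum R X <= (1 + e^-1) * X%:R `^ e.
Proof.
move=> e0 X0; apply: le_trans (harmonic_sum_ln R X0) _.
by apply: ln_leq_powR => //; rewrite ler1n.
Qed.

Lemma ceil_powR (x e : R) : 1 <= x -> 0 <= e ->
  exists n : nat, [/\ (0 < n)%N, x `^ e <= n%:R & n%:R <= 2 * x `^ e].
Proof.
move=> x1 e0; have p1 : 1 <= x `^ e by rewrite -(powRr0 x); apply: ler_powR.
exists (Num.truncn (x `^ e)).+1; split=> //.
  by apply: ltW; exact: truncnS_gt.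
have /andP[+ _] := truncn_itv (le_trans ler01 p1); rewrite -natr1; lra.
Qed.

Lemma aS_average_power (kappa alpha C : R) (A : set R) (a b : R) :
  2 <= kappa -> 0 < C ->
  (forall (p : int) (q : nat), (0 < q)%N -> C / q%:R `^ kappa < `|alpha - p%:~R / q%:R|) ->
  a <= b -> (forall x, a < x < b -> A x) -> (forall x, A x -> a <= x <= b) ->
  exists2 K, 0 <= K & forall X x : nat, (0 < X)%N -> (x <= X)%N ->
    `|\sum_(1 <= u < x.+1) (aS alpha A a b u - (b - a))| <= K * X%:R `^ (1 - nu kappa ^+ 2 / 16).
Proof.
move=> kappa2 C0 dioph ab Aop Acl; set v := nu kappa.
have v0 : 0 < v by exact: nu_gt0.
have v1 : v <= 1 by exact: nu_le1.
pose e := v ^+ 2 / 16; have e0 : 0 < e by rewrite divr_gt0 ?exprn_gt0.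
have vv : v ^+ 2 <= v by rewrite expr2 ler_piMl // ltW.
pose c1 := 12 * (C / 2) `^ (- v); pose c3 := (b - a + 1) / gapH kappa C a b + (b - a).
have c10 : 0 <= c1 by rewrite mulr_ge0 // powR_ge0.
have c30 : 0 <= c3.
  have ba0 : 0 <= b - a by rewrite subr_ge0.
  rewrite addr_ge0 // divr_ge0 //; first by rewrite addr_ge0.
  exact/ltW/gapH_gt0.
have cc0 : 0 <= c1 + 4 + c3 by do 2!apply: addr_ge0 => //.
have K0 : 0 <= (c1 + 4 + c3) * (1 + e^-1).
  by apply: mulr_ge0 => //; rewrite addr_ge0 // invr_ge0 ltW.
exists ((c1 + 4 + c3) * (1 + e^-1)) => // X x X0 xX.
have [->|x_gt0] := posnP x; first by rewrite big_geq // normr0 mulr_ge0 ?powR_ge0.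
apply: (@le_trans _ _ ((c1 + 4 + c3) * (1 + e^-1) * x%:R `^ (1 - e))); last first.
  apply: ler_wpM2l => //; apply: ge0_ler_powR; rewrite ?nnegrE ?ler_nat //.
  by rewrite /e; lra.
have x1 : 1 <= x%:R :> R by rewrite ler1n.
have x0 : 0 < x%:R :> R by rewrite ltr0n.
have h2 : 0 <= 2^-1 :> R by rewrite invr_ge0.
(* With [T] about [x^(1/2)] and [E = x^(v/8)], the three errors of [aS_average] have exponents
   [1 + v/8 - v/2], [1/2 + v/8] and [1 - v^2/8], each at most [1 - 2 e]. The harmonic sum costs
   [x^e]. *)
have [T [T0 Tge Tle]] := ceil_powR x1 h2.
pose E : R := x%:R `^ (v / 8); have E0 : 0 < E by rewrite powR_gt0.
have := aS_average kappa2 C0 dioph ab Aop Acl x T0 E0; rewrite -/v -/c3.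
move=> /le_trans; apply.
set H := harmonic_sum R x; have H0 : 0 <= H by exact: harmonic_sum_ge0.
have HE : H <= (1 + e^-1) * x%:R `^ e by exact: harmonic_sum_powR.
have pD (s t : R) : x%:R `^ s * x%:R `^ t = x%:R `^ (s + t).
  by rewrite powRD //; apply/implyP => _; rewrite gt_eqF.
have mono s t : s <= t -> x%:R `^ s <= x%:R `^ t :> R by move=> st; apply: ler_powR.
have t1 : E * (12 * x%:R * (C * T%:R / 2) `^ (- v)) <= c1 * x%:R `^ (1 - 2 * e).
  apply: (@le_trans _ _ (E * (12 * x%:R * ((C / 2) `^ (- v) * x%:R `^ (- (v / 2)))))).
    rewrite ler_pM2l // ler_pM2l ?mulr_gt0 //.
    rewrite (_ : - (v / 2) = 2^-1 * - v); last by ring.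
    rewrite powRrM -powRM ?divr_ge0 ?powR_ge0 // ?(ltW C0) // !powRN lef_pV2.
    - apply: ge0_ler_powR; rewrite ?nnegrE ?mulr_ge0 ?powR_ge0 ?divr_ge0 ?(ltW C0) ?(ltW v0) //.
      by rewrite mulrAC ler_pM2r ?invr_gt0 // ler_pM2l.
    - by rewrite posrE powR_gt0 // divr_gt0 // mulr_gt0 // ltr0n.
    - by rewrite posrE powR_gt0 // mulr_gt0 ?powR_gt0 // divr_gt0.
  rewrite (_ : _ * _ = c1 * (x%:R `^ (v / 8) * x%:R `^ 1 * x%:R `^ (- (v / 2)))); last first.
    by rewrite powRr1 // /c1 /E; ring.
  by rewrite !pD ler_wpM2l // mono // /e; lra.
have t2 : E * (2 * T%:R) <= 4 * x%:R `^ (1 - 2 * e).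
  apply: (@le_trans _ _ (E * (2 * (2 * x%:R `^ 2^-1)))).
    by rewrite ler_pM2l // ler_pM2l.
  rewrite (_ : _ * _ = 4 * (x%:R `^ (v / 8) * x%:R `^ 2^-1)); last by rewrite /E; ring.
  by rewrite pD ler_pM2l // mono // /e; lra.
have t3 : x%:R * E `^ (- v) <= x%:R `^ (1 - 2 * e).
  rewrite /E -powRrM -{1}(powRr1 (ltW x0)) pD mono // /e; lra.
apply: (@le_trans _ _ ((c1 + 4 + c3) * x%:R `^ (1 - 2 * e) * H)).
  set w := 12 * _ * _; set z := x%:R * _.
  rewrite (_ : _ + _ = (E * w + E * (2 * T%:R) + c3 * z) * H); last by ring.
  rewrite ler_wpM2r // [leRHS]mulrDl; apply: lerD; last exact: ler_wpM2l.
  by rewrite [leRHS]mulrDl; exact: lerD.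
apply: (@le_trans _ _ ((c1 + 4 + c3) * x%:R `^ (1 - 2 * e) * ((1 + e^-1) * x%:R `^ e))).
  by rewrite ler_wpM2l // mulr_ge0 ?powR_ge0.
rewrite (_ : _ * _ = (c1 + 4 + c3) * (1 + e^-1) * (x%:R `^ (1 - 2 * e) * x%:R `^ e)); last by ring.
by rewrite pD ler_wpM2l // mono //; lra.
Qed.

End AveragePower.

Section HalfPower.
Variable R : realType.

(** The unit [d] of all small exponents. As [kappa d = 1/400] and [d <= 1/800], the total loss
    [2 kappa d + 2 d] in [eps_bound] is below the available margin [17/72 - 16/72]. *)
Definition delta (kappa : R) : R := (20 * (20 * kappa))^-1.

(** The first entry is what the smoothing term saves, [d] minus [d/4] each for the divisor bound and
    the harmonic sum; the second is the saving of [aS_average_power]. *)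
Definition rate (kappa : R) : R := Num.min (delta kappa / 2) (nu kappa ^+ 2 / 16).

Lemma delta_gt0 kappa : 2 <= kappa -> 0 < delta kappa.
Proof. by move=> k2; rewrite invr_gt0 !mulr_gt0 ?ltr0n //; apply: lt_le_trans k2. Qed.

Lemma delta_leq kappa : 2 <= kappa -> 40 * (20 * delta kappa) <= 1.
Proof.
move=> k2; have d0 := delta_gt0 k2.
have : 20 * (20 * kappa) * delta kappa = 1 by rewrite mulfV // -invr_eq0 gt_eqF.
have : 2 * delta kappa <= kappa * delta kappa by rewrite ler_pM2r.
by move: (delta kappa) => d; lra.
Qed.

Lemma rate_gt0 kappa : 2 <= kappa -> 0 < rate kappa.
Proof.
by move=> k2; rewrite lt_min; apply/andP; split; apply: divr_gt0 => //;
  [exact: delta_gt0 | apply: exprn_gt0; exact: nu_gt0].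
Qed.

Lemma powR_mulD (x s t : R) : 0 < x -> x `^ s * x `^ t = x `^ (s + t).
Proof. by move=> x0; rewrite powRD //; apply/implyP => _; rewrite gt_eqF. Qed.

Lemma powR_expn (x s : R) (n : nat) : 0 <= x -> (x `^ s) ^+ n = x `^ (s * n%:R).
Proof. by move=> x0; rewrite powRrM powR_mulrn ?powR_ge0. Qed.

Lemma ler_mulD1 (c d x y : R) : 0 <= c -> 0 <= d -> 1 <= x -> 1 <= y ->
  (1 + c * x) * (1 + d * y) <= (1 + c) * (1 + d) * (x * y).
Proof.
move=> c0 d0 x1 y1; rewrite mulrACA; apply: ler_pM.
- by rewrite addr_ge0 // mulr_ge0 // (le_trans ler01).
- by rewrite addr_ge0 // mulr_ge0 // (le_trans ler01).
- by rewrite mulrDl mul1r lerD2r.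
- by rewrite mulrDl mul1r lerD2r.
Qed.

Lemma ler_mulD1B (y z : R) : 0 <= y -> y <= z -> z <= 1 -> (1 + y) ^+ 2 - 1 <= 3 * z.
Proof. by move=> *; nra. Qed.

(** The powers of [M] in the first term add up to [kappa (1 - eta) + 2 kappa d + d - eta/4], where
    [kappa (1 - eta) < 2/9] and [eta/4 > 17/72]. In the second, [T D / S1] and [T D / S2] are
    O([M^(- 7d/4)]), and the outer [T] costs [M^(d/4)]. *)
Lemma eps_bound (kappa eta C0 T1 M k0 D G T S1 S2 : R) (d := delta kappa) :
  2 <= kappa -> 17 / 18 < eta -> 1 - 2 / (9 * kappa) < eta -> eta <= 1 -> 1 <= C0 -> 1 <= T1 -> 1 <= M ->
  G = M `^ ((kappa - 1) * (1 - eta + 2 * d)) -> D = M `^ (eta - 3 * d) -> T = T1 * M `^ (d / 4) ->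
  k0 = 2 * (G * (T * M `^ (- ((eta - 3 * d) / 4)))) ->
  M `^ (eta - d) <= S1 -> M `^ (1 - d) <= S2 ->
  k0 * ((1 + C0 * M / S1) * (1 + C0 * M / S2)) + T * ((1 + T * D / S1) * (1 + T * D / S2) - 1)
  <= (2 * T1 * ((1 + C0) * (1 + C0)) + T1 * (T1 ^+ 2 + 2 * T1)) * M `^ (- d).
Proof.
move=> kappa2 eta17 etak eta1 C01 T11 M1 GE DE TE k0E S1E S2E.
have d0 : 0 < d by exact: delta_gt0.
have d1 : 40 * (20 * d) <= 1 by exact: delta_leq.
have k_gt0 : 0 < kappa by lra.
have kd : 20 * (20 * (kappa * d)) = 1.
  by rewrite /d /delta; field; rewrite gt_eqF.
have kx : kappa * (1 - eta) < 2 / 9.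
  have : 1 - eta < 2 / (9 * kappa) by lra.
  by rewrite invfM mulrA ltr_pdivlMr // mulrC.
have M0 : 0 < M by exact: lt_le_trans M1.
have pD (s t : R) : M `^ s * M `^ t = M `^ (s + t) by exact: powR_mulD.
have mono (s t : R) : s <= t -> M `^ s <= M `^ t by move=> st; exact: ler_powR.
have p0 (s : R) : 0 < M `^ s by exact: powR_gt0.
have p1 (s : R) : 0 <= s -> 1 <= M `^ s by move=> s0; rewrite -(powRr0 M); apply: mono.
have S10 : 0 < S1 by exact: lt_le_trans S1E.
have S20 : 0 < S2 by exact: lt_le_trans S2E.
have T10 : 0 < T1 by lra.
have C00 : 0 <= C0 by lra.
have inv1 (S s t c : R) : 0 <= c -> M `^ s <= S -> c * M `^ t / S <= c * M `^ (t - s).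
  move=> c0 sS; rewrite -mulrA; apply: ler_wpM2l => //.
  rewrite -pD; apply: ler_wpM2l; first exact/ltW/p0.
  by rewrite powRN lef_pV2 ?posrE // (lt_le_trans _ sS).
have M_1 : M = M `^ 1 by rewrite powRr1 // ltW.
have T0 : 0 <= T by rewrite TE mulr_ge0 // ltW.
have TD : T * D = T1 * M `^ (d / 4 + (eta - 3 * d)) by rewrite TE DE -mulrA pD.
rewrite [leRHS]mulrDl; apply: lerD.
  have -> : k0 = 2 * T1 * M `^ ((kappa - 1) * (1 - eta + 2 * d) + (d / 4 - (eta - 3 * d) / 4)).
    by rewrite k0E GE TE -!pD; ring.
  apply: (@le_trans _ _ (2 * T1 * M `^ ((kappa - 1) * (1 - eta + 2 * d) + (d / 4 - (eta - 3 * d) / 4))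
     * ((1 + C0) * (1 + C0) * (M `^ (1 - (eta - d)) * M `^ (1 - (1 - d)))))).
    apply: ler_wpM2l; first by rewrite !mulr_ge0 // ltW.
    apply: le_trans (ler_mulD1 C00 C00 (p1 _ _) (p1 _ _)); try lra.
    have nn (c S : R) : 0 < S -> 0 <= c -> 0 <= 1 + c / S by move=> *; rewrite addr_ge0 // divr_ge0 // ltW.
    apply: ler_pM; try by apply: nn => //; rewrite mulr_ge0 // ltW.
      by rewrite lerD2l {1}M_1; exact: inv1.
    by rewrite lerD2l {1}M_1; exact: inv1.
  set P1 := M `^ _; rewrite (_ : _ * _ = 2 * T1 * ((1 + C0) * (1 + C0)) *
     (P1 * (M `^ (1 - (eta - d)) * M `^ (1 - (1 - d))))); last by ring.
  apply: ler_wpM2l; first by rewrite !mulr_ge0 ?addr_ge0 // ltW.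
  rewrite /P1 !pD; apply: mono.
  rewrite [leLHS](_ : _ = kappa * (1 - eta) + 2 * (kappa * d) + d / 4 - (eta - 3 * d) / 4); last by ring.
  by move: (kappa * d) kd => kd' kd; lra.
rewrite -[leRHS]mulrA [X in X * (_ - 1)]TE -[leLHS]mulrA; apply: ler_wpM2l; first exact: ltW.
pose y := T1 * M `^ (- (7 / 4 * d)).
have y0 : 0 <= y by rewrite mulr_ge0 // ltW.
have y1 : T * D / S1 <= y.
  rewrite TD; apply: le_trans (inv1 _ _ _ _ (ltW T10) S1E) _.
  by apply: ler_wpM2l; [exact: ltW | apply: mono; lra].
have y2 : T * D / S2 <= y.
  rewrite TD; apply: le_trans (inv1 _ _ _ _ (ltW T10) S2E) _.
  by apply: ler_wpM2l; [exact: ltW | apply: mono; lra].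
have D0 : 0 <= D by rewrite DE ltW.
have y10 : 0 <= T * D / S1 by rewrite divr_ge0 ?mulr_ge0 // ltW.
have y20 : 0 <= T * D / S2 by rewrite divr_ge0 ?mulr_ge0 // ltW.
apply: (@le_trans _ _ (M `^ (d / 4) * (y ^+ 2 + 2 * y))).
  apply: ler_wpM2l; first exact/ltW/p0.
  have : (1 + T * D / S1) * (1 + T * D / S2) <= (1 + y) * (1 + y).
    by apply: ler_pM; rewrite ?addr_ge0 // lerD2l.
  rewrite (_ : (1 + y) * (1 + y) = y ^+ 2 + 2 * y + 1); last by ring.
  by move=> ?; rewrite lerBlDr.
have -> : M `^ (d / 4) * (y ^+ 2 + 2 * y) =
  T1 ^+ 2 * (M `^ (d / 4) * (M `^ (- (7 / 4 * d)) * M `^ (- (7 / 4 * d)))) +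
  2 * T1 * (M `^ (d / 4) * M `^ (- (7 / 4 * d))) by rewrite /y; ring.
rewrite !pD [leRHS]mulrDl; apply: lerD; apply: ler_wpM2l.
- by rewrite exprn_ge0 // ltW.
- by apply: mono; lra.
- by rewrite mulr_ge0 // ltW.
- by apply: mono; lra.
Qed.

End HalfPower.

Section HalfPower2.
Variable R : realType.

Lemma half_power (kappa eta alpha C : R) (A B1 B2 : set R) (a b a1 b1 a2 b2 C0 Ch : R) :
  2 <= kappa -> 17 / 18 < eta -> 1 - 2 / (9 * kappa) < eta -> eta <= 1 -> 0 < C ->
  (forall (p : int) (q : nat), (0 < q)%N -> C / q%:R `^ kappa < `|alpha - p%:~R / q%:R|) ->
  between A a b -> between B1 a1 b1 -> between B2 a2 b2 -> 1 <= C0 -> 0 <= Ch ->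
  exists2 K : R, 0 <= K & forall (M L : R) (X : nat), 1 <= M -> 8 <= M `^ (delta kappa) ->
    (0 < X)%N -> X%:R <= C0 * M ->
    (forall (u : nat) (h : int), (0 < u <= X)%N -> h \in Hseq alpha A a b u ->
       `|h%:~R| <= Ch * u%:R * M) ->
    (forall (u : nat) (h : int), (0 < u <= X)%N -> h \in Hseq alpha A a b u ->
       u%:R * (`|a2| + `|b2|) + `|h%:~R| + 2 * M <= L) ->
    `|\sum_(N <- zitv M (M + M `^ eta)) N%:~R^-1 * (Psum alpha A B1 B2 a b X L N
        - (b - a) * \sum_(1 <= u < X.+1) overlap a1 b1 a2 b2 (u%:R / N%:~R))| <=
    K * M `^ (eta - rate kappa).
Proof.
move=> kappa2 eta17 etak eta1 C_gt0 dioph btwA btw1 btw2 C01 Ch0.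
have C00 : 0 <= C0 by apply: le_trans C01.
have [ab Aop Acl] := btwA.
have [Kh Kh0 half] := half_estimate kappa2 C_gt0 dioph btwA btw1 btw2 C00 Ch0.
have [Kp Kp0 avg] := aS_average_power kappa2 C_gt0 dioph ab Aop Acl.
set d := delta kappa; have d0 : 0 < d by exact: delta_gt0.
have d1 : 40 * (20 * d) <= 1 by exact: delta_leq.
have d4 : 0 < d / 4 by rewrite divr_gt0.
have [Ct Ct0 tauC] := tau_powR_bound d4.
have v0 : 0 < nu kappa by exact: nu_gt0.
have v1 : nu kappa <= 1 by exact: nu_le1.
have vv : nu kappa ^+ 2 <= 1 by rewrite exprn_ile1 // ltW.
pose sg := nu kappa ^+ 2 / 16.
have sg0 : 0 < sg by rewrite divr_gt0 ?exprn_gt0.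
have sg1 : sg <= 1 by rewrite /sg; lra.
have s_d : rate kappa <= d / 2 by rewrite /rate ge_min lexx.
have s_sg : rate kappa <= sg by rewrite /rate ge_min lexx orbT.
pose T1 := 1 + Ct * C0 `^ (d / 4).
have T11 : 1 <= T1 by rewrite lerDl mulr_ge0 ?powR_ge0 // ltW.
have T10 : 0 <= T1 by apply: le_trans T11.
pose Hc := (1 + (d / 4)^-1) * C0 `^ (d / 4).
have Hc0 : 0 <= Hc by rewrite mulr_ge0 ?powR_ge0 // addr_ge0 // invr_ge0 ltW.
pose Ke := 2 * T1 * ((1 + C0) * (1 + C0)) + T1 * (T1 ^+ 2 + 2 * T1).
have Ke0 : 0 <= Ke.
  apply: addr_ge0; first by rewrite !mulr_ge0 // addr_ge0.
  by rewrite mulr_ge0 // addr_ge0 ?exprn_ge0 // mulr_ge0.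
pose Kd := Kp * C0 `^ (1 - sg).
have Kd0 : 0 <= Kd by rewrite mulr_ge0 ?powR_ge0.
exists (Kh * (Ke + (T1 + Ke) * 4 * Hc + T1 * Hc + (T1 * Hc + Kd))).
  by apply: mulr_ge0 => //; do !apply: addr_ge0 => //; do !apply: mulr_ge0 => //; apply: addr_ge0.
move=> M L X M1 M8 X0 XM hM LL.
have M0 : 0 < M by exact: lt_le_trans M1.
have pD (s t : R) : M `^ s * M `^ t = M `^ (s + t) by exact: powR_mulD.
have mono (s t : R) : s <= t -> M `^ s <= M `^ t by move=> st; exact: ler_powR.
have p0 (s : R) : 0 < M `^ s by exact: powR_gt0.
have p1 (s : R) : 0 <= s -> 1 <= M `^ s by move=> s0; rewrite -(powRr0 M); apply: mono.
have M_1 : M = M `^ 1 by rewrite powRr1 // ltW.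
have ed0 : 0 <= eta - d by move: d0 d1 eta17; clear; lra.
have d10 : 0 <= 1 - d by move: d0 d1; clear; lra.
have [S1 [S10 S1ge S1le]] := ceil_powR M1 ed0.
have [S2 [S20 S2ge S2le]] := ceil_powR M1 d10.
(* The assumption [8 <= M^d] lets a loss of [d] in the exponent pay for the numerical constants in
   the size conditions on [S1] and [S2]. *)
have le8 (t : R) : 8 * M `^ (t - d) <= M `^ t.
  have -> : M `^ t = M `^ d * M `^ (t - d) by rewrite pD addrC subrK.
  by rewrite ler_wpM2r // ltW.
have V1 : 1 <= M `^ eta by apply: p1; move: eta17; clear; lra.
have VM : M `^ eta <= M by rewrite {2}M_1; exact: mono.
pose T := T1 * M `^ (d / 4).
have T0 : 0 < T by rewrite mulr_gt0 // (lt_le_trans _ T11).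
have T_1 : 1 <= T by rewrite -[leLHS]mulr1 ler_pM // p1 // ltW.
have Xe : X%:R `^ (d / 4) <= C0 `^ (d / 4) * M `^ (d / 4).
  rewrite -powRM ?(ltW M0) //; apply: ge0_ler_powR; rewrite ?nnegrE ?(ltW d4) ?mulr_ge0 ?(ltW M0) //.
have tT u : (0 < u <= X)%N -> (tau u)%:R <= T.
  move=> /andP[u0 uX]; apply: le_trans (tauC u u0) _.
  apply: (@le_trans _ _ (Ct * (C0 `^ (d / 4) * M `^ (d / 4)))).
    apply: ler_wpM2l; first exact: ltW.
    by apply: le_trans Xe; apply: ge0_ler_powR; rewrite ?nnegrE ?(ltW d4) // ler_nat.
  by rewrite mulrA ler_wpM2r ?(ltW (p0 _)) // lerDr.
have H_le : harmonic_sum R X <= Hc * M `^ (d / 4).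
  apply: le_trans (harmonic_sum_powR d4 X0) _; rewrite -mulrA ler_wpM2l //.
  by rewrite addr_ge0 // invr_ge0 ltW.
(* [G^(- nu)] is [M^(- (1 - eta + 2d))], so bad pairs cost [M^(eta - 2d)] up to the divisor bound
   and the logarithm. [k0] below is [2 G T D^(- 1/4)], which makes
   [D * k0 ^+ 4 = 16 * G ^+ 4 * T ^+ 4]. *)
pose G := M `^ ((kappa - 1) * (1 - eta + 2 * d)); pose D := M `^ (eta - 3 * d).
pose k0 := 2 * (G * (T * M `^ (- ((eta - 3 * d) / 4)))).
have k00 : 0 <= k0 by rewrite !mulr_ge0 // ?powR_ge0 // ltW.
have kG : 2 * G ^+ 4 * T ^+ 3 <= D * k0 ^+ 4.
  rewrite (_ : D * k0 ^+ 4 = 16 * (G ^+ 4 * T ^+ 4) * (D * (M `^ (- ((eta - 3 * d) / 4))) ^+ 4)); last first.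
    by rewrite /k0; ring.
  rewrite powR_expn ?(ltW M0) // /D pD [X in M `^ X](_ : _ = 0) ?powRr0 ?mulr1; last by field.
  rewrite (_ : 16 * (G ^+ 4 * T ^+ 4) = 2 * G ^+ 4 * T ^+ 3 * (8 * T)); last by ring.
  rewrite ler_peMr //; last by move: T_1; clear; lra.
  by rewrite !mulr_ge0 ?exprn_ge0 ?powR_ge0 // ltW.
have Dd x : (x <= X)%N ->
    `|\sum_(1 <= u < x.+1) (aS alpha A a b u - (b - a))| <= Kd * M `^ (1 - sg).
  move=> xX; apply: le_trans (avg X x X0 xX) _; rewrite /Kd -mulrA; apply: ler_wpM2l => //.
  rewrite -powRM ?(ltW M0) //; apply: ge0_ler_powR; rewrite ?nnegrE ?mulr_ge0 ?(ltW M0) //.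
  by rewrite subr_ge0.
have S1V : S1%:R <= M `^ eta.
  by apply: le_trans (le8 eta); apply: le_trans S1le _; rewrite ler_wpM2r ?ler_nat // ltW.
have S2M : S2%:R <= M.
  rewrite [leRHS]M_1; apply: le_trans (le8 1); apply: le_trans S2le _.
  by rewrite ler_wpM2r ?ler_nat // ltW.
have S1M : 4 * S1%:R <= M.
  apply: le_trans VM; apply: le_trans (le8 eta).
  rewrite (_ : 8 * M `^ (eta - d) = 4 * (2 * M `^ (eta - d))); last by ring.
  by rewrite ler_pM2l.
have LL' (u : nat) (h : int) : (0 < u <= X)%N -> h \in Hseq alpha A a b u ->
    u%:R * (`|a2| + `|b2|) + `|h%:~R| + 2 * S2%:R <= L.
  by move=> uX hH; apply: le_trans (LL u h uX hH); rewrite lerD2l ler_pM2l.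
have G0 : 0 < G by exact: p0.
have D0 : 0 <= D by exact/ltW/p0.
apply: le_trans (half M (M `^ eta) L X S1 S2 T G D k0 _ _ M1 V1 VM XM hM S10 S1M S1V S20 S2M
  D0 k00 G0 (ltW T0) tT kG LL' erefl Dd) _.
set eps0 := k0 * _ + _.
have epsle : eps0 <= Ke * M `^ (- d) by exact: (@eps_bound R kappa eta C0 T1 M k0 D G T S1%:R S2%:R kappa2 eta17 etak eta1 C01 T11 M1 erefl erefl erefl erefl S1ge S2ge).
rewrite -[leRHS]mulrA; apply: ler_wpM2l => //; set H := harmonic_sum R X in H_le *.
have H0 : 0 <= H by exact: harmonic_sum_ge0.
have eps0' : eps0 <= Ke * M `^ (d / 4) by apply: le_trans epsle _; rewrite ler_wpM2l // mono //; move: d0 d1 s_d s_sg eta17 eta1 sg0; clear; lra.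
have ep0 : 0 <= eps0.
  rewrite /eps0 addr_ge0 // mulr_ge0 //; first by rewrite mulr_ge0 // addr_ge0 // divr_ge0 // mulr_ge0 // ltW.
    exact: ltW.
  by rewrite subr_ge0 -[leLHS]mulr1 ler_pM // lerDl divr_ge0 ?mulr_ge0 // ltW.
move: eps0 epsle eps0' ep0 => eps0 epsle eps0' ep0.
have pM (s : R) : M `^ s * M = M `^ (s + 1) by rewrite {2}M_1.
have Q_le : S1%:R + M `^ eta * S2%:R / M <= 4 * M `^ (eta - d).
  have : M `^ eta * S2%:R / M <= 2 * M `^ (eta - d).
    rewrite ler_pdivrMr // -mulrA pM.
    have -> : M `^ (eta - d + 1) = M `^ eta * M `^ (1 - d) by rewrite pD; congr (_ `^ _); ring.
    by rewrite mulrCA ler_pM2l.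
  by move: S1le; clear; lra.
have Q0 : 0 <= S1%:R + M `^ eta * S2%:R / M.
  by rewrite addr_ge0 // divr_ge0 ?mulr_ge0 // ltW.
have s1 : eps0 * M `^ eta <= Ke * M `^ (eta - rate kappa).
  apply: (@le_trans _ _ (Ke * M `^ (- d) * M `^ eta)); first by rewrite ler_pM2r.
  by rewrite -mulrA pD ler_wpM2l // mono //; move: d0 d1 s_d s_sg eta17 eta1 sg0; clear; lra.
have s2 : (T + eps0) * (S1%:R + M `^ eta * S2%:R / M) * H <=
    (T1 + Ke) * 4 * Hc * M `^ (eta - rate kappa).
  apply: (@le_trans _ _ ((T1 + Ke) * M `^ (d / 4) * (4 * M `^ (eta - d)) * (Hc * M `^ (d / 4)))).
    apply: ler_pM => //; first by rewrite mulr_ge0 // addr_ge0 // ltW.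
    by apply: ler_pM => //; [rewrite addr_ge0 // ltW | rewrite mulrDl lerD2l].
  rewrite (_ : _ * _ = (T1 + Ke) * 4 * Hc * (M `^ (d / 4) * M `^ (eta - d) * M `^ (d / 4))); last by ring.
  rewrite !pD; apply: ler_wpM2l; first by apply: mulr_ge0 => //; apply: mulr_ge0 => //; exact: addr_ge0.
  by apply: mono; move: d0 d1 s_d s_sg eta17 eta1 sg0; clear; lra.
have s3 : T * (M * G `^ (- nu kappa)) * H <= T1 * Hc * M `^ (eta - rate kappa).
  have -> : M * G `^ (- nu kappa) = M `^ (eta - 2 * d).
    rewrite {1}M_1 /G -powRrM pD /nu; congr (_ `^ _).
    by field; rewrite gt_eqF //; move: kappa2; clear; lra.
  apply: (@le_trans _ _ (T1 * M `^ (d / 4) * M `^ (eta - 2 * d) * (Hc * M `^ (d / 4)))).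
    by apply: ler_wpM2l => //; rewrite mulr_ge0 ?powR_ge0 // ltW.
  rewrite (_ : _ * _ = T1 * Hc * (M `^ (d / 4) * M `^ (eta - 2 * d) * M `^ (d / 4))); last by ring.
  rewrite !pD; apply: ler_wpM2l; first by rewrite mulr_ge0.
  by apply: mono; move: d0 d1 s_d s_sg eta17 eta1 sg0; clear; lra.
have s4 : M `^ eta / M * (T * H + Kd * M `^ (1 - sg)) <= (T1 * Hc + Kd) * M `^ (eta - rate kappa).
  have -> : M `^ eta / M = M `^ (eta - 1) by rewrite -pD powR_inv1 // ltW.
  rewrite mulrDr mulrDl; apply: lerD.
    apply: (@le_trans _ _ (M `^ (eta - 1) * (T1 * M `^ (d / 4) * (Hc * M `^ (d / 4))))).
      by rewrite ler_pM2l // ler_wpM2l // mulr_ge0 // ltW.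
    rewrite (_ : _ * _ = T1 * Hc * (M `^ (eta - 1) * (M `^ (d / 4) * M `^ (d / 4)))); last by ring.
    rewrite !pD; apply: ler_wpM2l; first by rewrite mulr_ge0.
    by apply: mono; move: d0 d1 s_d s_sg eta17 eta1 sg0; clear; lra.
  rewrite mulrCA pD; apply: ler_wpM2l => //; apply: mono.
  by move: d0 d1 s_d s_sg eta17 eta1 sg0; clear; lra.
rewrite [leRHS]mulrDl; apply: lerD; last exact: s4.
rewrite [leRHS]mulrDl; apply: lerD; last exact: s3.
by rewrite [leRHS]mulrDl; apply: lerD.
Qed.

End HalfPower2.

(** * Intervals, finite sums and assembly of the two halves *)

Section Intervals.
Variable R : realType.

Lemma bounded_interval_between (I : set R) : bounded_interval I ->
  exists a b, between I a b /\ ilength I = b - a.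
Proof.
move=> [Iitv Ibd]; have [->|/set0P[x0 Ix0]] := eqVneq I set0.
  (* The empty interval: any [a = b] serves as its end points. *)
  exists 0, 0; rewrite /ilength measure0 subr0; split=> //.
  by split=> // x; rewrite lt_asym.
have [m [mr Im]] := Ibd.
have Ib x : I x -> `|x| <= m + 1 by apply: Im; rewrite ltrDl.
have hl : has_lbound I by exists (- (m + 1)) => x /Ib; rewrite ler_norml => /andP[].
have hu : has_ubound I by exists (m + 1) => x /Ib; rewrite ler_norml => /andP[].
have IR := (is_intervalP I).1 Iitv.
have le_is : inf I <= sup I by apply: (@le_trans _ _ x0); [exact: ge_inf | exact: ub_le_sup].
exists (inf I), (sup I); split; last first.
  rewrite /ilength {1}IR lebesgue_measure_itv /Rhull (asboolT hl) (asboolT hu) /=.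
  rewrite lte_fin; move: le_is; rewrite le_eqVlt => /orP[/eqP ->|->].
    by rewrite ltxx subrr.
  by rewrite -EFinB.
split=> //.
  move=> x /andP[x1 x2]; rewrite IR /Rhull (asboolT hl) (asboolT hu) /= in_itv /=.
  by case: asbool => /=; case: asbool => /=; rewrite ?x1 ?x2 ?(ltW x1) ?(ltW x2).
by move=> x Ix; apply/andP; split; [exact: ge_inf | exact: ub_le_sup].
Qed.

Lemma between_opp (I : set R) (a b : R) : between I a b -> between [set - x | x in I] (- b) (- a).
Proof.
move=> [ab op cl]; split; first by rewrite lerN2.
  move=> x /andP[x1 x2]; exists (- x); last by rewrite opprK.
  by apply: op; rewrite ltrNl ltrNr x1 x2.
by move=> _ [x /cl /andP[x1 x2] <-]; rewrite !lerN2 x1 x2.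
Qed.

Lemma fsum_zitv (f : nat -> R) (M V : R) : 0 < M ->
  \sum_(N \in [set N : nat | M <= N%:R <= M + V]) f N = \sum_(N <- zitv M (M + V)) f `|N|%N.
Proof.
move=> M0; rewrite -(big_map absz xpredT f) [RHS]fsbig_seq; last first.
  rewrite map_inj_in_uniq ?zitv_uniq // => x y; rewrite !mem_zitv => /andP[x1 _] /andP[y1 _].
  have : 0 < x%:~R :> R by exact: lt_le_trans x1.
  have : 0 < y%:~R :> R by exact: lt_le_trans y1.
  by rewrite !ltr0z; clear; lia.
have -> // : [set N : nat | M <= N%:R <= M + V] = [set` [seq `|N|%N | N <- zitv M (M + V)]].
apply/seteqP; split=> n /=.
  by move=> h; apply/mapP; exists n%:Z => //; rewrite mem_zitv -pmulrn.
move=> /mapP[N]; rewrite mem_zitv => h ->; case/andP: (h) => h1 _.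
have : 0 < N%:~R :> R by exact: lt_le_trans h1.
by rewrite ltr0z => N0; rewrite pmulrn gez0_abs // ltW.
Qed.

(** [h] is within [absA] of [alpha u - u^2/2]; one factor [u] of [u^2] is at most [C0 M]. *)
Lemma Hseq_norm_leq (alpha : R) (A : set R) (a b C0 M : R) (u : nat) (h : int) :
  between A a b -> 1 <= M -> (0 < u)%N -> u%:R <= C0 * M -> h \in Hseq alpha A a b u ->
  `|h%:~R| <= (absA a b + C0 / 2 + `|alpha|) * u%:R * M.
Proof.
move=> [_ _ cl] M1 u_gt0 uM; rewrite (mem_Hseq _ cl) => /(inH_norm cl) hn.
have u1 : 1 <= u%:R :> R by rewrite ler1n.
have u0 : 0 <= u%:R :> R by [].
have e0 : 0 <= absA a b by rewrite /absA !addr_ge0.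
move: (absA a b) hn e0 => e hn e0.
have -> : h%:~R = h%:~R + u%:R ^+ 2 / 2 - alpha * u%:R - u%:R ^+ 2 / 2 + alpha * u%:R :> R by ring.
apply: le_trans (ler_normD _ _) _; rewrite !mulrDl; apply: lerD.
  apply: le_trans (ler_normB _ _) _; apply: lerD.
    by apply: (le_trans hn); rewrite -mulrA ler_peMr // -[leLHS]mulr1 ler_pM.
  rewrite ger0_norm ?divr_ge0 ?exprn_ge0 // expr2.
  rewrite (_ : C0 / 2 * u%:R * M = u%:R * (C0 * M) / 2); last by ring.
  by rewrite ler_pM2r ?invr_gt0 // ler_wpM2l.
by rewrite normrM normr_nat ler_peMr // mulr_ge0.
Qed.

End Intervals.

(** [R2_Psum] splits [R2] into the half for [(A, B1, B2)] and the half for [(- A, B2, B1)];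
    [half_power] handles both, and [overlap_riemann] evaluates the sum of the two main terms. *)
Lemma R2_sum_estimate (R : realType) (kappa eta alpha C : R) (A B1 B2 : set R) (a b a1 b1 a2 b2 : R) :
  2 <= kappa -> 17 / 18 < eta -> 1 - 2 / (9 * kappa) < eta -> eta <= 1 -> 0 < C ->
  (forall (p : int) (q : nat), (0 < q)%N -> C / q%:R `^ kappa < `|alpha - p%:~R / q%:R|) ->
  between A a b -> between B1 a1 b1 -> between B2 a2 b2 ->
  exists2 K : R, 0 <= K & forall M : R, 1 <= M -> b - a < M -> 8 <= M `^ (delta kappa) ->
    `|\sum_(N <- zitv M (M + M `^ eta)) (R2 `|N|%N A B1 B2 (phiN alpha `|N|%N)
        - (b - a) * ((b1 - a1) * (b2 - a2)))| <= K * M `^ (eta - rate kappa).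
Proof.
move=> kappa2 eta17 etak eta1 C_gt0 dioph btwA btw1 btw2.
have [ab _ _] := btwA; have [ab1 _ _] := btw1; have [ab2 _ _] := btw2.
have btwA' := between_opp btwA.
set A' := [set - x | x in A] in btwA'.
pose W := `|a1| + `|b1| + `|a2| + `|b2|.
have W0 : 0 <= W by rewrite /W !addr_ge0.
(* Differences [i - j] are at most [2 N W <= 4 M W], as [N <= M + V <= 2 M]; the 1 covers the
   rounding in [X]. *)
pose C0 := 4 * W + 1.
have C01 : 1 <= C0 by rewrite lerDr mulr_ge0.
have C00 : 0 <= C0 by apply: le_trans C01.
pose Ch := (absA a b + C0 / 2 + `|alpha|) + (absA (- b) (- a) + C0 / 2 + `|alpha|).
have e1 : 0 <= absA a b + C0 / 2 + `|alpha| by rewrite /absA !addr_ge0 // divr_ge0.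
have e2 : 0 <= absA (- b) (- a) + C0 / 2 + `|alpha| by rewrite /absA !addr_ge0 // divr_ge0.
have Ch0 : 0 <= Ch by rewrite addr_ge0.
have [K1 K10 H1] := half_power kappa2 eta17 etak eta1 C_gt0 dioph btwA btw1 btw2 C01 Ch0.
have [K2 K20 H2] := half_power kappa2 eta17 etak eta1 C_gt0 dioph btwA' btw2 btw1 C01 Ch0.
pose Cr := (b - a) * (2 * C0 + 2 + (b1 - a1) + 2 * (b2 - a2)).
have ba0 : 0 <= b - a by rewrite subr_ge0.
have Cr0 : 0 <= Cr.
  have [b10 b20] : 0 <= b1 - a1 /\ 0 <= b2 - a2 by rewrite !subr_ge0.
  apply: mulr_ge0 => //; apply: addr_ge0; last exact: mulr_ge0.
  by apply: addr_ge0 => //; rewrite addr_ge0 // mulr_ge0.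
exists (K1 + K2 + 2 * Cr); first by rewrite !addr_ge0 // mulr_ge0.
move=> M M1 baM M8; have M0 : 0 < M by exact: lt_le_trans M1.
pose X := (Num.truncn (4 * M * W)).+1.
have MW0 : 0 <= 4 * M * W by rewrite !mulr_ge0 // ltW.
have XC : X%:R <= C0 * M.
  have /andP[+ _] := truncn_itv MW0; rewrite /X -(natr1 (Num.truncn _)) => tr.
  rewrite (_ : C0 * M = 4 * M * W + M); last by rewrite /C0; ring.
  exact: lerD.
have XW : 4 * M * W <= X%:R by apply/ltW/truncnS_gt.
pose L := X%:R * W + Ch * X%:R * M + 2 * M.
have pX u : (0 < u <= X)%N -> [/\ (0 < u)%N, (u%:R : R) <= X%:R & u%:R <= C0 * M].
  by move=> /andP[u0 uX]; have uX' : (u%:R : R) <= X%:R by [rewrite ler_nat]; split=> //; apply: le_trans XC.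
have hM1 (u : nat) (h : int) : (0 < u <= X)%N -> h \in Hseq alpha A a b u -> `|h%:~R| <= Ch * u%:R * M.
  move=> /pX[u0 uX uM] hH; apply: le_trans (Hseq_norm_leq btwA M1 u0 uM hH) _.
  by rewrite ler_pM2r // ler_wpM2r // lerDl.
have hM2 (u : nat) (h : int) : (0 < u <= X)%N -> h \in Hseq alpha A' (- b) (- a) u ->
    `|h%:~R| <= Ch * u%:R * M.
  move=> /pX[u0 uX uM] hH; apply: le_trans (Hseq_norm_leq btwA' M1 u0 uM hH) _.
  by rewrite ler_pM2r // ler_wpM2r // lerDr.
have LLgen (u : nat) (h : int) (w : R) : (0 < u <= X)%N -> `|h%:~R| <= Ch * u%:R * M -> w <= W ->
    u%:R * w + `|h%:~R| + 2 * M <= L.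
  move=> /pX[u0 uX uM] hh wW; rewrite lerD2r; apply: lerD.
    apply: (@le_trans _ _ (u%:R * W)); first exact: ler_wpM2l.
    exact: ler_wpM2r.
  by apply: (le_trans hh); rewrite ler_pM2r // ler_wpM2l.
have w1 : `|a1| + `|b1| <= W by rewrite /W -addrA lerDl addr_ge0.
have w2 : `|a2| + `|b2| <= W by rewrite /W -(addrA (`|a1| + `|b1|)) lerDr addr_ge0.
have LL1 (u : nat) (h : int) : (0 < u <= X)%N -> h \in Hseq alpha A a b u ->
    u%:R * (`|a2| + `|b2|) + `|h%:~R| + 2 * M <= L.
  by move=> uX hH; apply: LLgen => //; exact: hM1.
have LL2 (u : nat) (h : int) : (0 < u <= X)%N -> h \in Hseq alpha A' (- b) (- a) u ->
    u%:R * (`|a1| + `|b1|) + `|h%:~R| + 2 * M <= L.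
  by move=> uX hH; apply: LLgen => //; exact: hM2.
have {}H1 := H1 M L X M1 M8 isT XC hM1 LL1.
have {}H2 := H2 M L X M1 M8 isT XC hM2 LL2.
set V := M `^ eta in H1 H2 *.
have V1 : 1 <= V by rewrite /V -(powRr0 M); apply: ler_powR => //; lra.
have VM : V <= M by rewrite /V -[leRHS](powRr1 (ltW M0)); apply: ler_powR.
pose rem (N : int) : R := N%:~R^-1 * ((b - a) * (\sum_(1 <= u < X.+1) (overlap a1 b1 a2 b2 (u%:R / N%:~R)
   + overlap a2 b2 a1 b1 (u%:R / N%:~R)) - N%:~R * ((b1 - a1) * (b2 - a2)))).
pose p1 (N : int) : R := N%:~R^-1 * (Psum alpha A B1 B2 a b X L N
        - (b - a) * \sum_(1 <= u < X.+1) overlap a1 b1 a2 b2 (u%:R / N%:~R)).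
pose p2 (N : int) : R := N%:~R^-1 * (Psum alpha A' B2 B1 (- b) (- a) X L N
        - (- a - - b) * \sum_(1 <= u < X.+1) overlap a2 b2 a1 b1 (u%:R / N%:~R)).
have dec N : N \in zitv M (M + V) ->
    R2 `|N|%N A B1 B2 (phiN alpha `|N|%N) - (b - a) * ((b1 - a1) * (b2 - a2)) = p1 N + p2 N + rem N
    /\ `|rem N| <= M^-1 * Cr.
  rewrite mem_zitv => /andP[MN NMV].
  have N0 : 0 < N%:~R :> R by exact: lt_le_trans MN.
  have [n nE] : exists n : nat, N = n%:Z.
    by exists `|N|%N; rewrite gez0_abs // -(ler0z R) ltW.
  rewrite nE absz_nat; rewrite nE -pmulrn in MN NMV N0.
  have n_gt0 : (0 < n)%N by rewrite -(ltr0n R).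
  have nW : 2 * (n%:R * W) <= X%:R.
    apply: le_trans XW; rewrite mulrA ler_wpM2r //.
    by move: NMV VM; clear; lra.
  split.
    rewrite (R2_Psum btwA btw1 btw2 n_gt0 (lt_le_trans baM MN) nW (L := L)); first last.
    - by move=> u h uX hH; apply: le_trans (LL2 u h uX hH); rewrite lerDl mulr_ge0 // ltW.
    - by move=> u h uX hH; apply: le_trans (LL1 u h uX hH); rewrite lerDl mulr_ge0 // ltW.
    rewrite /p1 /p2 /rem -/A' -!pmulrn big_split /=.
    by field; rewrite gt_eqF.
  have nW1 : n%:R * W <= X%:R.
    by apply: le_trans nW; rewrite ler_peMl ?mulr_ge0 ?ler1n.
  rewrite /rem -!pmulrn !normrM (ger0_norm ba0) ger0_norm ?invr_ge0 //.
  apply: ler_pM; rewrite ?invr_ge0 ?mulr_ge0 //; first by rewrite lef_pV2 ?posrE.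
  rewrite /Cr; apply: ler_wpM2l => //.
  apply: le_trans (overlap_riemann n_gt0 ab1 ab2 nW1) _.
  rewrite !lerD2r ler_pdivrMr // [leRHS]mulrDl; apply: lerD; last by rewrite ler_peMr // ler1n.
  by rewrite -mulrA ler_pM2l //; apply: (le_trans XC); rewrite ler_wpM2l.
have -> : \sum_(N <- zitv M (M + V)) (R2 `|N|%N A B1 B2 (phiN alpha `|N|%N)
        - (b - a) * ((b1 - a1) * (b2 - a2))) =
    \sum_(N <- zitv M (M + V)) p1 N + \sum_(N <- zitv M (M + V)) p2 N + \sum_(N <- zitv M (M + V)) rem N.
  by rewrite -!big_split /=; apply: eq_big_seq => N /dec[].
rewrite [leRHS]mulrDl; apply: le_trans (ler_normD _ _) _; apply: lerD.
  by rewrite [leRHS]mulrDl; apply: le_trans (ler_normD _ _) _; apply: lerD.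
apply: le_trans (ler_norm_sum _ _ _) _.
apply: (@le_trans _ _ (\sum_(N <- zitv M (M + V)) M^-1 * Cr)).
  by rewrite !big_seq; apply: ler_sum => N /dec[].
rewrite big_const_seq count_predT iter_addr_0 -[leLHS]mulr_natl.
apply: (@le_trans _ _ (2 * V * (M^-1 * Cr))).
  apply: ler_wpM2r; first by rewrite mulr_ge0 // invr_ge0 ltW.
  apply: le_trans (size_zitv_leq _) _; first by rewrite lerDl (le_trans ler01).
  by move: V1; clear; lra.
rewrite (_ : 2 * V * (M^-1 * Cr) = 2 * Cr * (V * M^-1)); last by ring.
apply: ler_wpM2l; first by rewrite mulr_ge0.
rewrite -(powR_inv1 (ltW M0)) /V powR_mulD //; apply: ler_powR => //.
have := delta_leq kappa2; have := delta_gt0 kappa2.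
have : rate kappa <= delta kappa / 2 by rewrite /rate ge_min lexx.
by move: (rate _) (delta _); clear => *; lra.
Qed.

Theorem theoremB1 (R : realType) (kappa eta : R) (kappa_gt0 : 0 < kappa)
  (eta_gt : Num.max (17 / 18) (1 - 2 / (9 * kappa)) < eta) (eta_le1 : eta <= 1) :
  exists2 s : R, 0 < s &
    forall alpha : R, diophantine kappa alpha ->
    forall A B1 B2 : set R,
      bounded_interval A -> bounded_interval B1 -> bounded_interval B2 ->
      exists K : R, \forall M \near +oo,
        `|average_R2 eta alpha A B1 B2 M - ilength A * ilength B1 * ilength B2|
          <= K * M `^ (- s).
Proof.
(* Type [kappa] implies type [k], and [k >= 2] makes [nu k] positive and at most 1. When [k = 2],
   the condition on [eta] becomes [8/9 < eta], which [17/18 < eta] gives. *)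
pose k := Num.max kappa 2.
have k2 : 2 <= k by rewrite le_max lexx orbT.
have k_kappa : kappa <= k by rewrite le_max lexx.
move: eta_gt; rewrite gt_max => /andP[eta17 etak].
have etak' : 1 - 2 / (9 * k) < eta.
  have [kap|kap] := leP kappa 2; last by rewrite /k (max_idPl (ltW kap)).
  by rewrite /k (max_idPr kap); lra.
exists (rate k); first exact: rate_gt0.
move=> alpha [_ [C C0 dioph]] A B1 B2.
move=> /bounded_interval_between[a [b [btwA ->]]].
move=> /bounded_interval_between[a1 [b1 [btw1 ->]]].
move=> /bounded_interval_between[a2 [b2 [btw2 ->]]].
have dioph' (p : int) (q : nat) : (0 < q)%N -> C / q%:R `^ k < `|alpha - p%:~R / q%:R|.
  move=> q0; apply: le_lt_trans (dioph p q q0); apply: ler_wpM2l; first exact: ltW.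
  have q1 : 1 <= q%:R :> R by rewrite ler1n.
  rewrite lef_pV2 ?posrE ?powR_gt0 ?ltr0n //; exact: ler_powR.
have [K K0 HK] := R2_sum_estimate k2 eta17 etak' eta_le1 C0 dioph' btwA btw1 btw2.
pose P := (b - a) * ((b1 - a1) * (b2 - a2)).
have P0 : 0 <= P.
  by case: btwA btw1 btw2 => [? _ _] [? _ _] [? _ _]; rewrite !mulr_ge0 ?subr_ge0.
exists (K + P); near=> M.
have M1 : 1 <= M by near: M; exact: nbhs_pinfty_ge.
have M0 : 0 < M by exact: lt_le_trans M1.
have baM : b - a < M by near: M; apply: nbhs_pinfty_gt; exact: num_real.
have M8 : 8 <= M `^ (delta k).
  have d0 := delta_gt0 k2.
  have -> : 8 = (8 `^ (delta k)^-1) `^ (delta k) :> R.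
    by rewrite -powRrM mulVf ?powRr1 // gt_eqF.
  apply: ge0_ler_powR; rewrite ?nnegrE ?powR_ge0 ?(ltW d0) ?(ltW M0) //.
have {HK} := HK M M1 baM M8.
rewrite /average_R2 fsum_zitv //; set V := M `^ eta.
set f : int -> R := fun N => R2 `|N|%N A B1 B2 (phiN alpha `|N|%N).
have V0 : 0 < V by exact: powR_gt0.
rewrite -mulrA -/P sumrB; set S := \sum_(N <- _) R2 _ _ _ _ _.
rewrite (_ : \sum_(N <- _) P = (size (zitv M (M + V)))%:R * P); last first.
  by rewrite big_const_seq count_predT iter_addr_0 mulr_natl.
set z := (size _)%:R => HK.
have MV : M <= M + V by rewrite lerDl ltW.
(* The number of [N] in the window differs from [M^eta] by at most 1; after division by [M^eta] this
   costs [P / V], whence the summand [P] in the constant. *)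
have z1 : `|z - V| <= 1.
  have := size_zitv_leq MV; have := size_zitv_geq MV; rewrite -/z => h1 h2.
  by rewrite ler_norml; apply/andP; split; lra.
have -> : V^-1 * S - P = V^-1 * (S - z * P) + V^-1 * ((z - V) * P).
  by field; rewrite gt_eqF.
apply: le_trans (ler_normD _ _) _; rewrite 2!(normrM V^-1) (normrM _ P) (ger0_norm P0).
rewrite (@ger0_norm _ V^-1) ?invr_ge0 ?(ltW V0) //.
rewrite mulrDl; apply: lerD.
  rewrite mulrC ler_pdivrMr // -mulrA /V powR_mulD // (addrC (- _)).
  exact: HK.
apply: (@le_trans _ _ (V^-1 * P)).
  by rewrite ler_wpM2l ?invr_ge0 ?(ltW V0) // ler_piMl.
rewrite mulrC ler_wpM2l // /V -powRN; apply: ler_powR => //.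
rewrite lerN2; have := delta_leq k2; have := delta_gt0 k2.
have : rate k <= delta k / 2 by rewrite /rate ge_min lexx.
by move: (rate _) (delta _) eta17; clear => *; lra.
Unshelve. all: by end_near.
Qed.
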